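(* Let $0<R_1<R_0<R_2$, and let $\Gamma_{R_0}$ be a closed subset of $\mathbb{S}_{R_0}$ with $\Gamma_{R_0}\neq\mathbb{S}_{R_0}$. Let $\Phi^{R_1,R_0,R_2}:L^2(\Gamma_{R_0},\mathbb{R}^3)\times L^2(\mathbb{S}_{R_1})\to L^2(\mathbb{S}_{R_2})$ be the operator $(\mathbf{m},h)\mapsto\Phi_0^{R_0,R_2}[\mathbf{m}]+\Phi_1^{R_1,R_2}[h]$. Then its nullspace is $$N(\Phi^{R_1,R_0,R_2})=\{(\mathbf{d},0):\ \mathbf{d}\in\mathcal{D}_{R_0},\ \operatorname{supp}(\mathbf{d})\subset\Gamma_{R_0}\}.$$
   Context: $\mathbb{S}_R=\{x\in\mathbb{R}^3:|x|=R\}$, with surface measure $\omega_R$. For $\mathbf{m}\in L^2(\Gamma_{R_0},\mathbb{R}^3)$ (identified with its extension by zero to $\mathbb{S}_{R_0}$) and $h\in L^2(\mathbb{S}_{R_1})$, define for $x\in\mathbb{S}_{R_2}$ $$\Phi_0^{R_0,R_2}[\mathbf{m}](x)=\frac{1}{4\pi}\int_{\Gamma_{R_0}}\mathbf{m}(y)\cdot\frac{x-y}{|x-y|^3}\,d\omega_{R_0}(y),\qquad \Phi_1^{R_1,R_2}[h](x)=\frac{1}{4\pi R_1}\int_{\mathbb{S}_{R_1}}h(y)\frac{|x|^2-R_1^2}{|x-y|^3}\,d\omega_{R_1}(y).$$ $\mathcal{D}_R$ is the space of tangential vector fields $\mathbf{h}\in L^2(\mathbb{S}_R,\mathbb{R}^3)$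 (i.e. $\mathbf{h}(x)\cdot x=0$ for a.e. $x$) that are weakly divergence-free: $\int_{\mathbb{S}_R}\nabla_{\mathbb{S}_R}f\cdot\mathbf{h}\,d\omega_R=0$ for all $f\in C^\infty(\mathbb{S}_R)$, $\nabla_{\mathbb{S}_R}$ being the surface gradient. *)

(* Defs.v *)
From HB Require Import structures.
From mathcomp Require Import all_boot all_order all_algebra.
From mathcomp Require Import all_classical all_reals all_analysis measurable_realfun.
Set Implicit Arguments.
Unset Strict Implicit.
Unset Printing Implicit Defensive.
Import Order.TTheory GRing.Theory Num.Theory.
Import numFieldNormedType.Exports.
Local Open Scope classical_set_scope.
Local Open Scope ring_scope.

(* Row vectors carry the sigma-algebra generated by the coordinates, as
   n.-tuple does in the library; on a realType it is the Borel one. *)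
Section measurable_rV.
Context (R : realType) (n : nat).

Definition rV_coord (i : 'I_n) (x : 'rV[R]_n) : measurableTypeR R := x 0 i.

Let rV_set0 : g_sigma_preimage rV_coord set0.
Proof. exact: sigma_algebra0. Qed.

Let rV_setC A : g_sigma_preimage rV_coord A -> g_sigma_preimage rV_coord (~` A).
Proof. exact: sigma_algebraC. Qed.

Let rV_bigcup (F : (set 'rV[R]_n)^nat) :
  (forall i, g_sigma_preimage rV_coord (F i)) ->
  g_sigma_preimage rV_coord (\bigcup_i (F i)).
Proof. exact: sigma_algebra_bigcup. Qed.

HB.instance Definition _ :=
  @isMeasurable.Build default_measure_display 'rV[R]_n
    (g_sigma_preimage rV_coord) rV_set0 rV_setC rV_bigcup.

End measurable_rV.

Lemma measurable_fun_rVP (R : realType) d (T : measurableType d) n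
    (f : T -> 'rV[R]_n) :
  (forall i, measurable_fun [set: T] (rV_coord i \o f)) ->
  measurable_fun [set: T] f.
Proof.
move=> mf.
have sub : g_sigma_preimage (fun i => rV_coord i \o f) `<=` measurable.
  apply: smallest_sub; first exact: sigma_algebra_measurable.
  case: n f mf => [|n] f mf; first by rewrite big_ord0.
  rewrite -bigcup_mkord_ord; apply: bigcup_sub => i Ii.
  by move=> A [B mB <-]; exact: mf.
rewrite g_sigma_preimage_comp in sub.
by move=> _ A mA; apply: sub; exists A.
Qed.

Section sphere.
Context {R : realType}.
Notation E := 'rV[R]_3.

(* The norm of the library on 'rV[R]_n is the sup norm; the Euclidean one is
   needed here. *)
Definition dot (u v : E) : R := \sum_i u 0 i * v 0 i.
Definition enorm (u : E) : R := Num.sqrt (dot u u).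
Definition sphere (r : R) : set E := [set x | enorm x = r].

Definition spherical (r : R) (p : measurableTypeR R * measurableTypeR R) : E :=
  \row_(i < 3) [:: r * sin p.1 * cos p.2; r * sin p.1 * sin p.2; r * cos p.1]`_i.

Definition angles : set (measurableTypeR R * measurableTypeR R) :=
  `[0, pi] `*` `[0, pi *+ 2].

(* Surface measure of the sphere of radius r, as a measure on R^3 carried by
   that sphere: (spherical r) has area element r ^ 2 sin(theta). *)
Definition sphere_measure (r : R) (A : set E) : \bar R :=
  (\int[lebesgue_measure \x lebesgue_measure]_(p in
     angles `&` spherical r @^-1` A) (r ^+ 2 * sin p.1)%:E)%E.

Let measurable_sin : measurable_fun [set: R] (sin : R -> R).
Proof. by apply: continuous_measurable_fun; exact: continuous_sin. Qed.

Let measurable_cos : measurable_fun [set: R] (cos : R -> R).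
Proof. by apply: continuous_measurable_fun; exact: continuous_cos. Qed.

Lemma measurable_spherical (r : R) :
  measurable_fun [set: measurableTypeR R * measurableTypeR R] (spherical r).
Proof.
apply: measurable_fun_rVP => i.
rewrite /comp /rV_coord /spherical.
under eq_fun do rewrite mxE.
have m1 := @measurable_fst _ _ (measurableTypeR R) (measurableTypeR R).
have m2 := @measurable_snd _ _ (measurableTypeR R) (measurableTypeR R).
case: i => -[|[|[|//]]] ? /=.
- apply: measurable_funM; last exact: (measurableT_comp measurable_cos m2).
  by apply: measurable_funM => //; exact: (measurableT_comp measurable_sin m1).
- apply: measurable_funM; last exact: (measurableT_comp measurable_sin m2).
  by apply: measurable_funM => //; exact: (measurableT_comp measurable_sin m1).
- by apply: measurable_funM => //; exact: (measurableT_comp measurable_cos m1).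
Qed.

Lemma measurable_angles : measurable angles.
Proof. by apply: measurableX; exact: measurable_itv. Qed.

Section sphere_measure_isMeasure.
Variable r : R.

Let density_ge0 p : angles p -> (0 <= (r ^+ 2 * sin p.1)%:E)%E.
Proof.
move=> [/= + _]; rewrite in_itv/= => p1.
by rewrite lee_fin mulr_ge0 ?sqr_ge0 ?sin_ge0_pi.
Qed.

Let sphere_measure0 : sphere_measure r set0 = 0%E.
Proof. by rewrite /sphere_measure preimage_set0 setI0 integral_set0. Qed.

Let sphere_measure_ge0 A : (0 <= sphere_measure r A)%E.
Proof. by apply: integral_ge0 => p [/density_ge0]. Qed.

Let sphere_measure_sigma_additive : semi_sigma_additive (sphere_measure r).
Proof.
move=> /= F mF tF mUF; rewrite /sphere_measure preimage_bigcup setI_bigcupr.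
rewrite ge0_integral_bigcup//=.
- apply: is_cvg_ereal_nneg_natsum_cond => n _ _.
  exact: sphere_measure_ge0.
- move=> k; apply: measurableI; first exact: measurable_angles.
  by rewrite -[X in measurable X]setTI; exact: measurable_spherical.
- apply/measurable_funTS/measurable_EFinP; apply: measurable_funM => //.
  apply: (measurableT_comp measurable_sin).
  exact: (@measurable_fst _ _ (measurableTypeR R) (measurableTypeR R)).
- by move=> p [k _ [/density_ge0]].
- apply/trivIsetP => i j _ _ ij.
  rewrite setIACA setIid -preimage_setI.
  by move/trivIsetP : tF => /(_ i j I I ij) ->; rewrite preimage_set0 setI0.
Qed.

HB.instance Definition _ := isMeasure.Build _ _ _ (sphere_measure r)
  sphere_measure0 sphere_measure_ge0 sphere_measure_sigma_additive.

End sphere_measure_isMeasure.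

Notation omega := sphere_measure.

Definition L2 (r : R) : set (E -> R) := [set f | f \in Lfun (omega r) 2%:E].

Definition L2vec (r : R) : set (E -> E) :=
  [set m | forall i, L2 r (fun x => m x 0 i)].

(* L^2 of a subset Gam of the sphere, identified through extension by zero. *)
Definition L2vec_on (Gam : set E) (r : R) : set (E -> E) :=
  [set m | L2vec r m /\ m = cst 0 %[ae omega r in ~` Gam]].

Definition grad (f : E -> R) (x : E) : E :=
  \row_i 'D_(delta_mx 0 i) f x.

Fixpoint cont_diff (n : nat) (U : set E) (f : E -> R) : Prop :=
  (forall x, U x -> {for x, continuous f}) /\
  if n is k.+1 then
    forall i : 'I_3, (forall x, U x -> derivable f x (delta_mx 0 i)) /\
      cont_diff k U ('D_(delta_mx 0 i) f)
  else True.

(* Extension of f from the sphere of radius r to R^3 \ {0}, constant along the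
   rays from 0. *)
Definition radial_ext (r : R) (f : E -> R) : E -> R :=
  fun x => f ((r / enorm x) *: x).

Definition smooth_on_sphere (r : R) (f : E -> R) : Prop :=
  forall n, cont_diff n [set~ 0] (radial_ext r f).

(* At a point of the sphere the gradient of the radially constant extension has
   no normal component, hence is the surface gradient. *)
Definition surface_grad (r : R) (f : E -> R) : E -> E := grad (radial_ext r f).

Definition tangential (r : R) (h : E -> E) : Prop :=
  {ae omega r, forall x, dot (h x) x = 0}.

Definition weak_div_free (r : R) (h : E -> E) : Prop :=
  forall f, smooth_on_sphere r f ->
    \int[omega r]_(x in sphere r) dot (surface_grad r f x) (h x) = 0.

Definition divfree_space (r : R) : set (E -> E) :=
  [set h | [/\ L2vec r h, tangential r h & weak_div_free r h]].

(* Support of an element of L^2, i.e. modulo omega-negligible sets. *)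
Definition ess_supp (r : R) (h : E -> E) : set E :=
  [set x | sphere r x /\
     forall U, nbhs x U -> ~ {ae omega r, forall y, U y -> h y = 0}].

Definition Phi0 (Gam : set E) (r0 : R) (m : E -> E) (x : E) : R :=
  (4 * pi)^-1 *
  \int[omega r0]_(y in Gam) (dot (m y) (x - y) / enorm (x - y) ^+ 3).

Definition Phi1 (r1 : R) (h : E -> R) (x : E) : R :=
  (4 * pi * r1)^-1 *
  \int[omega r1]_(y in sphere r1)
     (h y * ((enorm x ^+ 2 - r1 ^+ 2) / enorm (x - y) ^+ 3)).

Definition Phi (Gam : set E) (r1 r0 : R) (mh : (E -> E) * (E -> R)) : E -> R :=
  fun x => Phi0 Gam r0 mh.1 x + Phi1 r1 mh.2 x.

(* Elements of L^2 are given by their representatives: equality in L^2 of the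
   sphere of radius r2 is equality omega-almost everywhere, and the set is
   closed under changing m and h on negligible sets. *)
Definition Phi_nullspace (Gam : set E) (r1 r0 r2 : R) :
    set ((E -> E) * (E -> R)) :=
  [set mh | [/\ L2vec_on Gam r0 mh.1, L2 r1 mh.2 &
     Phi Gam r1 r0 mh = cst 0 %[ae omega r2]]].

End sphere.

(* Main.v *)
(* Idea.  Both potentials are integrals over a sphere of a numerator times
   |x - y|^-3.  If their sum vanishes on |x| = r2, it vanishes for |x| >= r2 by
   the maximum principle, and analytic continuation through the gap of Gam,
   along a segment and then along circular arcs, makes it vanish on the shell
   r1 < |x| < r0.  So Phi0 on |x| < r0 and - Phi1 on |x| > r1 glue to a harmonic
   function on R^3 that tends to 0 at infinity: Phi1 = 0 for |x| > r1, and
   Phi0 = 0 for |x| < r0 and for |x| >= r2.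
   On a ray, |l xi - y|^2 = (l^2 |xi|^2 + r^2) (1 - t (xi . y)), and the two
   points l xi exchanged by the inversion in the sphere share the same t.
   Expanding at t = 0, the integrals of h, m . y and m . xi against (xi . y)^k
   all vanish.  Differentiating in xi and approximating by Bernstein polynomials
   replaces these zonal polynomials by all C^1 functions, so that h = 0,
   m . y = 0, and m is orthogonal to surface gradients.  Conversely, for m
   tangential, Phi0 at x pairs m with the surface gradient of 1 / |x - y|. *)
Require Import Defs.
From HB Require Import structures.
From mathcomp Require Import all_boot all_order all_algebra.
From mathcomp Require Import all_classical all_reals all_analysis.
From mathcomp Require Import measurable_realfun.
From mathcomp Require Import ring lra.
Set Implicit Arguments.
Unset Strict Implicit.
Unset Printing Implicit Defensive.
Import Order.TTheory GRing.Theory Num.Theory.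
Import numFieldNormedType.Exports.
Local Open Scope classical_set_scope.
Local Open Scope ring_scope.

(** * Expansion of the power -3/2 of a quadratic polynomial *)

Section gegenbauer.
Context {R : realType}.
Implicit Types (c e k t q : R) (n N : nat).

(** Every expansion is in one real variable. A potential is restricted to a line, an arc or a ray
    along which |x - y|^2 is, up to a positive factor, a polynomial of degree at most 2 in the
    parameter; the integral then inherits the expansion of [kap], the power -3/2, with remainders
    uniform in y. Harmonicity is the statement that the second coefficients along the three axes add
    up to 0. Arcs are needed because radial segments through the gap reach only the cone over it;
    the rest of the shell is reached by moving on spheres |x| = l, where a rational parametrization
    keeps |x - y|^2 quadratic after clearing denominators. For a dipole, one point of a ray leaves
    two unknown integrals, those of m . xi and m . y. The inverse point supplies a second
    independent equation, so the potential has to vanish both near 0 and near infinity. Since m is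
    paired with gradients, polynomials must approximate in C^1. Bernstein operators do so, a
    derivative of one being the Bernstein operator of difference quotients. *)

Definition kap q : R := (Num.sqrt q ^+ 3)^-1.

Fixpoint geg_pair c e n : R * R :=
  if n is m.+1 then
    let p := geg_pair c e m in
    (p.2, (c * (2 * m.+2%:R + 1) * p.2 - e * (m.+3%:R) * p.1) / m.+2%:R)
  else (1, 3 * c).

(* The coefficients of (1 - 2 c t + e t ^ 2) ^ (-3/2) as a power series in t;
   for e = 1 these are the Gegenbauer polynomials of parameter 3/2. *)
Definition geg c e n : R := (geg_pair c e n).1.

Lemma geg0 c e : geg c e 0 = 1. Proof. by []. Qed.

Lemma geg1 c e : geg c e 1 = 3 * c. Proof. by []. Qed.

Lemma gegSS c e n : geg c e n.+2 =
  (c * (2 * n.+2%:R + 1) * geg c e n.+1 - e * n.+3%:R * geg c e n) / n.+2%:R.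
Proof. by []. Qed.

Lemma geg2 c e : geg c e 2 = (15 * c ^+ 2 - 3 * e) / 2.
Proof. by rewrite gegSS geg1 geg0; field. Qed.

Lemma nat_ind2 (P : nat -> Prop) : P 0%N -> P 1%N ->
  (forall n, P n -> P n.+1 -> P n.+2) -> forall n, P n.
Proof.
move=> P0 P1 PS n; have : P n /\ P n.+1; last by case.
by elim: n => [|n [Pn Pn1]]; split => //; exact: PS.
Qed.

(** Replacing t by k t in the generating function multiplies c by k and e by k ^ 2. *)
Lemma geg_homo k c e n : geg (k * c) (k ^+ 2 * e) n = k ^+ n * geg c e n.
Proof.
elim/nat_ind2: n => [||n IH0 IH1].
- by rewrite !geg0 expr0 mulr1.
- by rewrite !geg1 expr1 mulrCA.
- rewrite !gegSS IH0 IH1 !exprS; ring.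
Qed.

Lemma geg_e0 c n : geg c 0 n = geg 1 0 n * c ^+ n.
Proof.
by have := geg_homo c 1 0 n; rewrite mulr1 mulr0 mulrC.
Qed.

(** Positivity allows these coefficients to be divided out when moments are extracted in
    [zonal_moment]. *)
Lemma geg_gt0 n : 0 < geg 1 0 n.
Proof.
elim/nat_ind2: n => [||n _ IH1]; rewrite ?geg0 ?geg1 ?gegSS; [lra|lra|].
by rewrite !mul0r subr0 mul1r divr_gt0// mulr_gt0// addr_gt0// mulr_gt0.
Qed.

(** The ratio 4 is compatible with the recurrence because 4 (2 n + 5) + (n + 3) <= 16 (n + 2). *)
Lemma geg_le c e k n : 0 <= k -> `|c| <= k -> `|e| <= k ^+ 2 ->
  `|geg c e n| <= (4 * k) ^+ n.
Proof.
move=> k0 ck ek; elim/nat_ind2: n => [||n IH0 IH1].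
- by rewrite geg0 normr1 expr0.
- by rewrite geg1 expr1 normrM normr_nat; lra.
rewrite gegSS normrM normfV normr_nat ler_pdivrMr ?ltr0Sn//.
apply: (le_trans (ler_normB _ _)); rewrite !normrM !normr_nat.
have -> : `|2 * n.+2%:R + 1 : R| = 2 * n.+2%:R + 1.
  by rewrite ger0_norm// addr_ge0// mulr_ge0.
set X := (4 * k) ^+ n.
have X0 : 0 <= X by rewrite exprn_ge0// mulr_ge0.
have h1 : `|c| * (2 * n.+2%:R + 1) * `|geg c e n.+1| <=
    k * (2 * n.+2%:R + 1) * (4 * k * X).
  apply: ler_pM => //; rewrite ?mulr_ge0 ?addr_ge0 ?mulr_ge0//.
  - by rewrite ler_wpM2r// addr_ge0// mulr_ge0.
  - by rewrite -exprS.
have h2 : `|e| * n.+3%:R * `|geg c e n| <= k ^+ 2 * n.+3%:R * X.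
  by apply: ler_pM => //; rewrite ?mulr_ge0// ler_wpM2r.
apply: (le_trans (lerD h1 h2)).
rewrite !exprS -/X -[n.+3]addn3 -[n.+2]addn2 !natrD.
have kX : 0 <= k ^+ 2 * X by rewrite mulr_ge0// exprn_ge0.
have n0 : 0 <= n%:R :> R by [].
have nkX := mulr_ge0 n0 kX.
nra.
Qed.

Definition gegS c e N t : R := \sum_(n < N) geg c e n * t ^+ n.

Lemma is_derive_gegS c e N t : is_derive t 1 (gegS c e N)
  (\sum_(n < N) geg c e n * (n%:R * t ^+ n.-1)).
Proof.
have -> : gegS c e N = \sum_(n < N) (geg c e n *: (@GRing.exp R ^~ n)).
  by apply/funext => s; rewrite fct_sumE.
apply: is_derive_eq.
  apply: is_derive_sum => n; apply: is_deriveZ.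
  by apply: DeriveDef; [exact: exprn_derivable|exact: exp_derive].
by apply: eq_bigr => n _; rewrite /GRing.scale/= mulr1.
Qed.

(* Up to terms of order N, the partial sums satisfy the differential equation
   of (1 - 2 c t + e t ^ 2) ^ (-3/2). *)
Lemma gegS_ode c e N t :
  (1 - 2 * c * t + e * t ^+ 2) *
    (\sum_(n < N.+1) geg c e n * (n%:R * t ^+ n.-1))
  - 3 * (c - e * t) * gegS c e N.+1 t =
  - (N.+1%:R * geg c e N.+1 * t ^+ N) + e * N.+3%:R * geg c e N * t ^+ N.+1.
Proof.
elim: N => [|N IH].
  by rewrite /gegS !big_ord1 geg0 geg1 /= !expr0 expr1; ring.
rewrite /gegS in IH *; rewrite !(big_ord_recr N.+1) /=.
transitivity (- (N.+1%:R * geg c e N.+1 * t ^+ N) +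
    e * N.+3%:R * geg c e N * t ^+ N.+1 +
  ((1 - 2 * c * t + e * t ^+ 2) * (geg c e N.+1 * (N.+1%:R * t ^+ N)) -
    3 * (c - e * t) * (geg c e N.+1 * t ^+ N.+1))).
  by rewrite -IH; ring.
rewrite gegSS !exprS.
have h : N%:R + 2 != 0 :> R.
  by rewrite -natrD pnatr_eq0 addn2.
by field; rewrite addrC.
Qed.

(** The condition 16 k |t| <= 1 lets the residual term of order N + 1 be absorbed by the one of
    order N. *)
Lemma gegS_ode_bound c e k N t : 0 <= k -> `|c| <= k -> `|e| <= k ^+ 2 ->
  16 * k * `|t| <= 1 ->
  `|(1 - 2 * c * t + e * t ^+ 2) *
    (\sum_(n < N.+1) geg c e n * (n%:R * t ^+ n.-1))
  - 3 * (c - e * t) * gegS c e N.+1 t| <= 8 * k * N.+1%:R * (4 * k * `|t|) ^+ N.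
Proof.
move=> k0 ck ek tk; rewrite gegS_ode (le_trans (ler_normD _ _))//.
rewrite normrN !normrM !normrX !normr_nat.
set X := (4 * k) ^+ N; set T := `|t| ^+ N.
have X0 : 0 <= X by rewrite exprn_ge0// mulr_ge0.
have T0 : 0 <= T by rewrite exprn_ge0.
have h1 : N.+1%:R * `|geg c e N.+1| * T <= N.+1%:R * (4 * k * X) * T.
  by rewrite ler_wpM2r// ler_wpM2l// /X -exprS geg_le.
have h2 : `|e| * N.+3%:R * `|geg c e N| * `|t| ^+ N.+1 <=
    k ^+ 2 * N.+3%:R * X * (`|t| * T).
  rewrite -exprS ler_wpM2r ?exprn_ge0//.
  by apply: ler_pM; rewrite ?mulr_ge0 ?ler_wpM2r ?geg_le.
rewrite (le_trans (lerD h1 h2))// exprMn -/X -/T.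
rewrite -[N.+3]addn3 -[N.+1]addn1 !natrD.
have XT : 0 <= k * (X * T) by rewrite !mulr_ge0.
have n0 : 0 <= N%:R :> R by [].
have nXT := mulr_ge0 n0 XT.
have h3 : k * `|t| * (k * (X * T)) <= 16^-1 * (k * (X * T)).
  by rewrite ler_wpM2r//; lra.
have h4 : k * `|t| * (N%:R * (k * (X * T))) <= 16^-1 * (N%:R * (k * (X * T))).
  by rewrite ler_wpM2r//; lra.
nra.
Qed.

Lemma kap_ge0 q : 0 <= kap q. Proof. by rewrite invr_ge0 exprn_ge0. Qed.

Lemma kap_le3 q : 3 / 4 <= q -> kap q <= 3.
Proof.
move=> q34; have s34 : 3 / 4 <= Num.sqrt q.
  by rewrite -[leLHS]ger0_norm ?divr_ge0// -sqrtr_sqr ler_wsqrtr//; lra.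
rewrite /kap -[leRHS]invrK lef_pV2 ?posrE ?exprn_gt0//; [|lra..].
rewrite (@le_trans _ _ ((3 / 4) ^+ 3))//; first by lra.
by rewrite lerXn2r ?nnegrE//; lra.
Qed.

Lemma quad_near1 c e k t : 0 <= k -> `|c| <= k -> `|e| <= k ^+ 2 ->
  16 * k * `|t| <= 1 -> 3 / 4 <= 1 - 2 * c * t + e * t ^+ 2 <= 5 / 4.
Proof.
move=> k0 ck ek tk.
have h1 : `|c * t| <= 16^-1.
  by rewrite normrM (@le_trans _ _ (k * `|t|))// ?ler_wpM2r//; lra.
have h2 : `|e * t ^+ 2| <= 16^-1.
  rewrite normrM normrX (@le_trans _ _ ((k * `|t|) ^+ 2))//.
    by rewrite exprMn ler_wpM2r// exprn_ge0.
  have : k * `|t| <= 16^-1 by lra.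
  have : 0 <= k * `|t| by rewrite mulr_ge0.
  nra.
move: h1 h2; rewrite !ler_norml => /andP[? ?] /andP[? ?].
by apply/andP; split; lra.
Qed.

(** The partial sum times the power 3/2 of the quadratic polynomial equals 1 at 0, and its
    derivative is the residual of the differential equation times a square root. The mean value
    theorem bounds its distance to 1, and multiplying by [kap] gives the remainder. *)
Lemma kap_taylor c e k t N : 0 < k -> `|c| <= k -> `|e| <= k ^+ 2 ->
  16 * k * `|t| <= 1 ->
  `|kap (1 - 2 * c * t + e * t ^+ 2) - gegS c e N t| <=
  12 * (8 * k * `|t|) ^+ N.
Proof.
move=> k_gt0 ck ek tk; have k0 := ltW k_gt0.
have P34 (s : R) : `|s| <= `|t| -> 3 / 4 <= 1 - 2 * c * s + e * s ^+ 2 <= 5 / 4.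
  move=> st; apply: (quad_near1 k0) => //.
  by rewrite (le_trans _ tk)// ler_wpM2l// mulr_ge0.
have {}/andP[P1 P2] := P34 t (lexx _).
case: N => [|N].
  rewrite /gegS big_ord0 subr0 expr0 mulr1 ger0_norm ?kap_ge0//.
  by rewrite (le_trans (kap_le3 _))//; lra.
pose P s : R := 1 - 2 * c * s + e * s ^+ 2.
pose G s := gegS c e N.+1 s * (P s * Num.sqrt (P s)).
pose D s := Num.sqrt (P s) * (P s *
    (\sum_(n < N.+1) geg c e n * (n%:R * s ^+ n.-1))
    - 3 * (c - e * s) * gegS c e N.+1 s).
have dP (s : R) : is_derive s 1 P (- 2 * c + 2 * e * s).
  have -> : P = horner (e *: 'X^2 - (2 * c) *: 'X + 1%:P).
    by apply/funext => u; rewrite /P !hornerE; ring.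
  apply: (is_derive_eq (is_derive_poly _ _)).
  by rewrite derivD derivB !derivZ derivXn derivX derivC !hornerE; ring.
have dG (s : R) : `|s| <= `|t| -> is_derive s 1 G (D s).
  move=> /P34 /andP[Ps _].
  have Ps0 : 0 < P s by rewrite (lt_le_trans _ Ps)//; lra.
  have dS := is_derive_gegS c e N.+1 s.
  have dsq : is_derive s 1 (Num.sqrt \o P)
      ((- 2 * c + 2 * e * s) * (2 * Num.sqrt (P s))^-1).
    apply: is_derive_eq; first exact: is_derive1_comp (is_derive1_sqrt Ps0) (dP s).
    by rewrite /GRing.scale/= mulrC.
  rewrite /G; apply: is_derive_eq.
  rewrite /D /GRing.scale/= /comp.
  have sq0 : Num.sqrt (P s) != 0 by rewrite gt_eqF// sqrtr_gt0.
  have := sqr_sqrtr (ltW Ps0); set q := Num.sqrt (P s) => q2.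
  by rewrite -q2; field.
have cG (s : R) : `|s| <= `|t| -> {for s, continuous G}.
  move=> /dG Gs; apply/differentiable_continuous/derivable1_diffP.
  exact: ex_derive.
have G1 : G 0 = 1.
  rewrite /G /P /gegS mulr0 subr0 expr0n mulr0 addr0 sqrtr1 !mulr1 big_ord_recl.
  by rewrite geg0 expr0 mulr1 big1 ?addr0// => i _; rewrite lift0 expr0n mulr0.
have DB (s : R) : `|s| <= `|t| ->
    `|D s| <= 16 * k * N.+1%:R * (4 * k * `|t|) ^+ N.
  move=> st; have /andP[Ps1 Ps2] := P34 _ st.
  have sP : `|Num.sqrt (P s)| <= 2.
    rewrite ger0_norm ?sqrtr_ge0// -[leRHS]ger0_norm// -sqrtr_sqr ler_wsqrtr//.
    by rewrite /P; lra.
  rewrite normrM (@le_trans _ _ (2 * (8 * k * N.+1%:R * (4 * k * `|s|) ^+ N)))//.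
    apply: ler_pM => //; apply: gegS_ode_bound => //.
    by rewrite (le_trans _ tk)// ler_wpM2l// mulr_ge0.
  rewrite !mulrA; apply: ler_pM => //; rewrite ?mulr_ge0 ?exprn_ge0 ?mulr_ge0//.
    by rewrite ler_wpM2r// ler_wpM2r//; lra.
  by rewrite lerXn2r ?nnegrE ?mulr_ge0// ler_wpM2l// mulr_ge0.
have GB : `|G t - 1| <= 16 * k * N.+1%:R * (4 * k * `|t|) ^+ N * `|t|.
  rewrite -{1}G1; have [t0|t0|->] := ltgtP t 0; last by rewrite subrr normr0 mulr0.
  - have [] := @MVT _ G D t 0 t0.
    + move=> s; rewrite in_itv/= => /andP[s1 s2]; apply: dG.
      by rewrite !ltr0_norm// lerN2 ltW.
    + apply: continuous_in_subspaceT => s; rewrite inE/= in_itv/= => /andP[s1 s2].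
      by apply: cG; rewrite ler0_norm// ler0_norm ?lerN2// ltW.
    move=> s; rewrite in_itv/= => /andP[s1 s2] h.
    rewrite distrC h normrM sub0r normrN ler_wpM2r// DB//.
    by rewrite !ltr0_norm// lerN2 ltW.
  - have [] := @MVT _ G D 0 t t0.
    + move=> s; rewrite in_itv/= => /andP[s1 s2]; apply: dG.
      by rewrite !gtr0_norm// ltW.
    + apply: continuous_in_subspaceT => s; rewrite inE/= in_itv/= => /andP[s1 s2].
      by apply: cG; rewrite !ger0_norm// ltW.
    move=> s; rewrite in_itv/= => /andP[s1 s2] h.
    rewrite h normrM subr0 ler_wpM2r// DB//.
    by rewrite !gtr0_norm// ltW.
have Pt0 : 0 < P t by rewrite (lt_le_trans _ P1)//; lra.
have sq0 : Num.sqrt (P t) != 0 by rewrite gt_eqF// sqrtr_gt0.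
have -> : kap (P t) - gegS c e N.+1 t = kap (P t) * (1 - G t).
  rewrite /G /kap; have := sqr_sqrtr (ltW Pt0); move: sq0.
  by set q := Num.sqrt (P t) => q0 <-; field.
rewrite normrM distrC (@le_trans _ _
  (3 * (16 * k * N.+1%:R * (4 * k * `|t|) ^+ N * `|t|)))//.
  by apply: ler_pM => //; rewrite ger0_norm ?kap_ge0// kap_le3.
(* The factor N + 1 is paid for by doubling the ratio 4 k |t|; the constant is 3 * 16 / 4 = 12. *)
have h2N : N.+1%:R <= 2 ^+ N.+1 :> R.
  by rewrite -natrX ler_nat ltnW// ltn_expl.
have -> : 8 * k * `|t| = 2 * (4 * k * `|t|) by ring.
have -> : 3 * (16 * k * N.+1%:R * (4 * k * `|t|) ^+ N * `|t|) =
   12 * (N.+1%:R * (4 * k * `|t|) ^+ N.+1) by rewrite [in RHS]exprS; ring.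
have z0 : 0 <= 4 * k * `|t| by rewrite !mulr_ge0.
rewrite [in leRHS]exprMn ler_wpM2l// ler_wpM2r// exprn_ge0//.
Qed.

End gegenbauer.

(** * Quantitative Taylor expansions and continuation along an interval *)

Section taylor.
Context {R : realType}.
Implicit Types (U V : R -> R) (a b : nat -> R).

(** The same C and rho serve all orders N, so for |t| < rho the partial sums converge to [U t]. *)
Definition taylor_on (rho C : R) U a := forall N t, `|t| <= rho ->
  `|U t - \sum_(n < N) a n * t ^+ n| <= C * (`|t| / rho) ^+ N.

(* Quantitative analyticity at 0: no infinite series is involved. *)
Definition taylor U a := exists rho C, 0 < rho /\ taylor_on rho C U a.

Lemma taylor_onC_ge0 rho C U a : 0 < rho -> taylor_on rho C U a -> 0 <= C.
Proof.
move=> r0 /(_ 0%N 0); rewrite normr0 mul0r expr0 mulr1 => /(_ (ltW r0)).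
exact: le_trans.
Qed.

Lemma taylor_onW rho rho' C U a : 0 < rho' -> rho' <= rho ->
  taylor_on rho C U a -> taylor_on rho' C U a.
Proof.
move=> r0 rr Ua N t tr.
have rho0 := lt_le_trans r0 rr.
have C0 := taylor_onC_ge0 rho0 Ua.
rewrite (le_trans (Ua N t (le_trans tr rr)))// ler_wpM2l//.
by rewrite lerXn2r ?nnegrE ?divr_ge0 ?(ltW r0) ?(ltW rho0)// ler_pM// ?lef_pV2//
  invr_ge0 ltW.
Qed.

Lemma eq_taylor U V a : (exists2 e, 0 < e & forall t, `|t| < e -> U t = V t) ->
  taylor U a -> taylor V a.
Proof.
move=> [e e0 UV] [rho [C [r0 Ua]]].
have m0 : 0 < Num.min (e / 2) rho by rewrite lt_min r0 divr_gt0.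
exists (Num.min (e / 2) rho), C; split => // N t tm.
rewrite -UV; first by apply: (taylor_onW m0 _ Ua) => //; rewrite ge_min lexx orbT.
rewrite (le_lt_trans tm)// (@le_lt_trans _ _ (e / 2))//; last by lra.
by rewrite ge_min lexx.
Qed.

Lemma taylorD U V a b : taylor U a -> taylor V b ->
  taylor (fun t => U t + V t) (fun n => a n + b n).
Proof.
move=> [r1 [C1 [r10 Ua]]] [r2 [C2 [r20 Vb]]].
have m0 : 0 < Num.min r1 r2 by rewrite lt_min r10 r20.
exists (Num.min r1 r2), (C1 + C2); split => // N t tm.
have -> : U t + V t - \sum_(n < N) (a n + b n) * t ^+ n =
    (U t - \sum_(n < N) a n * t ^+ n) + (V t - \sum_(n < N) b n * t ^+ n).
  under eq_bigr do rewrite mulrDl.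
  by rewrite big_split/=; ring.
rewrite (le_trans (ler_normD _ _))// mulrDl lerD//.
- by apply: (taylor_onW m0 _ Ua) => //; rewrite ge_min lexx.
- by apply: (taylor_onW m0 _ Vb) => //; rewrite ge_min lexx orbT.
Qed.

Lemma taylorZ (k : R) U a : taylor U a ->
  taylor (fun t => k * U t) (fun n => k * a n).
Proof.
move=> [rho [C [r0 Ua]]]; exists rho, (`|k| * C); split => // N t tr.
under eq_bigr do rewrite -mulrA.
by rewrite -mulr_sumr -mulrBr normrM -mulrA ler_wpM2l// Ua.
Qed.

Definition coef_shift a n := if n is m.+1 then a m else 0.

Lemma taylorMid U a : taylor U a -> taylor (fun t => t * U t) (coef_shift a).
Proof.
move=> [rho [C [r0 Ua]]]; have C0 := taylor_onC_ge0 r0 Ua.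
exists rho, (rho * C); split => // -[|N] t tr.
  rewrite big_ord0 subr0 expr0 mulr1 normrM ler_pM//.
  by have := Ua 0%N t tr; rewrite big_ord0 subr0 expr0 mulr1.
rewrite big_ord_recl/= mul0r add0r.
have -> : \sum_(i < N) a i * t ^+ bump 0 i = t * \sum_(i < N) a i * t ^+ i.
  by rewrite mulr_sumr; apply: eq_bigr => i _; rewrite /bump add1n exprS mulrCA.
rewrite -mulrBr normrM exprS.
have -> : rho * C * (`|t| / rho * (`|t| / rho) ^+ N) = `|t| * (C * (`|t| / rho) ^+ N).
  by field; rewrite gt_eqF.
by rewrite ler_wpM2l// Ua.
Qed.

Lemma taylor0 U a : taylor U a -> U 0 = a 0%N.
Proof.
move=> [rho [C [r0 /(_ 1%N 0)]]]; rewrite normr0 mul0r big_ord1 !expr0 mulr1.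
rewrite expr1 mulr0 normr_le0 subr_eq0 => /(_ (ltW r0)).
by move/eqP.
Qed.

(** The first nonzero coefficient would dominate: at a zero t of U, the expansion to order n + 1
    gives |a n| rho ^ (n + 1) <= C |t|, which fails for small t. *)
Lemma taylor_coef0 U a : taylor U a ->
  (forall e, 0 < e -> exists t, 0 < `|t| < e /\ U t = 0) -> forall n, a n = 0.
Proof.
move=> [rho [C [r0 Ua]]] Uz; elim/ltn_ind => n IH; apply/eqP.
rewrite -[_ == 0]negbK -normr_gt0; apply/negP => an0.
have C0 := taylor_onC_ge0 r0 Ua.
have q0 : 0 < `|a n| * rho ^+ n.+1 / (C + 1).
  by rewrite divr_gt0// ?mulr_gt0 ?exprn_gt0//; lra.
have [|t [/andP[t0 tm] Ut]] := Uz (Num.min rho (`|a n| * rho ^+ n.+1 / (C + 1))).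
  by rewrite lt_min r0.
move: tm; rewrite lt_min => /andP[/ltW tr].
have := Ua n.+1 t tr; rewrite Ut big_ord_recr/= big1 => [|i _]; last first.
  by rewrite IH ?mul0r.
rewrite !add0r normrN normrM normrX expr_div_n exprS.
set T := `|t| ^+ n; set P := rho ^+ n.+1.
have T0 : 0 < T by rewrite exprn_gt0.
have P0 : 0 < P by rewrite exprn_gt0.
rewrite -(ler_pM2r P0) -[leRHS]mulrA divfK ?gt_eqF// => h1.
have C1 : 0 < C + 1 by lra.
rewrite ltr_pdivlMr// => h2.
have : `|a n| * P <= C * `|t|.
  by rewrite -(ler_pM2r T0) mulrAC (le_trans h1)// mulrA.
by nra.
Qed.

(** For |t| < rho / 2 the value [U t] is its own remainder, at most C / 2 ^ N for every N. *)
Lemma taylor_eq0 U a : taylor U a -> (forall n, a n = 0) ->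
  exists2 e, 0 < e & forall t, `|t| < e -> U t = 0.
Proof.
move=> [rho [C [r0 Ua]]] a0; have C0 := taylor_onC_ge0 r0 Ua.
exists (rho / 2); first by rewrite divr_gt0.
move=> t tr; apply/eqP; rewrite -[_ == 0]negbK -normr_gt0; apply/negP => Ut.
have [N] : exists N : nat, C / `|U t| < N%:R.
  by exists (Num.bound (C / `|U t|)); rewrite archi_boundP// divr_ge0.
rewrite ltr_pdivrMr// => hN.
have := Ua N t; rewrite big1 ?subr0 => [|i _]; last by rewrite a0 mul0r.
have tr1 : `|t| <= rho by lra.
move=> /(_ tr1) h.
have q2 : (`|t| / rho) ^+ N <= (2^-1) ^+ N.
  rewrite lerXn2r ?nnegrE ?divr_ge0// ?(ltW r0)//.
  by rewrite ler_pdivrMr//; lra.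
have : N%:R <= 2 ^+ N :> R by rewrite -natrX ler_nat ltnW// ltn_expl.
have p0 : 0 < 2 ^+ N :> R by rewrite exprn_gt0.
move=> N2.
have h2 : `|U t| <= C * (2 ^+ N)^-1.
  by rewrite (le_trans h)// ler_wpM2l// (le_trans q2)// exprVn.
rewrite -(ler_pM2r p0) divfK ?gt_eqF// in h2.
have : N%:R * `|U t| <= 2 ^+ N * `|U t| by rewrite ler_wpM2r.
by lra.
Qed.

(* Second-derivative test: a 2 is half the second derivative of U at 0. *)
Lemma taylor_max U a : taylor U a ->
  (exists2 e, 0 < e & forall t, `|t| < e -> U t <= U 0) -> a 2 <= 0.
Proof.
move=> Ta [e e0 Ue]; have U0 := taylor0 Ta.
have [rho [C [r0 Ua]]] := Ta; have C0 := taylor_onC_ge0 r0 Ua.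
rewrite leNgt; apply/negP => a2.
set P := rho ^+ 3; have P0 : 0 < P by rewrite exprn_gt0.
have C1 : 0 < C + 1 by lra.
pose t := Num.min (Num.min (e / 2) rho) (a 2 * P / (C + 1)).
have t0 : 0 < t by rewrite !lt_min r0 divr_gt0// divr_gt0// mulr_gt0.
have te : t < e.
  rewrite (@le_lt_trans _ _ (e / 2))//; last by lra.
  by rewrite !ge_min lexx.
have tr : t <= rho by rewrite !ge_min lexx orbT.
have ta : t <= a 2 * P / (C + 1) by rewrite !ge_min lexx !orbT.
have nt : `|t| = t by rewrite gtr0_norm.
have := Ua 3%N t; have := Ua 3%N (- t); rewrite normrN nt => /(_ tr) h1 /(_ tr).
move: h1; have := Ue t; have := Ue (- t).
rewrite normrN nt U0 => /(_ te) u1 /(_ te) u2.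
rewrite !big_ord_recl !big_ord0 /= !addr0 !expr0 !mulr1 !/bump /= !add1n.
rewrite !expr1 sqrrN !ler_norml => /andP[h1 _] /andP[h2 _].
(* Adding the expansions at t and - t cancels the coefficient of order 1. *)
have h : a 2 * t ^+ 2 <= C * (t / rho) ^+ 3 by lra.
move: h; rewrite expr_div_n -/P -(ler_pM2r P0) -[leRHS]mulrA divfK ?gt_eqF//.
rewrite (exprS t 2) => h.
have {}h : a 2 * P <= C * t.
  by rewrite -(ler_pM2r (exprn_gt0 2 t0)) mulrAC -[leRHS]mulrA.
move: ta; rewrite ler_pdivlMr// => ta.
by lra.
Qed.

(** Let s be the supremum of the points up to which U vanishes. Zeros accumulate at s, so U vanishes
    on a neighbourhood of s, which pushes s further unless s = 1. *)
Lemma taylor_propagation U :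
  (forall x, 0 <= x <= 1 -> exists a, taylor (fun t => U (x + t)) a) ->
  (exists2 e, 0 < e & forall t, 0 <= t < e -> U t = 0) ->
  forall t, 0 <= t <= 1 -> U t = 0.
Proof.
move=> TU [e e0 Ue].
pose A := [set s | 0 <= s <= 1 /\ forall t, 0 <= t <= s -> U t = 0].
have A0 : A 0.
  split; first by rewrite lexx ler01.
  by move=> t /andP[t0 t1]; apply: Ue; rewrite t0 (le_lt_trans t1).
have supA : has_sup A.
  by split; [exists 0|exists 1 => s [/andP[]]].
set s := sup A.
have s0 : 0 <= s by exact: ub_le_sup supA.2 _ A0.
have s1 : s <= 1 by apply: ge_sup; [exists 0|move=> u [/andP[]]].
have Us t : 0 <= t < s -> U t = 0.
  move=> /andP[t0 ts].
  have st0 : 0 < s - t by rewrite subr_gt0.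
  have [u [_ Au]] := sup_adherent st0 supA.
  by rewrite subKr => tu; apply: Au; rewrite t0 ltW.
have [|a Ta] := TU s; first by rewrite s0.
have [|e' e'0 Ue'] := taylor_eq0 Ta (taylor_coef0 Ta _).
  (* The accumulating zeros lie to the left of s if s > 0, and to the right, by the initial
     hypothesis, if s = 0. *)
  move=> d d0; move: s0; rewrite le_eqVlt => /predU1P[s0|s0].
    exists (Num.min d e / 2).
    have m0 : 0 < Num.min d e by rewrite lt_min d0.
    have md : Num.min d e <= d by rewrite ge_min lexx.
    have me : Num.min d e <= e by rewrite ge_min lexx orbT.
    rewrite gtr0_norm ?divr_gt0//=; split; first by lra.
    by rewrite -s0 add0r; apply: Ue; apply/andP; split; lra.
  exists (- (Num.min d s / 2)).
  have m0 : 0 < Num.min d s by rewrite lt_min d0.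
  have md : Num.min d s <= d by rewrite ge_min lexx.
  have ms : Num.min d s <= s by rewrite ge_min lexx orbT.
  rewrite normrN gtr0_norm ?divr_gt0//=; split; first by lra.
  by apply: Us; apply/andP; split; lra.
have As' : A (Num.min 1 (s + e' / 2)).
  split; first by rewrite le_min ge_min ler01 lexx/= addr_ge0// divr_ge0// ltW.
  move=> t /andP[t0]; rewrite le_min => /andP[t1 t2].
  have [ts|st] := ltP t s; first by apply: Us; rewrite t0.
  have -> : t = s + (t - s) by ring.
  by apply: Ue'; rewrite ger0_norm ?subr_ge0//; lra.
have : Num.min 1 (s + e' / 2) <= s by exact: ub_le_sup supA.2 _ As'.
rewrite ge_min => /orP[|]; last by lra.
move=> s1' t /andP[t0 t1].
have [ts|st] := ltP t s; first by apply: Us; rewrite t0.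
have -> : t = s + 0 by lra.
by apply: Ue'; rewrite normr0.
Qed.

End taylor.

(** * Measurability and bounds for weighted integrals *)

Section integrals.
Context d (T : measurableType d) (R : realType) (mu : {measure set T -> \bar R}).
Context (D : set T) (mD : measurable D).
Implicit Types (f g p : T -> R).

(** The inverse and [kap] are discontinuous at 0, so they are composed on the open half-line of
    positive reals. *)
Lemma measurable_comp_pos f (k : R -> R) : measurable_fun D f ->
  (forall y, D y -> 0 < f y) -> (forall x, 0 < x -> {for x, continuous k}) ->
  measurable_fun D (k \o f).
Proof.
move=> mf f0 ck; apply: (@measurable_comp _ _ _ _ (measurableTypeR R) _ `]0, +oo[%classic).
- exact: measurable_itv.
- by move=> _ [y Dy <-]; rewrite /= in_itv/= andbT f0.
- apply: open_continuous_measurable_fun; first exact: interval_open.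
  by move=> x; rewrite inE/= in_itv/= andbT => /ck.
- exact: mf.
Qed.

Lemma kap_continuous (x : R) : 0 < x -> {for x, continuous kap}.
Proof.
move=> x0.
apply: (@continuous_comp _ _ _ (fun q : R => Num.sqrt q ^+ 3) GRing.inv x).
  apply: (@continuous_comp _ _ _ Num.sqrt (fun z : R => z ^+ 3)).
    exact: sqrt_continuous.
  exact: exprn_continuous.
by apply: inv_continuous; rewrite expf_neq0// gt_eqF// sqrtr_gt0.
Qed.

Lemma integrable_scale (k : R) p : mu.-integrable D (EFin \o p) ->
  mu.-integrable D (EFin \o (fun y => k * p y)).
Proof. by move=> ip; have := integrableZl mD k ip. Qed.

Lemma integrable_add p g : mu.-integrable D (EFin \o p) ->
  mu.-integrable D (EFin \o g) -> mu.-integrable D (EFin \o (fun y => p y + g y)).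
Proof. by move=> ip ig; have := integrableD mD ip ig. Qed.

Lemma integrable_bddM p g (M : R) : mu.-integrable D (EFin \o p) ->
  measurable_fun D g -> (forall y, D y -> `|g y| <= M) ->
  mu.-integrable D (EFin \o (fun y => p y * g y)).
Proof.
move=> ip mg gM; apply: (@integrableMl _ _ _ _ _ mD (EFin \o p) g) => //.
exists M; split; first exact: num_real.
by move=> x Mx y Dy; exact: le_trans (gM y Dy) (ltW Mx).
Qed.

Lemma Rintegral_bddM p g (M : R) : mu.-integrable D (EFin \o p) ->
  measurable_fun D g -> (forall y, D y -> `|g y| <= M) ->
  `|\int[mu]_(y in D) (p y * g y)| <= M * \int[mu]_(y in D) `|p y|.
Proof.
move=> ip mg gM; have ipg := integrable_bddM ip mg gM.
rewrite (le_trans (le_normr_Rintegral mD ipg))//.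
have inp : mu.-integrable D (EFin \o (fun y => `|p y|)).
  by have := integrable_norm ip.
rewrite -RintegralZl//; apply: le_Rintegral => //.
- by have := integrable_norm ipg.
- exact: integrable_scale.
- by move=> y Dy; rewrite normrM mulrC ler_wpM2r// gM.
Qed.

Lemma measurable_geg f g n : measurable_fun D f -> measurable_fun D g ->
  measurable_fun D (fun y => geg (f y) (g y) n).
Proof.
move=> mf mg; elim/nat_ind2: n => [||n m0 m1].
- exact: measurable_cst.
- exact: measurable_funM.
- apply: measurable_funM => //; apply: measurable_funB.
    by apply: measurable_funM => //; exact: measurable_funM.
  by apply: measurable_funM => //; exact: measurable_funM.
Qed.

End integrals.

(** * Integrals of [kap] of a quadratic polynomial with variable coefficients *)

Section kap_integral.
Context d (T : measurableType d) (R : realType) (mu : {measure set T -> \bar R}).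
Context (D : set T) (mD : measurable D) (al be ga : T -> R) (m B : R).
Hypotheses (mal : measurable_fun D al) (mbe : measurable_fun D be)
  (mga : measurable_fun D ga) (m_gt0 : 0 < m)
  (al_ge : forall y, D y -> m <= al y)
  (be_le : forall y, D y -> `|be y| <= B) (ga_le : forall y, D y -> `|ga y| <= B).
Implicit Types p : T -> R.

(** Factoring [al] out of al + 2 be t + ga t ^ 2 leaves 1 - 2 c t + e t ^ 2 with c = - be / al and e
    = ga / al. *)
Definition kap_coef y n : R := kap (al y) * geg (- be y / al y) (ga y / al y) n.

(** The summand 1 ensures that k ^ 2, and not only k, dominates B / m, as the bound on ga / al
    requires. *)
Let k := 1 + B / m.

Let al_gt0 y : D y -> 0 < al y.
Proof. by move=> /al_ge; exact: lt_le_trans. Qed.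

Let k_gt0 y : D y -> 0 < k.
Proof.
by move=> /be_le h; rewrite ltr_pwDl// divr_ge0 ?(ltW m_gt0)// (le_trans _ h).
Qed.

Let c_le y : D y -> `|- be y / al y| <= k.
Proof.
move=> Dy; have B0 : 0 <= B by rewrite (le_trans _ (be_le Dy)).
rewrite normrM normrN normfV (gtr0_norm (al_gt0 Dy)).
rewrite (@le_trans _ _ (B / m)) ?lerDr// ler_pM ?be_le// ?invr_ge0 ?(ltW (al_gt0 _))//.
by rewrite lef_pV2 ?posrE ?al_ge ?al_gt0.
Qed.

Let e_le y : D y -> `|ga y / al y| <= k ^+ 2.
Proof.
move=> Dy; have B0 : 0 <= B by rewrite (le_trans _ (be_le Dy)).
have Bm0 : 0 <= B / m by rewrite divr_ge0 ?(ltW m_gt0).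
rewrite normrM normfV (gtr0_norm (al_gt0 Dy)).
rewrite (@le_trans _ _ (B / m))//; last by rewrite /k; nra.
rewrite ler_pM ?ga_le// ?invr_ge0 ?(ltW (al_gt0 _))//.
by rewrite lef_pV2 ?posrE ?al_ge ?al_gt0.
Qed.

Lemma kapM (a b : R) : 0 <= a -> kap (a * b) = kap a * kap b.
Proof. by move=> a0; rewrite /kap sqrtrM// exprMn invfM. Qed.

Lemma kap_le (a b : R) : 0 < a -> a <= b -> kap b <= kap a.
Proof.
move=> a0 ab; have b0 := lt_le_trans a0 ab.
rewrite /kap lef_pV2 ?posrE ?exprn_gt0 ?sqrtr_gt0//.
by rewrite lerXn2r ?nnegrE ?sqrtr_ge0// ler_wsqrtr.
Qed.

Let kap_al_le y : D y -> `|kap (al y)| <= kap m.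
Proof. by move=> Dy; rewrite ger0_norm ?kap_ge0// kap_le ?al_ge. Qed.

Let measurable_kap_al : measurable_fun D (fun y => kap (al y)).
Proof. by apply: measurable_comp_pos => //; exact: kap_continuous. Qed.

Let measurable_val : measurable_fun D (fun y => (al y)^-1).
Proof.
apply: (measurable_comp_pos (k := GRing.inv)) => //.
by move=> x x0; apply: inv_continuous; rewrite gt_eqF.
Qed.

Lemma measurable_kap_coef n : measurable_fun D (fun y => kap_coef y n).
Proof.
apply: measurable_funM => //; apply: measurable_geg => //.
- apply: measurable_funM => //; exact: measurable_funN.
- exact: measurable_funM.
Qed.

Lemma kap_coef_le y n : D y -> `|kap_coef y n| <= kap m * (4 * k) ^+ n.
Proof.
move=> Dy; rewrite normrM ler_pM ?kap_al_le// geg_le ?c_le ?e_le// ltW//.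
exact: k_gt0 Dy.
Qed.

Lemma integrable_kap_coef p n : mu.-integrable D (EFin \o p) ->
  mu.-integrable D (EFin \o (fun y => p y * kap_coef y n)).
Proof.
move=> ip; apply: integrable_bddM => //; first exact: measurable_kap_coef.
by move=> y; exact: kap_coef_le.
Qed.

Let quad t y := al y + 2 * be y * t + ga y * t ^+ 2.

Let quadE t y : D y ->
  quad t y = al y * (1 - 2 * (- be y / al y) * t + (ga y / al y) * t ^+ 2).
Proof. by move=> /al_gt0 a0; rewrite /quad; field; rewrite gt_eqF. Qed.

Let quad_ge t y : 16 * k * `|t| <= 1 -> D y -> m * (3 / 4) <= quad t y.
Proof.
move=> tk Dy.
have /andP[h _] := quad_near1 (ltW (k_gt0 Dy)) (c_le Dy) (e_le Dy) tk.
by rewrite quadE// ler_pM ?al_ge ?(ltW m_gt0).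
Qed.

Let measurable_kap_quad t : 16 * k * `|t| <= 1 ->
  measurable_fun D (fun y => kap (quad t y)).
Proof.
move=> tk; apply: measurable_comp_pos => //; last exact: kap_continuous.
  apply: measurable_funD; last exact: measurable_funM.
  by apply: measurable_funD => //; apply: measurable_funM => //; exact: measurable_funM.
by move=> y Dy; apply: lt_le_trans (quad_ge tk Dy); rewrite mulr_gt0.
Qed.

Let integrable_kap_quad p t : 16 * k * `|t| <= 1 -> mu.-integrable D (EFin \o p) ->
  mu.-integrable D (EFin \o (fun y => p y * kap (quad t y))).
Proof.
move=> tk ip; apply: (integrable_bddM mD (M := kap (m * (3 / 4)))) => //.
  exact: measurable_kap_quad.
move=> y Dy; rewrite ger0_norm ?kap_ge0// kap_le ?mulr_gt0//.
exact: quad_ge.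
Qed.

(** The remainder in [kap_taylor] is uniform in y once [al] is bounded below and [be], [ga] are
    bounded, so it can be integrated against p. *)
Lemma taylor_kap_quad p : mu.-integrable D (EFin \o p) ->
  taylor (fun t => \int[mu]_(y in D) (p y * kap (quad t y)))
    (fun n => \int[mu]_(y in D) (p y * kap_coef y n)).
Proof.
move=> ip.
(* On an empty D the bounds say nothing about B, and k could fail to be positive. *)
have [D0|/set0P[y0 Dy0]] := eqVneq D set0.
  exists 1, 0; split=> // N t _.
  by rewrite D0 Rintegral_set0 big1 ?subrr ?normr0 ?mul0r// => i _;
    rewrite Rintegral_set0 mul0r.
have k0 := k_gt0 Dy0.
exists (16 * k)^-1, (12 * kap m * \int[mu]_(y in D) `|p y|).
split; first by rewrite invr_gt0 mulr_gt0.
move=> N t; rewrite -[_^-1]mul1r ler_pdivlMr ?mulr_gt0// mulrC => tk.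
rewrite mul1r invrK.
(* Integrability is carried along in the induction because additivity of the integral needs it at
   each stage. *)
have sumE : \int[mu]_(y in D) (p y * (kap (al y) * gegS (- be y / al y) (ga y / al y) N t)) =
    \sum_(n < N) (\int[mu]_(y in D) (p y * kap_coef y n)) * t ^+ n /\
    mu.-integrable D (EFin \o (fun y => p y * (kap (al y) * gegS (- be y / al y) (ga y / al y)
      N t))).
  elim: N => [|N [IH1 IH2]].
    rewrite /gegS; under eq_Rintegral do rewrite big_ord0 !mulr0.
    rewrite Rintegral_cst// mul0r big_ord0; split => //.
    have -> : (EFin \o (fun y => p y * (kap (al y) * \sum_(n < 0) geg (- be y / al y) (ga y /
      al y) n * t ^+ n))) = cst 0%E.
      by apply/funext => y /=; rewrite big_ord0 !mulr0.
    exact: integrable0.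
  have E y : p y * (kap (al y) * gegS (- be y / al y) (ga y / al y) N.+1 t) =
     p y * (kap (al y) * gegS (- be y / al y) (ga y / al y) N t) + t ^+ N * (p y * kap_coef y
       N).
    by rewrite /gegS big_ord_recr/= /kap_coef; ring.
  have i2 := integrable_scale mD (t ^+ N) (integrable_kap_coef N ip).
  split.
    under eq_Rintegral do rewrite E.
    rewrite RintegralD// RintegralZl//; last exact: integrable_kap_coef.
    by rewrite big_ord_recr/= IH1 [_ * t ^+ N]mulrC.
  have -> : (fun y => p y * (kap (al y) * gegS (- be y / al y) (ga y / al y) N.+1 t)) =
    (fun y => p y * (kap (al y) * gegS (- be y / al y) (ga y / al y) N t) + t ^+ N * (p y *
      kap_coef y N)).
    by apply/funext.
  exact: integrable_add.
case: sumE => <- iS.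
have iK := integrable_kap_quad tk ip.
rewrite -RintegralB//.
pose r y := kap (quad t y) - kap (al y) * gegS (- be y / al y) (ga y / al y) N t.
have -> : \int[mu]_(y in D) (p y * kap (quad t y) -
    p y * (kap (al y) * gegS (- be y / al y) (ga y / al y) N t)) =
    \int[mu]_(y in D) (p y * r y).
  by apply: eq_Rintegral => y _; rewrite /r mulrBr.
have mS : measurable_fun D (fun y => gegS (- be y / al y) (ga y / al y) N t).
  apply: measurable_sum => n; apply: measurable_funM => //; apply: measurable_geg.
  - by apply: measurable_funM => //; exact: measurable_funN.
  - exact: measurable_funM.
apply: le_trans (Rintegral_bddM mD (M := kap m * (12 * (`|t| * (16 * k)) ^+ N)) ip _ _) _.
- apply: measurable_funB; first exact: measurable_kap_quad.
  exact: measurable_funM.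
- move=> y Dy; rewrite /r quadE// kapM ?(ltW (al_gt0 Dy))// -mulrBr normrM.
  apply: ler_pM => //; first exact: kap_al_le.
  apply: le_trans (kap_taylor N k0 (c_le Dy) (e_le Dy) tk) _.
  rewrite ler_wpM2l// lerXn2r ?nnegrE ?mulr_ge0 ?(ltW k0)//.
  have := mulr_ge0 (ltW k0) (normr_ge0 t); lra.
- by rewrite le_eqVlt; apply/orP; left; apply/eqP; ring.
Qed.

Lemma taylor_quad p0 p1 p2 : mu.-integrable D (EFin \o p0) ->
  mu.-integrable D (EFin \o p1) -> mu.-integrable D (EFin \o p2) ->
  taylor (fun t => \int[mu]_(y in D)
      ((p0 y + p1 y * t + p2 y * t ^+ 2) *
        kap (al y + 2 * be y * t + ga y * t ^+ 2)))
    (fun n => \int[mu]_(y in D) (p0 y * kap_coef y n) +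
      coef_shift (fun n => \int[mu]_(y in D) (p1 y * kap_coef y n)) n +
      coef_shift (coef_shift (fun n => \int[mu]_(y in D) (p2 y * kap_coef y n))) n).
Proof.
move=> i0 i1 i2.
have [D0|/set0P[y0 Dy0]] := eqVneq D set0.
  exists 1, 0; split=> // N t _; rewrite D0 Rintegral_set0 big1 ?subrr ?normr0 ?mul0r//.
  by case=> -[|[|n]] ? _; rewrite /coef_shift/= !Rintegral_set0 !addr0 mul0r.
have k0 := k_gt0 Dy0.
apply: eq_taylor (taylorD (taylorD (taylor_kap_quad i0)
  (taylorMid (taylor_kap_quad i1))) (taylorMid (taylorMid (taylor_kap_quad i2)))).
exists (16 * k)^-1; first by rewrite invr_gt0 mulr_gt0.
move=> t; rewrite -[_^-1]mul1r ltr_pdivlMr ?mulr_gt0// mulrC => /ltW tk.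
have j0 := integrable_kap_quad tk i0.
have j1 := integrable_kap_quad tk i1.
have j2 := integrable_kap_quad tk i2.
have j1' := integrable_scale mD t j1.
have j2' := integrable_scale mD (t * t) j2.
rewrite mulrA -!RintegralZl// -RintegralD// -RintegralD//; last exact: integrable_add.
by apply: eq_Rintegral => y _; rewrite -/(quad t y); ring.
Qed.

End kap_integral.

(** * Euclidean geometry, topology and measurable sets of the space *)

Section euclidean.
Context {R : realType}.
Notation E := 'rV[R]_3.
Implicit Types (x y z u v : E).

Lemma dotE u v : dot u v = u 0 ord0 * v 0 ord0 +
  (u 0 (lift ord0 ord0) * v 0 (lift ord0 ord0) +
   u 0 (lift ord0 (lift ord0 ord0)) * v 0 (lift ord0 (lift ord0 ord0))).
Proof. by rewrite /dot !big_ord_recl big_ord0 addr0. Qed.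

Lemma dotC u v : dot u v = dot v u.
Proof. by rewrite !dotE; ring. Qed.

Lemma dotDl u v z : dot (u + v) z = dot u z + dot v z.
Proof. by rewrite !dotE !mxE; ring. Qed.

Lemma dotZl (k : R) u v : dot (k *: u) v = k * dot u v.
Proof. by rewrite !dotE !mxE; ring. Qed.

Lemma dotNl u v : dot (- u) v = - dot u v.
Proof. by rewrite !dotE !mxE; ring. Qed.

Lemma dotBl u v z : dot (u - v) z = dot u z - dot v z.
Proof. by rewrite dotDl dotNl. Qed.

Lemma dotDr u v z : dot z (u + v) = dot z u + dot z v.
Proof. by rewrite dotC dotDl !(dotC z). Qed.

Lemma dotZr (k : R) u v : dot v (k *: u) = k * dot v u.
Proof. by rewrite dotC dotZl (dotC v). Qed.

Lemma dotNr u v : dot v (- u) = - dot v u.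
Proof. by rewrite dotC dotNl (dotC v). Qed.

Lemma dotBr u v z : dot z (u - v) = dot z u - dot z v.
Proof. by rewrite dotDr dotNr. Qed.

Lemma dot_delta u i : dot u (delta_mx 0 i) = u 0 i.
Proof.
rewrite /dot (bigD1 i)//= !mxE !eqxx mulr1 big1 ?addr0// => j ji.
by rewrite mxE (negbTE ji) andbF mulr0.
Qed.

Lemma dot_ge0 u : 0 <= dot u u.
Proof. by apply: sumr_ge0 => i _; rewrite -expr2 sqr_ge0. Qed.

Lemma sqr_coord_le u i : u 0 i ^+ 2 <= dot u u.
Proof.
rewrite /dot (bigD1 i)//= -expr2 lerDl; apply: sumr_ge0 => j _.
by rewrite -expr2 sqr_ge0.
Qed.

Lemma dot_eq0 u : (dot u u == 0) = (u == 0).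
Proof.
apply/eqP/eqP => [u0|->]; last by rewrite dotE !mxE !mulr0 !addr0.
apply/rowP => i; rewrite mxE; apply/eqP; rewrite -sqrf_eq0 eq_le sqr_ge0 andbT.
by rewrite -u0 sqr_coord_le.
Qed.

Lemma dot_gt0 u : (0 < dot u u) = (u != 0).
Proof. by rewrite lt_neqAle dot_ge0 andbT eq_sym dot_eq0. Qed.

Lemma sqr_dot_le u v : dot u v ^+ 2 <= dot u u * dot v v.
Proof.
rewrite -subr_ge0 !dotE.
set a := u 0 _; set b := u 0 _; set c := u 0 _.
set a' := v 0 _; set b' := v 0 _; set c' := v 0 _.
have -> : (a * a + (b * b + c * c)) * (a' * a' + (b' * b' + c' * c')) -
    (a * a' + (b * b' + c * c')) ^+ 2 =
  (a * b' - b * a') ^+ 2 + ((a * c' - c * a') ^+ 2 + (b * c' - c * b') ^+ 2).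
  by ring.
by rewrite !addr_ge0// sqr_ge0.
Qed.

Lemma enorm_ge0 u : 0 <= enorm u. Proof. exact: sqrtr_ge0. Qed.

Lemma sqr_enorm u : enorm u ^+ 2 = dot u u.
Proof. by rewrite sqr_sqrtr// dot_ge0. Qed.

Lemma normr_dot_le u v : `|dot u v| <= enorm u * enorm v.
Proof.
rewrite -sqrtr_sqr /enorm -sqrtrM ?dot_ge0// ler_wsqrtr//; exact: sqr_dot_le.
Qed.

Lemma coord_le u i : `|u 0 i| <= enorm u.
Proof. by rewrite -sqrtr_sqr ler_wsqrtr// sqr_coord_le. Qed.

Lemma enormZ (k : R) u : enorm (k *: u) = `|k| * enorm u.
Proof.
by rewrite /enorm dotZl dotZr mulrA -expr2 sqrtrM ?sqr_ge0// sqrtr_sqr.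
Qed.

Lemma enorm_eq0 u : (enorm u == 0) = (u == 0).
Proof. by rewrite -dot_eq0 -sqr_enorm sqrf_eq0. Qed.

Lemma enorm_gt0 u : (0 < enorm u) = (u != 0).
Proof. by rewrite lt_neqAle enorm_ge0 andbT eq_sym enorm_eq0. Qed.

Lemma sphereE (r : R) u : 0 <= r -> sphere r u <-> dot u u = r ^+ 2.
Proof.
move=> r0; rewrite /sphere/= -sqr_enorm; split => [->//|/eqP].
by rewrite eqrXn2 ?enorm_ge0// => /eqP.
Qed.

Lemma ler_enormD u v : enorm (u + v) <= enorm u + enorm v.
Proof.
rewrite -(@ler_pXn2r _ 2) ?nnegrE ?addr_ge0 ?enorm_ge0// sqr_enorm sqrrD !sqr_enorm.
rewrite dotDl !dotDr (dotC v u).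
have := normr_dot_le u v; have := ler_norm (dot u v); lra.
Qed.

Lemma ler_enormB u v : enorm u - enorm v <= enorm (u - v).
Proof. by rewrite lerBlDr -{1}(subrK v u) ler_enormD. Qed.

Lemma kap_dot u : kap (dot u u) = (enorm u ^+ 3)^-1.
Proof. by []. Qed.

Lemma dot_continuous (T : topologicalType) (f g : T -> E) (t : T) :
  {for t, continuous f} -> {for t, continuous g} ->
  {for t, continuous (fun s => dot (f s) (g s))}.
Proof.
move=> cf cg.
have cc (h : T -> E) i : {for t, continuous h} -> {for t, continuous (fun s => h s 0 i)}.
  move=> ch; apply: (@continuous_comp _ _ _ h (fun M : E => M 0 i)) => //.
  exact: coord_continuous.
have -> : (fun s => dot (f s) (g s)) = (fun s => f s 0 ord0 * g s 0 ord0 +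
  (f s 0 (lift ord0 ord0) * g s 0 (lift ord0 ord0) +
   f s 0 (lift ord0 (lift ord0 ord0)) * g s 0 (lift ord0 (lift ord0 ord0)))).
  by apply/funext => s; rewrite dotE.
by apply: cvgD; [|apply: cvgD]; apply: cvgM; apply: cc.
Qed.

Lemma enorm_continuous : continuous (@enorm R).
Proof.
move=> x; apply: continuous_comp; last exact: sqrt_continuous.
by apply: dot_continuous; exact: cvg_id.
Qed.

Lemma sphere_closed (r : R) : closed (@sphere R r).
Proof.
rewrite (_ : sphere r = enorm @^-1` [set r])//.
by apply: closed_comp; [move=> x _; exact: enorm_continuous|exact: closed_eq].
Qed.

(** Neighbourhoods are sup-norm balls, which contain the Euclidean ball of the same radius; m is the
    square of that radius. *)
Lemma closed_sep (F : set E) x : closed F -> ~ F x ->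
  exists2 m : R, 0 < m & forall y, F y -> m <= dot (x - y) (x - y).
Proof.
move=> cF Fx; have : nbhs x (~` F) by apply: open_nbhs_nbhs; split => //; exact: closed_openC.
move=> /nbhs_ballP[e /= e0 eF]; exists (e ^+ 2); first by rewrite exprn_gt0.
move=> y Fy; rewrite leNgt; apply/negP => h; apply: eF Fy; split => // i j.
rewrite (ord1 i) /ball/=.
have := le_lt_trans (sqr_coord_le (x - y) j) h.
by rewrite !mxE -[_ ^+ 2]real_normK ?num_real// ltr_pXn2r ?nnegrE// ltW.
Qed.

(* A countable base of the topology made of measurable sets. *)
Definition rat_box (c : 'rV[rat]_3 * nat) : set E :=
  [set x | forall i, `|x 0 i - ratr (c.1 0 i)| < c.2.+1%:R^-1].

Lemma rat_box_nbhs (U : set E) x : nbhs x U ->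
  exists c, rat_box c x /\ rat_box c `<=` U.
Proof.
move=> /nbhs_ballP[e /= e0 eU].
have [k ke] : exists k : nat, 2 / e < k.+1%:R.
  exists (Num.bound (2 / e)).
  apply: (lt_trans (archi_boundP _)); last by rewrite ltr_nat.
  by rewrite divr_ge0// ltW.
have k0 : 0 < k.+1%:R^-1 :> R by rewrite invr_gt0.
have de : 2 * k.+1%:R^-1 < e by rewrite ltr_pdivrMr// mulrC -ltr_pdivrMr.
move: k0 de; rewrite /rat_box/=.
have [dd ddE] : exists dd : R, dd = k.+1%:R^-1 by eexists.
rewrite -ddE => d0 de.
have qi i : {q : rat | `|x 0 i - ratr q| < dd}.
  apply/cid.
  have [|q] := @rat_in_itvoo R (x 0 i - dd) (x 0 i + dd); first by lra.
  rewrite in_itv/= => /andP[q1 q2]; exists q.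
  by rewrite ltr_norml; apply/andP; split; lra.
exists (\row_i sval (qi i), k); rewrite /= -ddE; split.
  by move=> i; rewrite mxE; exact: (svalP (qi i)).
move=> y /= By; apply: eU; split => // i j; rewrite (ord1 i) /ball/=.
have h1 := By j; have h2 := svalP (qi j); rewrite mxE in h1.
have -> : x 0 j - y 0 j = (x 0 j - ratr (sval (qi j))) - (y 0 j - ratr (sval (qi j))).
  by ring.
by rewrite (le_lt_trans (ler_normB _ _))//; lra.
Qed.

Lemma measurable_coord (D : set E) i : measurable_fun D (fun x : E => x 0 i).
Proof.
apply: (@measurable_funS _ _ _ _ setT) => // _ A mA; rewrite setTI.
apply: sub_sigma_algebra.
have mem : preimage_set_system setT (@rV_coord R 3 i) measurable
    ((fun x : E => x 0 i) @^-1` A) by exists A => //; rewrite setTI.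
by rewrite (bigD1 i)//=; left.
Qed.

Lemma measurable_rat_box c : measurable (rat_box c).
Proof.
rewrite (_ : rat_box c = \bigcap_(i : 'I_3)
   ((fun x : E => x 0 i) @^-1` ball (ratr (c.1 0 i) : R) c.2.+1%:R^-1)).
  by apply: fin_bigcap_measurable => // i _; rewrite -[X in measurable X]setTI;
    apply: measurable_coord => //; exact: measurable_ball.
by apply/seteqP; split => x /= xc i; [move=> _|]; have := xc i; rewrite /ball/= distrC => h;
  exact: h.
Qed.

Lemma measurable_open (U : set E) : open U -> measurable U.
Proof.
move=> oU; rewrite (_ : U = \bigcup_c (if pselect (rat_box c `<=` U) then rat_box c else set0)).
  apply: countable_bigcupT_measurable => [|c]; first exact: countableP.
  by case: pselect => ?; [exact: measurable_rat_box|exact: measurable0].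
apply/seteqP; split => x.
  move=> Ux; have [c [cx cU]] := rat_box_nbhs (open_nbhs_nbhs (conj oU Ux)).
  by exists c => //; case: pselect.
by move=> [c _]; case: pselect => // cU; exact: cU.
Qed.

Lemma measurable_closed (F : set E) : closed F -> measurable F.
Proof.
move=> cF; rewrite -(setCK F); apply: measurableC; apply: measurable_open.
exact: closed_openC.
Qed.

Lemma measurable_cont (U : set E) (f : E -> R) : open U ->
  (forall x, U x -> {for x, continuous f}) -> measurable_fun U f.
Proof.
move=> oU cf; apply: (measurability _ (RGenOpens.measurableE R)).
move=> _ [_ [a [b ->] <-]]; apply: measurable_open; rewrite openE => x [Ux fx].
apply: filterI; first exact: open_nbhs_nbhs.
by apply: (cf _ Ux); apply: open_nbhs_nbhs; split => //; exact: interval_open.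
Qed.

(** A Lindelof argument: among the countably many rational boxes, those on which P holds almost
    everywhere cover U. It will show that m vanishes almost everywhere off its support. *)
Lemma ae_cover (mu : {measure set E -> \bar R}) (U : set E) (P : E -> Prop) :
  (forall x, U x -> exists2 V, nbhs x V & {ae mu, forall y, V y -> P y}) ->
  {ae mu, forall y, U y -> P y}.
Proof.
move=> UV.
(* [Q n] says something only when n encodes a box on which P holds almost everywhere. *)
pose Q (n : nat) y := forall c, unpickle n = Some c ->
  {ae mu, forall y, rat_box c y -> P y} -> rat_box c y -> P y.
have : {ae mu, forall y, forall n, Q n y}.
  apply: ae_foralln => n; rewrite /Q.
  case: (unpickle n) => [c|]; last by apply: aeW.
  have [h|h] := pselect {ae mu, forall y, rat_box c y -> P y}.
    by apply: filterS h => y h c' [<-] _.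
  by apply: aeW => y c' [<-].
apply: filterS => y h Uy; have [V Vy VP] := UV _ Uy.
have [c [cy cV]] := rat_box_nbhs Vy.
apply: (h (pickle c) c) => //; first exact: pickleK.
by apply: filterS VP => z zP /cV.
Qed.

End euclidean.

Section pointwise_continuity.
Context {R : realType} (T : topologicalType).
Implicit Types (t : T) (V : normedModType R).

Lemma contC V (k : V) t : {for t, continuous (fun _ : T => k)}.
Proof. exact: cst_continuous. Qed.

Lemma contI t : {for t, continuous (fun s : T => s)}.
Proof. by move=> A; exact. Qed.

Lemma contD V (f g : T -> V) t : {for t, continuous f} -> {for t, continuous g} ->
  {for t, continuous (fun s => f s + g s)}.
Proof. by move=> cf cg; exact: continuousD cf cg. Qed.

Lemma contB V (f g : T -> V) t : {for t, continuous f} -> {for t, continuous g} ->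
  {for t, continuous (fun s => f s - g s)}.
Proof. by move=> cf cg; exact: continuousB cf cg. Qed.

Lemma contM (f g : T -> R) t : {for t, continuous f} -> {for t, continuous g} ->
  {for t, continuous (fun s => f s * g s)}.
Proof. by move=> cf cg; exact: continuousM cf cg. Qed.

Lemma contZ V (f : T -> R) (g : T -> V) t :
  {for t, continuous f} -> {for t, continuous g} ->
  {for t, continuous (fun s => f s *: g s)}.
Proof. by move=> cf cg; exact: continuousZ cf cg. Qed.

Lemma contcomp (U W : topologicalType) (f : T -> U) (g : U -> W) t :
  {for t, continuous f} -> {for f t, continuous g} ->
  {for t, continuous (fun s => g (f s))}.
Proof. by move=> cf cg; exact: continuous_comp cf cg. Qed.

End pointwise_continuity.

(** * A maximum principle outside a ball *)

Section max_principle.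
Context {R : realType}.
Notation E := 'rV[R]_3.
Implicit Types (x y z u v : E) (V : E -> R).

Lemma normr_le_enorm x : `|x| <= enorm x.
Proof.
rewrite [leLHS]/Num.norm/= mx_normrE; apply/bigmax_leP; split; first exact: enorm_ge0.
by move=> [i j] _ /=; rewrite (ord1 i) coord_le.
Qed.

Lemma near_enorm x (d : R) : 0 < d -> \forall z \near x, enorm (z - x) < d.
Proof.
move=> d0; have : {for x, continuous (fun z : E => enorm (z - x))}.
  apply: (@continuous_comp _ _ _ (fun z : E => z - x) enorm); last exact: enorm_continuous.
  by apply: contB; [exact: contI|exact: contC].
move=> /cvgrPdist_lt /(_ d d0); apply: filterS => z.
rewrite subrr (_ : enorm 0 = 0); last by apply/eqP; rewrite enorm_eq0.
by rewrite sub0r normrN ger0_norm// enorm_ge0.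
Qed.

Lemma taylor_cst (k : R) : taylor (cst k) (fun n => if n is 0%N then k else 0).
Proof.
exists 1, `|k|; split => // -[|N] t t1; first by rewrite big_ord0 subr0 expr0 mulr1.
rewrite big_ord_recl/= expr0 mulr1 big1 ?addr0 ?subrr ?normr0 => [|i _].
  by rewrite mulr_ge0// exprn_ge0// divr_ge0.
by rewrite mul0r.
Qed.

Lemma taylor_sqr_line x i : taylor (fun t => dot (x + t *: delta_mx 0 i) (x + t *: delta_mx 0
  i))
  (fun n => match n with 0 => dot x x | 1 => 2 * x 0 i | 2 => 1 | _ => 0 end).
Proof.
have h := taylorD (taylorD (taylor_cst (dot x x)) (taylorMid (taylor_cst (2 * x 0 i))))
  (taylorMid (taylorMid (taylor_cst 1))).
have [rho [C [r0 hC]]] := h; exists rho, C; split => // N t tr.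
have := hC N t tr; congr (`| _ - _ | <= _).
  rewrite dotDl !dotDr !dotZl !dotZr (dotC _ x) !dot_delta mxE !eqxx /= /cst; ring.
by apply: eq_bigr => -[[|[|[|n]]] ?] _ /=; rewrite /coef_shift/= ?addr0 ?add0r.
Qed.

(** Adding a small multiple of |x|^2 makes the sum of second coefficients positive, which excludes
    an interior maximum. For rho < 0 the domain is the whole space and the boundary condition is
    empty; this case is used for the glued function. *)
Lemma max_principle V (rho : R) :
  (forall x, rho <= enorm x -> {for x, continuous V}) ->
  (forall x, rho < enorm x -> exists c : 'I_3 -> nat -> R,
     (forall i, taylor (fun t => V (x + t *: delta_mx 0 i)) (c i)) /\
     \sum_i c i 2 = 0) ->
  (forall x, enorm x = rho -> V x <= 0) ->
  (forall e, 0 < e -> exists M, forall x, M <= enorm x -> V x <= e) ->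
  forall x, rho <= enorm x -> V x <= 0.
Proof.
move=> cV hV bV dV x0 x0rho; rewrite leNgt; apply/negP => Vx0.
have [M0 hM0] := dV _ (divr_gt0 Vx0 (ltr0n _ 2)).
pose M := Num.max (Num.max M0 (enorm x0)) 1.
have M1 : 1 <= M by rewrite le_max lexx orbT.
have Mx0 : enorm x0 <= M by rewrite !le_max lexx orbT.
have MM0 : M0 <= M by rewrite !le_max lexx.
(* With this e the perturbation is at most [V x0] / 4 on the ball of radius M. As V is at most
   [V x0] / 2 where |x| = M and at most 0 where |x| = rho, the maximum of [W], which is at least
   [V x0], is attained strictly in between. *)
pose e := V x0 / (4 * M ^+ 2).
have MM_gt0 : 0 < 4 * M ^+ 2 by rewrite mulr_gt0// exprn_gt0// (lt_le_trans _ M1).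
have e0 : 0 < e by rewrite divr_gt0.
have eM : e * M ^+ 2 = V x0 / 4.
  by rewrite /e; field; rewrite gt_eqF// (lt_le_trans _ M1).
pose W x := V x + e * dot x x.
pose K := [set x : E | rho <= enorm x <= M].
have cK : compact K.
  apply: bounded_closed_compact.
    exists M; split; first exact: num_real.
    move=> k Mk x /andP[_ xM].
    exact: le_trans (normr_le_enorm x) (le_trans xM (ltW Mk)).
  have -> : K = enorm @^-1` [set` `[rho, M]%R].
    by apply/seteqP; split => x; rewrite /= in_itv/=.
  apply: closed_comp; first by move=> x _; exact: enorm_continuous.
  exact: interval_closed.
have K0 : K !=set0 by exists x0; rewrite /K/= x0rho.
have cW x : rho <= enorm x -> {for x, continuous W}.
  move=> xr; apply: contD; first exact: cV.
  by apply: contM; [exact: contC|apply: dot_continuous; exact: contI].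
have [|z] := EVT_max_rV K0 cK (f := W).
  by apply: continuous_in_subspaceT => x; rewrite inE => /andP[/cW].
rewrite inE => -[/andP[z1 z2]] zmax.
have Wz : V x0 <= W z.
  apply: (@le_trans _ _ (W x0)); last by apply: zmax; rewrite inE /K/= x0rho.
  by rewrite lerDl mulr_ge0 ?dot_ge0 ?ltW.
have We : e * dot z z <= V x0 / 4.
  rewrite -eM ler_wpM2l ?(ltW e0)// -sqr_enorm lerXn2r ?nnegrE ?enorm_ge0//.
  by rewrite (le_trans _ M1).
have zr : rho < enorm z.
  rewrite lt_neqAle z1 andbT; apply/eqP => zr.
  by have := bV z (esym zr); rewrite /W in Wz; lra.
have zM : enorm z < M.
  rewrite lt_neqAle z2 andbT; apply/eqP => zM.
  by have := hM0 z; rewrite zM => /(_ MM0); rewrite /W in Wz; lra.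
have zK : \forall u \near z, K u.
  have := @enorm_continuous R z => /cvgrPdist_lt.
  move=> /(_ (Num.min (enorm z - rho) (M - enorm z))).
  rewrite lt_min !subr_gt0 zr zM => /(_ isT); apply: filterS => u.
  rewrite lt_min !ltr_norml => /andP[/andP[_ h1] /andP[h2 _]].
  by apply/andP; split; lra.
move: zK => /nbhs_ballP[d /= d0 dK].
have [c [hc sc]] := hV z zr.
have c2 i : c i 2 + e <= 0.
  have h := taylorD (hc i) (taylorZ e (taylor_sqr_line z i)).
  have := taylor_max h; rewrite /= mulr1; apply.
  exists d => // t td.
  rewrite -[X in X <= _]/(W (z + t *: delta_mx 0 i)) !scale0r !addr0.
  apply: zmax; rewrite inE; apply: dK; split => // k l; rewrite (ord1 k) /ball/=.
  rewrite !mxE opprD addrA subrr sub0r normrN normrM (le_lt_trans _ td)//.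
  by rewrite ler_piMr//; case: (_ && _); rewrite ?normr1 ?normr0.
have : \sum_(i < 3) (c i 2 + e) <= 0 by apply: sumr_le0 => i _.
by rewrite big_split/= sc add0r sumr_const card_ord -mulr_natr; lra.
Qed.

End max_principle.

(** * Potentials of densities on a sphere *)

Section potential.
Context {R : realType}.
Notation E := 'rV[R]_3.
Context (mu : {measure set E -> \bar R}) (F : set E) (r : R).
Context (a : E -> R) (b : E -> E).
Hypotheses (cF : closed F) (r_ge0 : 0 <= r) (Fr : F `<=` sphere r)
  (ia : mu.-integrable F (EFin \o a))
  (ib : forall i, mu.-integrable F (EFin \o (fun y => b y 0 i))).
Implicit Types x y z u v : E.

(* The numerator vanishes at x = y, which makes each term harmonic in x; this
   covers both the dipole potential and the Poisson integral. *)
Definition pot x : R := \int[mu]_(y in F)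
  ((a y * (dot x x - r ^+ 2) + dot (b y) (x - y)) * kap (dot (x - y) (x - y))).

Let mF : measurable F. Proof. exact: measurable_closed. Qed.

Lemma measurable_dot (D : set E) (f g : E -> E) :
  (forall i, measurable_fun D (fun y => f y 0 i)) ->
  (forall i, measurable_fun D (fun y => g y 0 i)) ->
  measurable_fun D (fun y => dot (f y) (g y)).
Proof.
by move=> mf mg; apply: measurable_sum => i; exact: measurable_funM.
Qed.

Lemma measurable_sub_coord (D : set E) x i : measurable_fun D (fun y => (x - y) 0 i).
Proof.
rewrite (_ : (fun y => (x - y) 0 i) = (fun y => x 0 i - y 0 i)).
  by apply: measurable_funB => //; exact: measurable_coord.
by apply/funext => y; rewrite !mxE.
Qed.

Lemma integrable_dot (g : E -> E) (M : R) :
  (forall i, measurable_fun F (fun y => g y 0 i)) ->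
  (forall y, F y -> enorm (g y) <= M) ->
  mu.-integrable F (EFin \o (fun y => dot (b y) (g y))).
Proof.
move=> mg gM.
rewrite (_ : (fun y => _) = (fun y => b y 0 ord0 * g y 0 ord0 +
  (b y 0 (lift ord0 ord0) * g y 0 (lift ord0 ord0) +
   b y 0 (lift ord0 (lift ord0 ord0)) * g y 0 (lift ord0 (lift ord0 ord0))))).
  have h i : mu.-integrable F (EFin \o (fun y => b y 0 i * g y 0 i)).
    apply: (integrable_bddM mF (M := M)) => // y Fy.
    by rewrite (le_trans (coord_le _ _))// gM.
  by apply: integrable_add => //; exact: integrable_add.
by apply/funext => y; rewrite dotE.
Qed.

Let Fdot y : F y -> dot y y = r ^+ 2.
Proof. by move=> /Fr /(sphereE _ r_ge0). Qed.

Let Fenorm y : F y -> enorm y = r. Proof. exact: Fr. Qed.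

Let sub_le x y : F y -> enorm (x - y) <= enorm x + r.
Proof.
move=> /Fenorm <-; rewrite (le_trans (ler_enormD _ _))// lerD2l.
by rewrite -scaleN1r enormZ normrN normr1 mul1r.
Qed.

Lemma sub_neq0 x y : ~ F x -> F y -> x - y != 0.
Proof. by move=> Fx Fy; rewrite subr_eq0; apply/eqP => xy; apply: Fx; rewrite xy. Qed.

Section line.
Variables (x v : E).
Hypothesis Fx : ~ F x.

Let al y := dot (x - y) (x - y).
Let be y := dot v (x - y).
Let ga (y : E) := dot v v.
Let p0 y := a y * (dot x x - r ^+ 2) + dot (b y) (x - y).
Let p1 y := a y * (2 * dot x v) + dot (b y) v.
Let p2 y := a y * dot v v.

Let mal : measurable_fun F al.
Proof. by apply: measurable_dot => i; exact: measurable_sub_coord. Qed.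

Let mbe : measurable_fun F be.
Proof. by apply: measurable_dot => i //; exact: measurable_sub_coord. Qed.

Let integrable_acst (k : R) : mu.-integrable F (EFin \o (fun y => a y * k)).
Proof.
rewrite (_ : (fun y => a y * k) = (fun y => k * a y)); first exact: integrable_scale.
by apply/funext => y; rewrite mulrC.
Qed.

Let ip0 : mu.-integrable F (EFin \o p0).
Proof.
apply: (@integrable_add _ _ _ mu F mF (fun y => a y * (dot x x - r ^+ 2))
  (fun y => dot (b y) (x - y))); first exact: integrable_acst.
by apply: (integrable_dot (M := enorm x + r)) => [i|]; [exact: measurable_sub_coord|exact:
  sub_le].
Qed.

Let ip1 : mu.-integrable F (EFin \o p1).
Proof.
apply: (@integrable_add _ _ _ mu F mF (fun y => a y * (2 * dot x v))
  (fun y => dot (b y) v)); first exact: integrable_acst.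
exact: (integrable_dot (M := enorm v)).
Qed.

Let ip2 : mu.-integrable F (EFin \o p2).
Proof. exact: integrable_acst. Qed.

Definition pot_coef n : R :=
  \int[mu]_(y in F) (p0 y * kap_coef al be ga y n) +
  coef_shift (fun n => \int[mu]_(y in F) (p1 y * kap_coef al be ga y n)) n +
  coef_shift (coef_shift (fun n => \int[mu]_(y in F) (p2 y * kap_coef al be ga y n))) n.

Let B := enorm v * (enorm x + r) + dot v v.

Let be_le y : F y -> `|be y| <= B.
Proof.
move=> Fy; rewrite (le_trans (normr_dot_le _ _))// (le_trans _ (_ : enorm v * (enorm x + r) <=
  _))//.
  by rewrite ler_wpM2l ?enorm_ge0 ?sub_le.
by rewrite lerDl dot_ge0.
Qed.

Let ga_le y : F y -> `|ga y| <= B.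
Proof.
by move=> Fy; rewrite ger0_norm ?dot_ge0// lerDr mulr_ge0 ?addr_ge0 ?enorm_ge0.
Qed.

Lemma pot_line : taylor (fun t => pot (x + t *: v)) pot_coef.
Proof.
have [m m0 mle] := closed_sep cF Fx.
have h := taylor_quad mF mal mbe (measurable_cst _) m0 mle be_le ga_le ip0 ip1 ip2.
apply: eq_taylor h; exists 1 => // t _; apply: eq_Rintegral => y _.
have -> : x + t *: v - y = (x - y) + t *: v by rewrite addrAC.
rewrite /p0 /p1 /p2 /al /be /ga; congr (_ * kap _).
  by rewrite !(dotDl, dotDr, dotZl, dotZr, dotNr) (dotC v x); ring.
by move: (x - y) => z; rewrite dotDl !dotDr !dotZl !dotZr (dotC z v) /=; ring.
Qed.

(** Merging the three integrals allows harmonicity to be checked pointwise in y. *)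
Lemma pot_coefE n : pot_coef n.+2 = \int[mu]_(y in F)
   (p0 y * kap_coef al be ga y n.+2 + p1 y * kap_coef al be ga y n.+1 +
    p2 y * kap_coef al be ga y n) /\
  mu.-integrable F (EFin \o (fun y => p0 y * kap_coef al be ga y n.+2 +
    p1 y * kap_coef al be ga y n.+1 + p2 y * kap_coef al be ga y n)).
Proof.
have [m m0 mle] := closed_sep cF Fx.
have ik p k : mu.-integrable F (EFin \o p) ->
    mu.-integrable F (EFin \o (fun y => p y * kap_coef al be ga y k)).
  exact: (integrable_kap_coef mF mal mbe (measurable_cst _) m0 mle be_le ga_le).
have h0 := ik p0 n.+2 ip0; have h1 := ik p1 n.+1 ip1; have h2 := ik p2 n ip2.
by rewrite !RintegralD//; [split => //; do ?apply: integrable_add|exact: integrable_add].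
Qed.

End line.

Lemma pot_harmonic x : ~ F x -> \sum_i pot_coef x (delta_mx 0 i) 2 = 0.
Proof.
move=> Fx; rewrite !big_ord_recl big_ord0 addr0.
set e0 := delta_mx 0 ord0; set e1 := delta_mx 0 (lift ord0 ord0).
set e2 := delta_mx 0 (lift ord0 (lift ord0 ord0)).
have [-> i0] := pot_coefE e0 Fx 0.
have [-> i1] := pot_coefE e1 Fx 0.
have [-> i2] := pot_coefE e2 Fx 0.
rewrite -!RintegralD//; last exact: integrable_add.
rewrite (@eq_Rintegral _ _ _ mu F (cst 0)); first by rewrite Rintegral_cst// mul0r.
move=> y; rewrite inE => Fy; rewrite /kap_coef !geg2 !geg1 !geg0.
rewrite !(dotC _ (x - y)) !dot_delta !mxE !eqxx /= (dotC (x - y)).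
have := sub_neq0 Fx Fy; rewrite -dot_gt0 => /lt0r_neq0.
(* The term with [a] is harmonic only because r ^ 2 = |y|^2; after this substitution the sum is an
   identity between rational functions. *)
move: (kap _) => k; rewrite -(Fdot Fy) !dotE !mxE.
move: (a y) (b y 0 _) (b y 0 _) (b y 0 _) (x 0 _) (x 0 _) (x 0 _) (y 0 _) (y 0 _) (y 0 _).
by move=> a0 b0 b1 b2 x0 x1 x2 y0 y1 y2 h; field.
Qed.

(** The L^1 size of the densities: the bounds on [pot] are bounds on its kernels times this
    number. *)
Definition pot_mass : R :=
  \int[mu]_(y in F) `|a y| + \sum_i \int[mu]_(y in F) `|b y 0 i|.

Lemma pot_mass_ge0 : 0 <= pot_mass.
Proof. by rewrite addr_ge0 ?sumr_ge0// => *; rewrite ?Rintegral_ge0. Qed.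

Lemma weight_bound (A : E -> R) (B : E -> E) (M : R) :
  measurable_fun F A -> (forall i, measurable_fun F (fun y => B y 0 i)) ->
  (forall y, F y -> `|A y| <= M) -> (forall y i, F y -> `|B y 0 i| <= M) ->
  mu.-integrable F (EFin \o (fun y => a y * A y + dot (b y) (B y))) /\
  `|\int[mu]_(y in F) (a y * A y + dot (b y) (B y))| <= M * pot_mass.
Proof.
move=> mA mB AM BM.
have iA := integrable_bddM mF ia mA AM.
have iB i := integrable_bddM mF (ib i) (mB i) (fun y Fy => BM y i Fy).
have hA := Rintegral_bddM mF ia mA AM.
have hB i := Rintegral_bddM mF (ib i) (mB i) (fun y Fy => BM y i Fy).
have E y : a y * A y + dot (b y) (B y) =
  a y * A y + (b y 0 ord0 * B y 0 ord0 +
  (b y 0 (lift ord0 ord0) * B y 0 (lift ord0 ord0) +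
   b y 0 (lift ord0 (lift ord0 ord0)) * B y 0 (lift ord0 (lift ord0 ord0)))).
  by rewrite dotE.
have i1 := integrable_add mF (iB (lift ord0 ord0)) (iB (lift ord0 (lift ord0 ord0))).
have i0 := integrable_add mF (iB ord0) i1.
have i2 := integrable_add mF iA i0.
split; first by move: i2; congr (_.-integrable _ (_ \o _)); apply/funext => y; rewrite E.
under eq_Rintegral do rewrite E.
rewrite !RintegralD// /pot_mass !big_ord_recl big_ord0 addr0 !mulrDr.
by do 3 (apply: (le_trans (ler_normD _ _)); apply: lerD => //).
Qed.

Definition potA x y : R := (dot x x - r ^+ 2) * kap (dot (x - y) (x - y)).
Definition potB x y : E := kap (dot (x - y) (x - y)) *: (x - y).

Lemma potE x : pot x = \int[mu]_(y in F) (a y * potA x y + dot (b y) (potB x y)).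
Proof. by apply: eq_Rintegral => y _; rewrite /potA /potB dotZr; ring. Qed.

Section away.
Variables (x : E) (m : R).
Hypotheses (m0 : 0 < m) (mle : forall y, F y -> m <= dot (x - y) (x - y)).

Let measurable_kap_sub : measurable_fun F (fun y => kap (dot (x - y) (x - y))).
Proof.
apply: measurable_comp_pos => //.
- by apply: measurable_dot => i; exact: measurable_sub_coord.
- by move=> y /mle; exact: lt_le_trans.
- exact: kap_continuous.
Qed.

Lemma measurable_potA : measurable_fun F (potA x).
Proof. exact: measurable_funM. Qed.

Lemma measurable_potB i : measurable_fun F (fun y => potB x y 0 i).
Proof.
rewrite (_ : (fun y => _) = (fun y => kap (dot (x - y) (x - y)) * (x - y) 0 i)).
  by apply: measurable_funM => //; exact: measurable_sub_coord.
by apply/funext => y; rewrite mxE.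
Qed.

End away.

Lemma pot_le x M : ~ F x -> (forall y, F y -> `|potA x y| <= M) ->
  (forall y i, F y -> `|potB x y 0 i| <= M) -> `|pot x| <= M * pot_mass.
Proof.
move=> Fx AM BM; rewrite potE; have [m m0 mle] := closed_sep cF Fx.
by have [] := weight_bound (measurable_potA m0 mle) (measurable_potB m0 mle) AM BM.
Qed.

Lemma pot_integrable x : ~ F x ->
  mu.-integrable F (EFin \o (fun y => a y * potA x y + dot (b y) (potB x y))).
Proof.
move=> Fx; have [m m0 mle] := closed_sep cF Fx.
have kk y : F y -> kap (dot (x - y) (x - y)) <= kap m by move=> Fy; rewrite kap_le ?mle.
pose M := (enorm x ^+ 2 + r ^+ 2 + (enorm x + r)) * kap m.
have s0 : 0 <= enorm x + r by rewrite addr_ge0 ?enorm_ge0.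
have [||//] := weight_bound (M := M) (measurable_potA m0 mle) (measurable_potB m0 mle).
- move=> y Fy; rewrite /potA normrM (ger0_norm (kap_ge0 _)) ler_pM ?kap_ge0 ?kk//.
  rewrite (le_trans (ler_normB _ _))// -sqr_enorm !ger0_norm ?sqr_ge0//.
  by rewrite lerDl.
- move=> y i Fy; rewrite /potB mxE normrM (ger0_norm (kap_ge0 _)) mulrC.
  rewrite ler_pM ?kap_ge0 ?kk// (le_trans (coord_le _ _))// (le_trans (sub_le _ Fy))//.
  by rewrite lerDr addr_ge0 ?sqr_ge0.
Qed.

(** Since |x - y| >= |x| / 2, [kap] is at most 8 / |x|^3. The kernel of [a] is then of order 1 / |x|
    and that of [b] of order 1 / |x|^2, which |x| >= 1 brings under the same bound. *)
Lemma pot_decay x : 2 * r <= enorm x -> 1 <= enorm x ->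
  `|pot x| <= 8 / enorm x * pot_mass.
Proof.
move=> x2r x1; have x0 : 0 < enorm x by lra.
have d y : F y -> enorm x / 2 <= enorm (x - y).
  by move=> /Fenorm yr; have := ler_enormB x y; rewrite yr; lra.
have Fx : ~ F x by move=> /Fenorm; lra.
have kle y : F y -> kap (dot (x - y) (x - y)) <= 8 / enorm x ^+ 3.
  move=> Fy; rewrite kap_dot -[leRHS]invf_div lef_pV2 ?posrE ?divr_gt0 ?exprn_gt0//.
    by rewrite (le_trans _ (_ : (enorm x / 2) ^+ 3 <= _))// ?lerXn2r ?nnegrE ?d ?enorm_ge0
      ?divr_ge0 ?enorm_ge0// expr_div_n; lra.
  by rewrite (lt_le_trans _ (d _ Fy))// divr_gt0.
apply: pot_le => // y; last move=> i; move=> Fy.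
  rewrite /potA normrM (ger0_norm (kap_ge0 _)).
  rewrite (@le_trans _ _ (enorm x ^+ 2 * (8 / enorm x ^+ 3)))//.
    rewrite ler_pM ?kap_ge0 ?kle// -sqr_enorm ger0_norm ?subr_ge0.
      by rewrite lerBlDr lerDl sqr_ge0.
    by rewrite lerXn2r ?nnegrE//; lra.
  by rewrite le_eqVlt; apply/orP; left; apply/eqP; field; rewrite gt_eqF.
rewrite /potB mxE normrM (ger0_norm (kap_ge0 _)) mulrC.
have dy := d _ Fy; have n0 : 0 < enorm (x - y) by lra.
apply: (@le_trans _ _ (enorm (x - y) * kap (dot (x - y) (x - y)))).
  by rewrite ler_wpM2r ?kap_ge0 ?coord_le.
rewrite kap_dot exprS invfM mulrA divff ?gt_eqF// mul1r.
rewrite -[leRHS]invf_div lef_pV2 ?posrE ?divr_gt0 ?exprn_gt0//.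
nra.
Qed.

(** This is [kap_taylor] at order N = 1 for 1 + e / q, that is with c = - 1 / 2; the constant 96 is
    12 * 8. *)
Lemma kap_lipschitz (m q e : R) : 0 < m -> m <= q -> 16 * `|e| <= m ->
  `|kap (q + e) - kap q| <= 96 * kap m / m * `|e|.
Proof.
move=> m0 mq em; have q0 := lt_le_trans m0 mq.
have -> : kap (q + e) - kap q =
    kap q * (kap (1 - 2 * (- 2^-1) * (e / q) + 0 * (e / q) ^+ 2) - gegS (- 2^-1) 0 1 (e / q)).
  rewrite /gegS big_ord1 geg0 expr0 mulr1 mulrBr mulr1 -kapM ?(ltW q0)//.
  by congr (kap _ - _); field; rewrite gt_eqF.
have eq : `|e / q| <= `|e| / m.
  by rewrite normrM normfV (gtr0_norm q0) ler_wpM2l// lef_pV2.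
have e16 : 16 * (`|e| / m) <= 1 by rewrite mulrA ler_pdivrMr// mul1r.
have h : `|kap (1 - 2 * (- 2^-1) * (e / q) + 0 * (e / q) ^+ 2) - gegS (- 2^-1) 0 1 (e / q)|
    <= 12 * (8 * 1 * `|e / q|) ^+ 1.
  apply: kap_taylor; rewrite ?normr0 ?expr1n//; last by lra.
  by rewrite normrN normfV normr_nat; lra.
rewrite normrM (ger0_norm (kap_ge0 _)).
rewrite (@le_trans _ _ (kap m * (96 * (`|e| / m))))//; last first.
  by rewrite le_eqVlt; apply/orP; left; apply/eqP; ring.
rewrite ler_pM ?kap_ge0 ?kap_le// (le_trans h)// expr1; lra.
Qed.

Lemma pot_lipschitz x : ~ F x -> exists d L, [/\ 0 < d, 0 <= L &
  forall v, enorm v < d -> `|pot (x + v) - pot x| <= L * enorm v].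
Proof.
move=> Fx; have [m m0 mle] := closed_sep cF Fx.
move: (enorm_ge0 x) (@sub_le x) (normr_dot_le x) (ler_enormD x).
move: (enorm x) => n n0 subx dotx addx.
(* For |v| <= 1, D |v| bounds the change of |x - y|^2 under x -> x + v; the radius m / (16 D) then
   makes [kap_lipschitz] applicable. *)
pose D := 2 * (n + r) + 1; have D0 : 0 < D by rewrite ltr_wpDl// mulr_ge0// addr_ge0.
have km : 0 <= kap m by exact: kap_ge0.
pose c := 96 * kap m / m * D.
have c0 : 0 <= c by rewrite /c !mulr_ge0 ?invr_ge0 ?(ltW m0) ?(ltW D0).
pose K := ((n + 1) ^+ 2 + r ^+ 2 + n + r + 1) * c + (2 * n + 2) * kap m.
have K0 : 0 <= K.
  by rewrite /K; do ?[exact: sqr_ge0|apply: addr_ge0 => //|apply: mulr_ge0 => //].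
exists (Num.min 1 (m / (16 * D))), (K * pot_mass); split.
- by rewrite lt_min ltr01 divr_gt0// mulr_gt0.
- by rewrite mulr_ge0 ?pot_mass_ge0.
move=> v; rewrite lt_min => /andP[/ltW v1]; rewrite ltr_pdivlMr ?mulr_gt0// => vD.
have v0 := enorm_ge0 v.
pose e y := 2 * dot v (x - y) + dot v v.
have eD y : F y -> `|e y| <= D * enorm v.
  move=> Fy; rewrite (le_trans (ler_normD _ _))// normrM normr_nat.
  have h1 := normr_dot_le v (x - y); have h2 := subx _ Fy.
  have h3 : enorm v * enorm (x - y) <= enorm v * (n + r) by rewrite ler_wpM2l.
  by rewrite (ger0_norm (dot_ge0 _)) -sqr_enorm /D; nra.
have qE y : dot (x + v - y) (x + v - y) = dot (x - y) (x - y) + e y.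
  have -> : x + v - y = (x - y) + v by rewrite addrAC.
  by rewrite /e; move: (x - y) => z; rewrite dotDl !dotDr (dotC z v); ring.
have e16 y : F y -> 16 * `|e y| <= m by move=> /eD h; lra.
have kl y : F y -> `|kap (dot (x + v - y) (x + v - y)) - kap (dot (x - y) (x - y))| <=
    c * enorm v.
  move=> Fy; rewrite qE (le_trans (kap_lipschitz m0 (mle _ Fy) (e16 _ Fy)))//.
  by rewrite /c -[leRHS]mulrA ler_wpM2l ?eD// mulr_ge0 ?invr_ge0 ?(ltW m0)// mulr_ge0.
have m'0 : 0 < m / 2 by rewrite divr_gt0.
have mle' y : F y -> m / 2 <= dot (x + v - y) (x + v - y).
  move=> Fy; rewrite qE; have := e16 _ Fy; have := mle _ Fy.
  by have := ler_norm (- e y); rewrite normrN; lra.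
have kk y : F y -> kap (dot (x - y) (x - y)) <= kap m by move=> Fy; rewrite kap_le ?mle.
have bA y : F y -> `|potA (x + v) y - potA x y| <= K * enorm v.
  move=> Fy; rewrite /potA.
  have -> (p q k l s : R) : (p - s) * k - (q - s) * l = (p - s) * (k - l) + (p - q) * l by ring.
  rewrite (le_trans (ler_normD _ _))// !normrM (ger0_norm (kap_ge0 _)).
  have xv : enorm (x + v) <= n + 1 by rewrite (le_trans (addx _))// lerD2l.
  have h1 : `|dot (x + v) (x + v) - r ^+ 2| <= (n + 1) ^+ 2 + r ^+ 2.
    rewrite (le_trans (ler_normB _ _))// -sqr_enorm !ger0_norm ?sqr_ge0// lerD2r.
    by rewrite lerXn2r ?nnegrE ?enorm_ge0 ?addr_ge0.
  have h2 : `|dot (x + v) (x + v) - dot x x| <= (2 * n + 1) * enorm v.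
    have -> : dot (x + v) (x + v) - dot x x = 2 * dot x v + dot v v.
      by rewrite dotDl !dotDr (dotC v x); ring.
    rewrite (le_trans (ler_normD _ _))// normrM normr_nat (ger0_norm (dot_ge0 _)).
    by have := dotx v; rewrite -sqr_enorm; nra.
  have h3 := ler_pM (normr_ge0 _) (normr_ge0 _) h1 (kl _ Fy).
  have h4 := ler_pM (normr_ge0 _) (kap_ge0 _) h2 (kk _ Fy).
  have h5 : 0 <= (n + r + 1) * (c * enorm v).
    by do ?[exact: sqr_ge0|apply: addr_ge0 => //|apply: mulr_ge0 => //].
  have h6 : 0 <= kap m * enorm v by rewrite mulr_ge0.
  by rewrite (le_trans (lerD h3 h4))// /K; nra.
have bB y i : F y -> `|potB (x + v) y 0 i - potB x y 0 i| <= K * enorm v.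
  move=> Fy; rewrite /potB !mxE.
  have -> (k l p w s : R) : k * (p + w + s) - l * (p + s) = (k - l) * (p + s + w) + l * w by
    ring.
  rewrite (le_trans (ler_normD _ _))// !normrM (ger0_norm (kap_ge0 _)).
  have h1 : `|x 0 i - y 0 i + v 0 i| <= n + r + 1.
    have -> : x 0 i - y 0 i = (x - y) 0 i by rewrite !mxE.
    rewrite (le_trans (ler_normD _ _))// lerD//.
      by rewrite (le_trans (coord_le _ _))// subx.
    by rewrite (le_trans (coord_le _ _)).
  have h3 := ler_pM (normr_ge0 _) (normr_ge0 _) (kl _ Fy) h1.
  have h4 := ler_pM (kap_ge0 _) (normr_ge0 _) (kk _ Fy) (coord_le v i).
  have h5 : 0 <= ((n + 1) ^+ 2 + r ^+ 2) * (c * enorm v).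
    by do ?[exact: sqr_ge0|apply: addr_ge0 => //|apply: mulr_ge0 => //].
  have h6 : 0 <= (2 * n + 1) * (kap m * enorm v) by do ?[apply: addr_ge0 => //|apply: mulr_ge0
    => //].
  by rewrite (le_trans (lerD h3 h4))// /K; nra.
have mA := measurable_potA m0 mle; have mB := measurable_potB m0 mle.
have mA' := measurable_potA m'0 mle'; have mB' := measurable_potB m'0 mle'.
have E y : a y * (potA (x + v) y - potA x y) + dot (b y) (potB (x + v) y - potB x y) =
  (a y * potA (x + v) y + dot (b y) (potB (x + v) y)) -
  (a y * potA x y + dot (b y) (potB x y)) by rewrite dotBr; ring.
have mAA : measurable_fun F (fun y => potA (x + v) y - potA x y) by exact: measurable_funB.
have mBB i : measurable_fun F (fun y => (potB (x + v) y - potB x y) 0 i).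
  rewrite (_ : (fun y => _) = (fun y => potB (x + v) y 0 i - potB x y 0 i)).
    exact: measurable_funB.
  by apply/funext => y; rewrite !mxE.
have bBB y i : F y -> `|(potB (x + v) y - potB x y) 0 i| <= K * enorm v.
  by move=> Fy; have := bB y i Fy; rewrite !mxE.
have [_] := weight_bound mAA mBB bA bBB.
rewrite !potE -RintegralB//.
- by under [in X in X -> _]eq_Rintegral do rewrite E; rewrite mulrAC.
- apply: pot_integrable => /mle'; rewrite subrr dotE !mxE !mulr0 !addr0; lra.
- exact: pot_integrable.
Qed.

Lemma pot_continuous x : ~ F x -> {for x, continuous pot}.
Proof.
move=> Fx; have [d [L [d0 L0 dL]]] := pot_lipschitz Fx.
apply/(@cvgrPdist_lt _ _ _ (nbhs x)) => e e0.
have d'0 : 0 < Num.min d (e / (L + 1)).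
  by rewrite lt_min d0 divr_gt0// ltr_wpDl.
have := near_enorm x d'0; apply: filterS => z; rewrite lt_min => /andP[zd ze].
rewrite distrC; have -> : z = x + (z - x) by rewrite addrC subrK.
rewrite (le_lt_trans (dL _ zd))//.
rewrite ltr_pdivlMr ?ltr_wpDl// in ze.
by have := enorm_ge0 (z - x); lra.
Qed.

Section arc.
Variables (X0 X1 X2 : E) (q0 q1 q2 lam : R).

Definition arc_den (t : R) : R := q0 + q1 * t + q2 * t ^+ 2.
Definition arc_num (t : R) : E := X0 + t *: X1 + t ^+ 2 *: X2.
Definition arc_point t : E := (arc_den t)^-1 *: arc_num t.

(** On a curve x = [arc_num] / [arc_den] in the sphere of radius lam, |x - y|^2 times [arc_den] is
    (lam ^ 2 + r ^ 2) [arc_den] - 2 [arc_num] . y, of degree 2 in t. The numerator and the argument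
    of [kap] are both multiplied by [arc_den], which divides [pot] by its square root. *)
Definition arc_pot (t : R) : R := \int[mu]_(y in F)
  (((a y * (lam ^+ 2 - r ^+ 2) - dot (b y) y) * arc_den t + dot (b y) (arc_num t)) *
   kap ((lam ^+ 2 + r ^+ 2) * arc_den t - 2 * dot (arc_num t) y)).

Variable t0 : R.
Hypotheses (lamE : dot (arc_num t0) (arc_num t0) = lam ^+ 2 * arc_den t0 ^+ 2)
  (den_gt0 : 0 < arc_den t0) (Ft0 : ~ F (arc_point t0)).

Let quadE y : F y -> (lam ^+ 2 + r ^+ 2) * arc_den t0 - 2 * dot (arc_num t0) y =
  arc_den t0 * dot (arc_point t0 - y) (arc_point t0 - y).
Proof.
move=> Fy; rewrite /arc_point dotBl !dotBr !dotZl !dotZr lamE (Fdot Fy).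
rewrite (dotC y); field; exact: lt0r_neq0.
Qed.

Lemma arc_potE : arc_pot t0 = pot (arc_point t0) / Num.sqrt (arc_den t0).
Proof.
rewrite potE -RintegralZr//; last exact: pot_integrable.
apply: eq_Rintegral => y; rewrite inE => Fy; rewrite quadE// kapM ?(ltW den_gt0)//.
rewrite /potA /potB dotZr.
have -> : dot (arc_point t0) (arc_point t0) = lam ^+ 2.
  by rewrite /arc_point dotZl dotZr lamE; field; exact: lt0r_neq0.
have -> : dot (b y) (arc_point t0 - y) = (arc_den t0)^-1 * dot (b y) (arc_num t0) - dot (b y) y.
  by rewrite dotBr dotZr.
rewrite /kap; have := sqr_sqrtr (ltW den_gt0).
have : Num.sqrt (arc_den t0) != 0 by rewrite gt_eqF// sqrtr_gt0.
move: (Num.sqrt (arc_den t0)) => w w0 <-.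
move: (Num.sqrt _) => k.
(* For k = 0 the convention that the inverse of 0 is 0 makes both sides vanish. *)
have [->|k0] := eqVneq k 0; last by field; rewrite k0 w0.
by rewrite expr0n /= invr0 !(mulr0, mul0r, addr0).
Qed.

Lemma arc_taylor : exists c, taylor (fun s => arc_pot (t0 + s)) c.
Proof.
have [m m0 mle] := closed_sep cF Ft0.
pose al y := (lam ^+ 2 + r ^+ 2) * arc_den t0 - 2 * dot (arc_num t0) y.
(* [Y1] and [s1] are the derivatives of [arc_num] and [arc_den] at t0, hence the linear coefficients
   in s for t = t0 + s. *)
pose Y1 := X1 + (2 * t0) *: X2; pose s1 := q1 + 2 * q2 * t0.
pose be y := (lam ^+ 2 + r ^+ 2) * s1 / 2 - dot Y1 y.
pose ga y := (lam ^+ 2 + r ^+ 2) * q2 - 2 * dot X2 y.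
pose w y := a y * (lam ^+ 2 - r ^+ 2) - dot (b y) y.
have md v : measurable_fun F (fun y : E => dot v y).
  by apply: measurable_dot => i //; exact: measurable_coord.
have iby : mu.-integrable F (EFin \o (fun y => dot (b y) y)).
  apply: (integrable_dot (M := r)) => [i|y Fy]; first exact: measurable_coord.
  by rewrite (Fenorm Fy).
have ibv v : mu.-integrable F (EFin \o (fun y => dot (b y) v)).
  exact: (integrable_dot (M := enorm v)).
have iw : mu.-integrable F (EFin \o w).
  rewrite (_ : w = (fun y => (lam ^+ 2 - r ^+ 2) * a y + (- 1) * dot (b y) y)).
    by apply: integrable_add => //; apply: integrable_scale.
  by apply/funext => y; rewrite /w; ring.
have ip (k : R) v : mu.-integrable F (EFin \o (fun y => k * w y + dot (b y) v)).
  by apply: integrable_add => //; exact: integrable_scale.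
have mal : measurable_fun F al by apply: measurable_funB => //; exact: measurable_funM.
have mbe : measurable_fun F be by exact: measurable_funB.
have mga : measurable_fun F ga by apply: measurable_funB => //; exact: measurable_funM.
have dle v y : F y -> `|dot v y| <= enorm v * r.
  by move=> Fy; rewrite (le_trans (normr_dot_le _ _))// (Fenorm Fy).
pose B := `|(lam ^+ 2 + r ^+ 2) * s1 / 2| + enorm Y1 * r +
  (`|(lam ^+ 2 + r ^+ 2) * q2| + 2 * (enorm X2 * r)).
have v0 v : 0 <= enorm v * r by rewrite mulr_ge0 ?enorm_ge0.
have bbe y : F y -> `|be y| <= B.
  move=> Fy; rewrite (le_trans (ler_normB _ _))// /B -[leLHS]addr0 lerD ?lerD2l ?dle//.
  by rewrite addr_ge0// mulr_ge0// v0.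
have bga y : F y -> `|ga y| <= B.
  move=> Fy; rewrite (le_trans (ler_normB _ _))// /B -[leLHS]add0r lerD//.
    by rewrite addr_ge0.
  by rewrite lerD2l normrM normr_nat ler_wpM2l// dle.
have mm : 0 < arc_den t0 * m by rewrite mulr_gt0.
have alge y : F y -> arc_den t0 * m <= al y.
  by move=> Fy; rewrite /al quadE// ler_wpM2l ?mle// ltW.
have h := taylor_quad mF mal mbe mga mm alge bbe bga
  (ip (arc_den t0) (arc_num t0)) (ip s1 Y1) (ip q2 X2).
eexists; apply: eq_taylor h; exists 1 => // s _.
apply: eq_Rintegral => y _; congr (_ * kap _).
  rewrite /w /s1 /Y1 /arc_den /arc_num !(dotDr, dotZr); ring.
by rewrite /al /be /ga /s1 /Y1 /arc_den /arc_num !(dotDl, dotZl); field.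
Qed.

End arc.

End potential.

(** * Separation of the two potentials *)

Section separation.
Context {R : realType}.
Notation E := 'rV[R]_3.
Implicit Types x y z u v : E.

Lemma enormN u : enorm (- u) = enorm u.
Proof. by rewrite /enorm dotNl dotNr opprK. Qed.

Lemma enorm_delta i : enorm (delta_mx 0 i : E) = 1.
Proof. by rewrite /enorm dot_delta mxE !eqxx sqrtr1. Qed.

Lemma enorm_line_delta x i (t : R) :
  enorm x - `|t| <= enorm (x + t *: delta_mx 0 i) <= enorm x + `|t|.
Proof.
have e : enorm (t *: delta_mx 0 i : E) = `|t| by rewrite enormZ enorm_delta mulr1.
apply/andP; split; last by rewrite -e ler_enormD.
have := ler_enormB x (- (t *: delta_mx 0 i)).
by rewrite opprK enormN e.
Qed.

Lemma cont_near_eq (V W : E -> R) x : (\forall z \near x, V z = W z) ->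
  {for x, continuous W} -> {for x, continuous V}.
Proof.
move=> VW cW; apply/(@cvgrPdist_lt _ _ _ (nbhs x)) => e e0.
have -> : V x = W x by exact: nbhs_singleton VW.
have /(@cvgrPdist_lt _ _ _ (nbhs x)) /(_ e e0) := cW.
by apply: filterS2 VW => z ->.
Qed.

Context (mu0 mu1 : {measure set E -> \bar R}) (F0 F1 : set E) (r0 r1 r2 : R).
Context (a0 a1 : E -> R) (b0 b1 : E -> E).
Hypotheses (r1_ge0 : 0 <= r1) (r10 : r1 < r0) (r02 : r0 < r2).
Hypotheses (cF0 : closed F0) (cF1 : closed F1)
  (F0r : F0 `<=` sphere r0) (F1r : F1 `<=` sphere r1)
  (F0_gap : F0 <> sphere r0).
Hypotheses (ia0 : mu0.-integrable F0 (EFin \o a0))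
  (ib0 : forall i, mu0.-integrable F0 (EFin \o (fun y => b0 y 0 i)))
  (ia1 : mu1.-integrable F1 (EFin \o a1))
  (ib1 : forall i, mu1.-integrable F1 (EFin \o (fun y => b1 y 0 i))).

Let r0_gt0 : 0 < r0. Proof. exact: le_lt_trans r10. Qed.
Let r0_ge0 : 0 <= r0. Proof. exact: ltW. Qed.

Let P0 := pot mu0 F0 r0 a0 b0.
Let P1 := pot mu1 F1 r1 a1 b1.

Let F0P x : enorm x != r0 -> ~ F0 x.
Proof. by move=> /eqP xr /F0r. Qed.

Let F1P x : enorm x != r1 -> ~ F1 x.
Proof. by move=> /eqP xr /F1r. Qed.

Let line0 := pot_line cF0 r0_ge0 F0r ia0 ib0.
Let line1 := pot_line cF1 r1_ge0 F1r ia1 ib1.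

Let decay (mu : {measure set E -> \bar R}) (F : set E) (r : R) (a : E -> R)
    (b : E -> E) (k e : R) : closed F -> 0 <= r ->
  F `<=` sphere r -> mu.-integrable F (EFin \o a) ->
  (forall i, mu.-integrable F (EFin \o (fun y => b y 0 i))) -> 0 < e ->
  exists M, forall x, M <= enorm x -> `|k * pot mu F r a b x| <= e.
Proof.
move=> cF rr Fr ia ib e0; set W := pot_mass mu F a b.
have W0 : 0 <= W by exact: pot_mass_ge0.
exists (Num.max (Num.max (2 * r) 1) (8 * `|k| * W / e)) => x.
rewrite !ge_max => /andP[/andP[xr x1] xk]; have x0 : 0 < enorm x by lra.
rewrite normrM (@le_trans _ _ (`|k| * (8 / enorm x * W)))//.
  by rewrite ler_wpM2l// pot_decay.
move: xk; rewrite ler_pdivrMr// => xk.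
rewrite (_ : `|k| * _ = (8 * `|k| * W) / enorm x); last by field; rewrite gt_eqF.
by rewrite ler_pdivrMr// [e * _]mulrC.
Qed.

Section step.
Variables k0 k1 : R.

(** The coefficients stay arbitrary so that the one-sided estimate [exterior_le0] applies to u and
    to - u. *)
Let u x := k0 * P0 x + k1 * P1 x.

Let cu x : enorm x != r0 -> enorm x != r1 -> {for x, continuous u}.
Proof.
move=> xr0 xr1.
have c0 := pot_continuous cF0 r0_ge0 F0r ia0 ib0 (F0P xr0).
have c1 := pot_continuous cF1 r1_ge0 F1r ia1 ib1 (F1P xr1).
have cst_cont (k : R) : {for x, continuous (fun _ : E => k)} by exact: contC.
apply: contD; first exact: (contM (cst_cont k0) c0).
exact: (contM (cst_cont k1) c1).
Qed.

Lemma exterior_le0 : (forall x, enorm x = r2 -> u x = 0) ->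
  forall x, r2 <= enorm x -> u x <= 0.
Proof.
have [h10 h02] := (r10, r02).
move=> u2; apply: max_principle.
- by move=> x xr; apply: cu; rewrite gt_eqF//; lra.
- move=> x xr.
  have Fx0 : ~ F0 x by apply: F0P; rewrite gt_eqF//; lra.
  have Fx1 : ~ F1 x by apply: F1P; rewrite gt_eqF//; lra.
  exists (fun i n => k0 * pot_coef mu0 F0 r0 a0 b0 x (delta_mx 0 i) n +
    k1 * pot_coef mu1 F1 r1 a1 b1 x (delta_mx 0 i) n); split.
    by move=> i; apply: taylorD; apply: taylorZ; [exact: line0|exact: line1].
  rewrite big_split/= -!mulr_sumr.
  rewrite (pot_harmonic cF0 r0_ge0 F0r ia0 ib0 Fx0).
  by rewrite (pot_harmonic cF1 r1_ge0 F1r ia1 ib1 Fx1) !mulr0 addr0.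
- by move=> x /u2 ->.
- move=> e e0; have e20 : 0 < e / 2 by rewrite divr_gt0.
  have [M0 h0] := decay k0 cF0 r0_ge0 F0r ia0 ib0 e20.
  have [M1 h1] := decay k1 cF1 r1_ge0 F1r ia1 ib1 e20.
  exists (Num.max M0 M1) => x; rewrite ge_max => /andP[/h0 x0 /h1 x1].
  have := ler_norm (k0 * P0 x); have := ler_norm (k1 * P1 x).
  by rewrite /u; lra.
Qed.

Lemma sum_line x v : ~ F0 x -> ~ F1 x -> exists c, taylor (fun t => u (x + t *: v)) c.
Proof.
move=> x0 x1; eexists; apply: taylorD; apply: taylorZ; [exact: line0|exact: line1].
Qed.

Hypothesis u_ext : forall x, r2 <= enorm x -> u x = 0.

(* The radial segment from infinity to x avoids F0. *)
Lemma sum_cone x : r1 < enorm x -> enorm x < r0 ->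
  ~ F0 ((r0 / enorm x) *: x) -> u x = 0.
Proof.
have [h10 h02] := (r10, r02).
move=> xr1 xr0 Fx; have x0 : 0 < enorm x by exact: le_lt_trans xr1.
(* The segment starts at norm 2 r2, so its points for t < 1 / 2 still have norm at least r2, where u
   is known to vanish. *)
pose L := 2 * r2 / enorm x; pose v := x - L *: x.
have L1 : 1 <= L by rewrite /L ler_pdivlMr// mul1r; lra.
have lineE s : L *: x + s *: v = (L + s * (1 - L)) *: x.
  by rewrite /v -{2}(scale1r x) -scalerBl scalerA -scalerDl.
have ns s : 0 <= s <= 1 -> enorm (L *: x + s *: v) = (L + s * (1 - L)) * enorm x.
  by move=> /andP[s0 s1]; rewrite lineE enormZ ger0_norm//; nra.
have nx s : 0 <= s <= 1 -> enorm x <= enorm (L *: x + s *: v).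
  by move=> s01; rewrite ns// ler_peMl ?enorm_ge0//; case/andP: s01 => s0 s1; nra.
pose U t := u (L *: x + t *: v).
have -> : x = L *: x + 1 *: v by rewrite /v scale1r addrC subrK.
apply: (@taylor_propagation _ U); last by rewrite ler01 lexx.
- move=> s s01; have := nx _ s01 => nxs.
  have [||c hc] := @sum_line (L *: x + s *: v) v.
  + move=> F0s; apply: Fx; move: (F0s) => /F0r; rewrite /sphere/= ns// => e.
    by move: F0s; rewrite lineE; congr (F0 (_ *: _)); rewrite -e mulfK// gt_eqF.
  + by apply: F1P; rewrite gt_eqF// (lt_le_trans xr1).
  + exists c; apply: eq_taylor hc; exists 1; first exact: ltr01.
    by move=> t _; rewrite /U scalerDl addrA.
- exists (2^-1); first by rewrite invr_gt0.
  move=> t /andP[t0 t1]; apply: u_ext; rewrite ns; last by apply/andP; split; lra.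
  have : (1 - t) * L <= L + t * (1 - L) by lra.
  move=> h; apply: le_trans (_ : (1 - t) * L * enorm x <= _); last by rewrite ler_wpM2r// ltW.
  have -> : (1 - t) * L * enorm x = (1 - t) * (2 * r2).
    by rewrite /L; field; rewrite gt_eqF.
  nra.
Qed.

Variable p : E.
Hypotheses (pr : enorm p = r0) (Fp : ~ F0 p).

Let p_neq0 : p != 0. Proof. by rewrite -enorm_gt0 pr. Qed.

(* The arc from (enorm x / r0) p to x is the reflection of its starting point
   p' across the line spanned by p' + t x. *)
Lemma sum_shell x : r1 < enorm x -> enorm x < r0 ->
  x != - ((enorm x / r0) *: p) -> u x = 0.
Proof.
set l := enorm x => l1 l0; have l_gt0 : 0 < l by exact: le_lt_trans l1.
have [p' p'E] : exists p', p' = (l / r0) *: p by eexists.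
rewrite -p'E => xp'.
have pp : dot p' p' = l ^+ 2.
  by rewrite p'E dotZl dotZr -sqr_enorm pr; field; rewrite gt_eqF.
have xx : dot x x = l ^+ 2 by rewrite -sqr_enorm.
set g := dot p' x.
(* The exclusion of the antipode - p' enters here: it keeps the denominator of the arc positive up
   to t = 1. *)
have gl : - l ^+ 2 < g.
  have : 0 < dot (x + p') (x + p') by rewrite dot_gt0 addr_eq0.
  by rewrite dotDl !dotDr (dotC x p') -/g xx pp; lra.
have gl' : g <= l ^+ 2.
  have := normr_dot_le p' x; rewrite -/g => h.
  have e1 : enorm p' = l by rewrite /enorm pp sqrtr_sqr gtr0_norm.
  by rewrite e1 -/l -expr2 in h; apply: le_trans h; exact: ler_norm.
(* With w = p' + t x, the reflection of p' is (2 (p' . w) w - |w|^2 p') / |w|^2. These are the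
   coefficients in t of its numerator, and [q0], [q1], [q2] are those of |w|^2. *)
pose X0 := (l ^+ 2) *: p'; pose X1 := (2 * l ^+ 2) *: x.
pose X2 := (2 * g) *: x - (l ^+ 2) *: p'.
pose q0 := l ^+ 2; pose q1 := 2 * g; pose q2 := l ^+ 2.
have l2 : 0 < l ^+ 2 by rewrite exprn_gt0.
have den_gt0 t : 0 <= t <= 1 -> 0 < arc_den q0 q1 q2 t.
  move=> /andP[t0 t1]; rewrite /arc_den /q0 /q1 /q2.
  have -> : l ^+ 2 + 2 * g * t + l ^+ 2 * t ^+ 2 =
    l ^+ 2 * (1 - t) ^+ 2 + 2 * (t * (g + l ^+ 2)) by ring.
  move: t0; rewrite le_eqVlt => /predU1P[<-|t0].
    by rewrite mul0r mulr0 addr0 subr0 expr1n mulr1.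
  rewrite ltr_wpDl//; first by rewrite mulr_ge0 ?sqr_ge0.
  by rewrite mulr_gt0// mulr_gt0// -ltrBlDr sub0r.
have numE t : dot (arc_num X0 X1 X2 t) (arc_num X0 X1 X2 t) =
    l ^+ 2 * arc_den q0 q1 q2 t ^+ 2.
  rewrite /arc_num /arc_den /X0 /X1 /X2 /q0 /q1 /q2.
  rewrite !(dotDl, dotDr, dotZl, dotZr, dotNl, dotNr) (dotC x p') -/g xx pp; ring.
have ptE t : 0 <= t <= 1 -> enorm (arc_point X0 X1 X2 q0 q1 q2 t) = l.
  move=> /den_gt0 d0; rewrite /arc_point enormZ /enorm numE.
  rewrite sqrtrM ?sqr_ge0// !sqrtr_sqr normfV !gtr0_norm//.
  by field; rewrite gt_eqF.
have pF0 t : 0 <= t <= 1 -> ~ F0 (arc_point X0 X1 X2 q0 q1 q2 t).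
  by move=> /ptE h; apply: F0P; rewrite h lt_eqF.
have pF1 t : 0 <= t <= 1 -> ~ F1 (arc_point X0 X1 X2 q0 q1 q2 t).
  by move=> /ptE h; apply: F1P; rewrite h gt_eqF.
pose U t := k0 * arc_pot mu0 F0 r0 a0 b0 X0 X1 X2 q0 q1 q2 l t +
  k1 * arc_pot mu1 F1 r1 a1 b1 X0 X1 X2 q0 q1 q2 l t.
have UE t : 0 <= t <= 1 ->
    U t = u (arc_point X0 X1 X2 q0 q1 q2 t) / Num.sqrt (arc_den q0 q1 q2 t).
  move=> t01; rewrite /U /u.
  rewrite (arc_potE cF0 r0_ge0 F0r ia0 ib0 (numE t) (den_gt0 _ t01) (pF0 _ t01)).
  rewrite (arc_potE cF1 r1_ge0 F1r ia1 ib1 (numE t) (den_gt0 _ t01) (pF1 _ t01)).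
  by rewrite /P0 /P1; ring.
have t01 : 0 <= (1 : R) <= 1 by rewrite ler01 lexx.
have pt0 : arc_point X0 X1 X2 q0 q1 q2 0 = p'.
  rewrite /arc_point /arc_num /arc_den expr0n /= !mulr0 !scale0r !addr0 /X0 /q0.
  by rewrite scalerA mulVf ?scale1r// gt_eqF.
have pt1 : arc_point X0 X1 X2 q0 q1 q2 1 = x.
  have d1 := den_gt0 _ t01.
  rewrite /arc_point; have -> : arc_num X0 X1 X2 1 = arc_den q0 q1 q2 1 *: x.
    rewrite /arc_num /arc_den /X0 /X1 /X2 /q0 /q1 /q2.
    by apply/rowP => i; rewrite !mxE; ring.
  by rewrite scalerA mulVf ?scale1r// gt_eqF.
(* Near its start the arc stays in the cone over the gap, which is open, so [sum_cone] gives the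
   initial zeros. *)
have near0 : \forall t \near (0 : R), ~ F0 ((r0 / l) *: arc_point X0 X1 X2 q0 q1 q2 t).
  have cpt : {for (0 : R), continuous (fun t => (r0 / l) *: arc_point X0 X1 X2 q0 q1 q2 t)}.
    apply: contZ; first exact: contC.
    have cX : {for (0 : R), continuous (fun t : R => t ^+ 2)}.
      by apply: contM; exact: contI.
    apply: contZ.
      apply: contcomp; last by apply: inv_continuous; rewrite gt_eqF// den_gt0// lexx ler01.
      apply: contD; last by apply: contM => //; exact: contC.
      by apply: contD; [exact: contC|apply: contM; [exact: contC|exact: contI]].
    apply: contD; last by apply: contZ => //; exact: contC.
    by apply: contD; [exact: contC|apply: contZ; [exact: contI|exact: contC]].
  have : nbhs ((r0 / l) *: arc_point X0 X1 X2 q0 q1 q2 0) (~` F0).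
    rewrite pt0 p'E scalerA (_ : _ * _ = 1).
      by rewrite scale1r; apply: open_nbhs_nbhs; split => //; exact: closed_openC.
    by field; rewrite !gt_eqF.
  by move=> /cpt.
have : U 1 = 0.
  apply: (@taylor_propagation _ U) => //.
  - move=> s s01.
    have [c0 h0] := arc_taylor cF0 r0_ge0 F0r ia0 ib0 (numE s) (den_gt0 _ s01) (pF0 _ s01).
    have [c1 h1] := arc_taylor cF1 r1_ge0 F1r ia1 ib1 (numE s) (den_gt0 _ s01) (pF1 _ s01).
    by eexists; apply: taylorD; apply: taylorZ; [exact: h0|exact: h1].
  - move: near0 => /nbhs_ballP[e /= e0 he]; exists (Num.min e 1).
      by rewrite lt_min e0 ltr01.
    move=> t; rewrite lt_min => /andP[t0 /andP[te t1]].
    have t01' : 0 <= t <= 1 by rewrite t0 ltW.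
    rewrite UE// sum_cone ?mul0r// ?ptE//.
    by apply: he; rewrite /ball/= sub0r normrN ger0_norm.
rewrite UE// pt1 => /eqP; rewrite mulf_eq0 invr_eq0 sqrtr_eq0.
by rewrite [_ <= 0]leNgt den_gt0//= orbF => /eqP.
Qed.

(** The antipode left out by [sum_shell] is a limit of points of the shell where u vanishes, and the
    expansion along a coordinate line forces the value 0 there too. *)
Lemma sum_shell_all x : r1 < enorm x -> enorm x < r0 -> u x = 0.
Proof.
move=> l1 l0; have [xp|] := eqVneq x (- ((enorm x / r0) *: p)); last exact: sum_shell.
have [j pj] : exists j, p 0 j != 0.
  apply/existsP; rewrite -negb_forall; apply: contra p_neq0 => /forallP h.
  by apply/eqP/rowP => j; rewrite mxE; apply/eqP.
(* As p has a nonzero coordinate j, moving along an axis i other than j leaves the line spanned by p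
   at once. *)
have [i ij] : exists i : 'I_3, i != j.
  by exists (if j == ord0 then ord_max else ord0); case: ifPn => [/eqP ->|]; rewrite // eq_sym.
have Fx0 : ~ F0 x by apply: F0P; rewrite lt_eqF.
have Fx1 : ~ F1 x by apply: F1P; rewrite gt_eqF.
have [c hc] := sum_line (delta_mx 0 i) Fx0 Fx1.
have := taylor0 hc; rewrite scale0r addr0 => ->.
apply: (taylor_coef0 hc) => e e0.
pose d := Num.min (Num.min e (enorm x - r1)) (r0 - enorm x) / 2.
have m0 : 0 < Num.min (Num.min e (enorm x - r1)) (r0 - enorm x).
  by rewrite !lt_min e0 !subr_gt0 l1 l0.
have me : Num.min (Num.min e (enorm x - r1)) (r0 - enorm x) <= e by rewrite !ge_min lexx.
have m1 : Num.min (Num.min e (enorm x - r1)) (r0 - enorm x) <= enorm x - r1.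
  by rewrite !ge_min lexx !orbT.
have m2 : Num.min (Num.min e (enorm x - r1)) (r0 - enorm x) <= r0 - enorm x.
  by rewrite !ge_min lexx !orbT.
have d0 : 0 < d by rewrite divr_gt0.
have de : `|d| = d by rewrite gtr0_norm.
exists d; rewrite de d0/=; split; first by rewrite /d; lra.
have := enorm_line_delta x i d; rewrite de => /andP[h1 h2].
apply: sum_shell; [by rewrite /d in h1 *; lra|by rewrite /d in h2 *; lra|].
have key (c1 c2 : R) : x = - (c1 *: p) -> x + d *: delta_mx 0 i = - (c2 *: p) -> False.
  move=> /rowP A /rowP B; have := B i; have := B j; have := A i; have := A j.
  rewrite !mxE !eqxx [j == i]eq_sym (negbTE ij) /= mulr0 addr0 mulr1 => -> -> /eqP.
  rewrite eqr_opp -subr_eq0 -mulrBl mulf_eq0 (negbTE pj) orbF subr_eq0 => /eqP ->.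
  by move=> h; lra.
by apply/eqP; exact: key xp.
Qed.

End step.

Lemma potentials_vanish (k0 k1 : R) :
  (forall x, enorm x = r2 -> k0 * P0 x + k1 * P1 x = 0) ->
  [/\ forall x, enorm x < r0 -> k0 * P0 x = 0,
      forall x, r2 <= enorm x -> k0 * P0 x = 0 &
      forall x, r1 < enorm x -> k1 * P1 x = 0].
Proof.
have [h10 h02] := (r10, r02).
move=> u2.
have u_ext x : r2 <= enorm x -> k0 * P0 x + k1 * P1 x = 0.
  move=> xr; apply/eqP; rewrite eq_le exterior_le0//=.
  rewrite -oppr_le0 opprD -!mulNr; apply: exterior_le0 => // z /u2 h.
  by rewrite !mulNr -opprD h oppr0.
have [p [pr Fp]] : exists p, enorm p = r0 /\ ~ F0 p.
  apply: contrapT => h; apply: F0_gap; apply/seteqP; split => // x xr.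
  by apply: contrapT => F0x; apply: h; exists x.
have shell x := sum_shell_all u_ext pr Fp (x := x).
pose V x := if enorm x < r0 then k0 * P0 x else - (k1 * P1 x).
(* The two formulas agree on the shell, so every point has a neighbourhood on which V is given by a
   single one; continuity and harmonicity are then local. *)
have V1 x : r1 < enorm x -> V x = - (k1 * P1 x).
  move=> xr1; rewrite /V; case: ifPn => // xr0.
  by apply/eqP; rewrite -addr_eq0; apply/eqP; exact: shell.
have cV x : {for x, continuous V}.
  have [xr0|xr0] := ltP (enorm x) r0.
    have c0 := pot_continuous cF0 r0_ge0 F0r ia0 ib0 (F0P (negbT (lt_eqF xr0))).
    apply: (@cont_near_eq _ (fun x => k0 * P0 x)).
      have d0 : 0 < r0 - enorm x by rewrite subr_gt0.
      apply: filterS (near_enorm x d0) => z zx; rewrite /V ifT//.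
      have := ler_enormD (z - x) x; rewrite subrK => h; lra.
    exact: (contM (@contC _ _ R k0 x) c0).
  have xr1 : r1 < enorm x by lra.
  have c1 := pot_continuous cF1 r1_ge0 F1r ia1 ib1 (F1P (negbT (gt_eqF xr1))).
  apply: (@cont_near_eq _ (fun x => (- k1) * P1 x)).
    have d0 : 0 < enorm x - r1 by rewrite subr_gt0.
    apply: filterS (near_enorm x d0) => z zx; rewrite V1 ?mulNr//.
    by have := ler_enormB x z; rewrite -(enormN (x - z)) opprB => h; lra.
  exact: (contM (@contC _ _ R (- k1) x) c1).
have hV x : exists c : 'I_3 -> nat -> R,
    (forall i, taylor (fun t => V (x + t *: delta_mx 0 i)) (c i)) /\ \sum_i c i 2 = 0.
  have [xr0|xr0] := ltP (enorm x) r0.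
    have Fx := F0P (negbT (lt_eqF xr0)).
    exists (fun i n => k0 * pot_coef mu0 F0 r0 a0 b0 x (delta_mx 0 i) n); split => [i|].
      apply: eq_taylor (taylorZ k0 (line0 _ Fx)).
      exists (r0 - enorm x); first by rewrite subr_gt0.
      move=> t tr; rewrite /V ifT//.
      by have /andP[_ h] := enorm_line_delta x i t; lra.
    by rewrite -mulr_sumr (pot_harmonic cF0 r0_ge0 F0r ia0 ib0 Fx) mulr0.
  have xr1 : r1 < enorm x by lra.
  have Fx := F1P (negbT (gt_eqF xr1)).
  exists (fun i n => (- k1) * pot_coef mu1 F1 r1 a1 b1 x (delta_mx 0 i) n); split => [i|].
    apply: eq_taylor (taylorZ (- k1) (line1 _ Fx)).
    exists (enorm x - r1); first by rewrite subr_gt0.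
    move=> t tr; rewrite V1 ?mulNr//.
    by have /andP[h _] := enorm_line_delta x i t; lra.
  by rewrite -mulr_sumr (pot_harmonic cF1 r1_ge0 F1r ia1 ib1 Fx) mulr0.
have dV e : 0 < e -> exists M, forall x, M <= enorm x -> `|V x| <= e.
  move=> e0; have [M hM] := decay k1 cF1 r1_ge0 F1r ia1 ib1 e0.
  exists (Num.max M r0) => x; rewrite ge_max => /andP[/hM h xr0].
  by rewrite V1 ?normrN//; lra.
have V0 x : V x = 0.
  have x1 : -1 <= enorm x by rewrite (le_trans _ (enorm_ge0 x))//; lra.
  apply/eqP; rewrite eq_le; apply/andP; split.
    apply: (max_principle (rho := -1)) => //.
    - by move=> z zr; have := enorm_ge0 z; lra.
    - move=> e /dV[M hM]; exists M => z /hM h; exact: le_trans (ler_norm _) h.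
  rewrite -oppr_le0.
  apply: (@max_principle _ (fun x => - V x) (-1)) => //.
  - move=> z _; have -> : (fun x => - V x) = (fun x => (-1) * V x).
      by apply/funext => w; rewrite mulN1r.
    exact: (contM (@contC _ _ R (-1) z) (cV z)).
  - move=> z _; have [c [hc sc]] := hV z.
    exists (fun i n => (-1) * c i n); split => [i|]; last by rewrite -mulr_sumr sc mulr0.
    apply: eq_taylor (taylorZ (-1) (hc i)); exists 1; first exact: ltr01.
    by move=> t _; rewrite mulN1r.
  - by move=> z zr; have := enorm_ge0 z; lra.
  - move=> e /dV[M hM]; exists M => z /hM; rewrite -normrN => h.
    exact: le_trans (ler_norm _) h.
have P1z x : r1 < enorm x -> k1 * P1 x = 0.
  by move=> xr; have := V0 x; rewrite V1// => /eqP; rewrite oppr_eq0 => /eqP.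
split => //.
- by move=> x xr; have := V0 x; rewrite /V xr.
- by move=> x xr; have := u_ext _ xr; rewrite (P1z x) ?addr0//; lra.
Qed.

End separation.

(** * Bernstein operators through the de Casteljau recursion *)

Section casteljau.
Context {R : realType}.
Implicit Types (s u v w : R) (n : nat) (phi psi : nat -> R).

(* The Bernstein operator: sum over a of binom(n, a) s^a (1-s)^(n-a) phi(a). *)
Fixpoint cas s n phi : R :=
  if n is m.+1 then s * cas s m (phi \o S) + (1 - s) * cas s m phi else phi 0%N.

(** This is the derivative of [cas s n phi] in s. *)
Definition dcas s n phi : R :=
  if n is m.+1 then n%:R * cas s m (fun a => phi a.+1 - phi a) else 0.

Lemma casD s n phi psi : cas s n (fun a => phi a + psi a) = cas s n phi + cas s n psi.
Proof.
elim: n phi psi => //= n IH phi psi.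
rewrite (IH phi psi) [cas s n (_ \o S)](IH (phi \o S) (psi \o S)); ring.
Qed.

Lemma casZ s n k phi : cas s n (fun a => k * phi a) = k * cas s n phi.
Proof.
elim: n phi => //= n IH phi.
rewrite (IH phi) [cas s n (_ \o S)](IH (phi \o S)); ring.
Qed.

Lemma casB s n phi psi : cas s n (fun a => phi a - psi a) = cas s n phi - cas s n psi.
Proof.
rewrite -[- cas s n psi]mulN1r -casZ -casD; congr (cas s n).
by apply/funext => a; rewrite mulN1r.
Qed.

Lemma cas_cst s n k : cas s n (fun=> k) = k.
Proof. elim: n => //= n IH; rewrite !IH; ring. Qed.

Lemma eq_cas s n phi psi : phi =1 psi -> cas s n phi = cas s n psi.
Proof. by move=> h; congr (cas s n); apply/funext. Qed.

Lemma cas_le s n phi psi : 0 <= s <= 1 -> (forall a, (a <= n)%N -> phi a <= psi a) ->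
  cas s n phi <= cas s n psi.
Proof.
move=> /andP[s0 s1]; elim: n phi psi => [|n IH] phi psi h /=; first exact: h.
apply: lerD; apply: ler_wpM2l; rewrite ?subr_ge0//; apply: IH => a an.
  by apply: (h a.+1).
by apply: h; exact: leqW.
Qed.

(** For s in [0, 1] the operator is positive and fixes constants, so pointwise deviation bounds pass
    through it. *)
Lemma cas_dist s n phi psi k : 0 <= s <= 1 ->
  (forall a, (a <= n)%N -> `|phi a - k| <= psi a) -> `|cas s n phi - k| <= cas s n psi.
Proof.
move=> s01 h; rewrite -[X in _ - X](cas_cst s n) -casB ler_norml; apply/andP; split.
  rewrite -mulN1r -casZ; apply: cas_le => // a /h.
  by rewrite ler_norml mulN1r => /andP[].
by apply: cas_le => // a /h; rewrite ler_norml => /andP[].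
Qed.

(** Variance plus squared bias of a binomial variable with parameters n and s. *)
Lemma cas_var s n x : cas s n (fun a => (a%:R - x) ^+ 2) =
  n%:R * s * (1 - s) + (n%:R * s - x) ^+ 2.
Proof.
elim: n x => [|n IH] x /=; first by ring.
rewrite (@eq_cas _ _ (_ \o S) (fun a => (a%:R - (x - 1)) ^+ 2)) ?IH.
  by rewrite -natr1; ring.
by move=> a /=; rewrite -natr1; congr (_ ^+ 2); ring.
Qed.

(** The recursion defining [cas], differentiated in s by the product rule. *)
Lemma dcasS s n phi : dcas s n.+1 phi = cas s n (phi \o S) - cas s n phi +
  (s * dcas s n (phi \o S) + (1 - s) * dcas s n phi).
Proof.
case: n => [|n]; first by rewrite /= mul1r !mulr0 !addr0.
pose D a := phi a.+1 - phi a.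
have E : cas s n.+1 D = cas s n.+1 (phi \o S) - cas s n.+1 phi by exact: casB.
transitivity (cas s n.+1 D + n.+1%:R * cas s n.+1 D).
  by rewrite -[X in X + _]mul1r -mulrDl addrC natr1.
by rewrite {1}E /=; ring.
Qed.

Definition cas3 u v w k l m (F : nat -> nat -> nat -> R) : R :=
  cas u k (fun a => cas v l (fun b => cas w m (F a b))).

Lemma cas3_dist u v w k l m (F G : nat -> nat -> nat -> R) x :
  0 <= u <= 1 -> 0 <= v <= 1 -> 0 <= w <= 1 ->
  (forall a b c, (a <= k)%N -> (b <= l)%N -> (c <= m)%N -> `|F a b c - x| <= G a b c) ->
  `|cas3 u v w k l m F - x| <= cas3 u v w k l m G.
Proof.
by move=> u01 v01 w01 h; do 3 (apply: cas_dist => // ? ?); exact: h.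
Qed.

Lemma cas3_sum u v w k l m e K (A B C : nat -> R) :
  cas3 u v w k l m (fun a b c => e + K * (A a + (B b + C c))) =
  e + K * (cas u k A + (cas v l B + cas w m C)).
Proof.
rewrite /cas3.
transitivity (cas u k (fun a => e + K * (A a + (cas v l B + cas w m C)))).
  apply: eq_cas => a.
  transitivity (cas v l (fun b => e + K * (A a + (B b + cas w m C)))).
    by apply: eq_cas => b; rewrite casD cas_cst casZ !casD !cas_cst.
  by rewrite casD cas_cst casZ !casD !cas_cst.
by rewrite casD cas_cst casZ !casD !cas_cst.
Qed.

End casteljau.

(** * Moduli of continuity and approximation at the nodes *)

Section c1_approximation.
Context {R : realType}.
Notation E := 'rV[R]_3.
Implicit Types (x y z : E).

Lemma is_derive_line (f : E -> R) (x v : E) (t df : R) :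
  is_derive (x + t *: v) v f df -> is_derive t 1 (fun s : R => f (x + s *: v)) df.
Proof.
move=> [dv <-].
have E0 (h : R) : x + (h * 1 + t) *: v = h *: v + (x + t *: v).
  by rewrite mulr1 scalerDl addrCA.
have E1 : (fun h : R => h^-1 *: (f (x + (h * 1 + t) *: v) - f (x + t *: v))) =
   (fun h : R => h^-1 *: ((f \o shift (x + t *: v)) (h *: v) - f (x + t *: v))).
  by apply/funext => h /=; rewrite E0.
by split; [move: dv; rewrite /derivable -E1|rewrite [in RHS]/derive -E1].
Qed.

Definition cube (r : R) : set E := [set x | forall i, `|x 0 i| <= r].

Lemma cube_compact (r : R) : compact (cube r).
Proof.
have -> : cube r = [set v : E | forall i, `[- r, r]%classic (v ord0 i)].
  by apply/seteqP; split => x h i; have := h i; rewrite /= in_itv/= ler_norml.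
by apply: (@rV_compact R 3 (fun=> `[- r, r]%classic)) => i; exact: segment_compact.
Qed.

(** The quadratic term is the shape that second moments control. Pairs with |g x - g y| >= e form a
    compact set, on which |g x - g y| has a maximum M and |x - y|^2 a minimum m > 0; then K = M / m
    works. *)
Lemma modulus (g : E -> R) (r e : R) : continuous g -> 0 < e ->
  exists2 K, 0 <= K & forall x y, cube r x -> cube r y ->
    `|g x - g y| <= e + K * dot (x - y) (x - y).
Proof.
move=> cg e0.
pose A : set (E * E) := [set z | e <= `|g z.1 - g z.2|].
pose B := (cube r `*` cube r) `&` A.
have cA : continuous (fun z : E * E => `|g z.1 - g z.2|).
  move=> z; apply: (@contcomp _ _ _ (fun z : E * E => g z.1 - g z.2) (fun t : R => `|t|)).
    apply: contB.
      by apply: (@contcomp _ _ _ fst g); [exact: cvg_fst|exact: cg].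
    by apply: (@contcomp _ _ _ snd g); [exact: cvg_snd|exact: cg].
  exact: norm_continuous.
have cB : compact B.
  apply: (@subclosed_compact _ _ (cube r `*` cube r)).
  - apply: closedI.
      apply: compact_closed; first exact: norm_hausdorff.
      by apply: compact_setX; exact: cube_compact.
    rewrite (_ : A = (fun z : E * E => `|g z.1 - g z.2|) @^-1` [set t | e <= t])//.
    by apply: closed_comp; [move=> z _; exact: cA|exact: closed_ge].
  - by apply: compact_setX; exact: cube_compact.
  - by move=> z [].
have [B0|/set0P Bn0] := eqVneq B set0.
  exists 0 => // x y rx ry; rewrite mul0r addr0 leNgt; apply/negP => h.
  have : B (x, y) by split => //; rewrite /A/= ltW.
  by rewrite B0.
have cd : continuous (fun z : E * E => dot (z.1 - z.2) (z.1 - z.2)).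
  move=> z.
  have c1 : {for z, continuous (fun z : E * E => z.1 - z.2)}.
    by apply: (@contB _ _ _ fst snd); [exact: cvg_fst|exact: cvg_snd].
  exact: (dot_continuous c1 c1).
have [z0 /set_mem z0B z0max] := compact_EVT_max Bn0 cB (continuous_subspaceT cA).
have [z1 /set_mem z1B z1min] := compact_EVT_min Bn0 cB (continuous_subspaceT cd).
set M := `|g z0.1 - g z0.2| in z0max; set m := dot (z1.1 - z1.2) (z1.1 - z1.2) in z1min.
have M0 : 0 <= M by exact: normr_ge0.
have m0 : 0 < m.
  rewrite dot_gt0 subr_eq0; apply/eqP => h; case: z1B => _; rewrite /A/= h subrr normr0.
  by rewrite leNgt e0.
exists (M / m); first by rewrite divr_ge0// ltW.
move=> x y rx ry; have [h|h] := leP (`|g x - g y|) e.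
  by rewrite (le_trans h)// lerDl mulr_ge0 ?dot_ge0// divr_ge0// ltW.
have xyB : (x, y) \in B by rewrite inE; split => //; rewrite /A/= ltW.
have h1 := z0max _ xyB; have h2 := z1min _ xyB.
rewrite (le_trans h1)// (@le_trans _ _ (M / m * m))//; first by rewrite divfK// gt_eqF.
rewrite (le_trans _ (_ : M / m * dot (x - y) (x - y) <= _))//.
  by rewrite ler_wpM2l// divr_ge0// ltW.
by rewrite lerDr ltW.
Qed.

Definition vec3 (p q s : R) : E := \row_(i < 3) [:: p; q; s]`_i.

Section nodes.
Variables (r : R) (n : nat).
Hypotheses (r_gt0 : 0 < r) (n_gt0 : (0 < n)%N).

Let h := 2 * r / n%:R.
Definition node (a : nat) : R := 2 * r / n%:R * a%:R - r.
Definition unit_coord (t : R) : R := (t + r) / (2 * r).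

Let nR : 0 < n%:R :> R. Proof. by rewrite ltr0n. Qed.

Lemma unit_coord01 t : `|t| <= r -> 0 <= unit_coord t <= 1.
Proof.
have hr := r_gt0.
rewrite ler_norml => /andP[t1 t2]; rewrite /unit_coord; apply/andP; split.
  by rewrite divr_ge0//; lra.
by rewrite ler_pdivrMr; lra.
Qed.

(** The summand bounds the squared distance to t of any point within h of the node. For k = n or n -
    1, variance, squared bias and slack add up to at most 2 n units of 2 h ^ 2, which is 16 r ^ 2 /
    n. *)
Lemma node_moment t k : `|t| <= r -> (k <= n)%N -> (n <= k.+1)%N ->
  cas (unit_coord t) k (fun a => 2 * (node a - t) ^+ 2 + 2 * h ^+ 2) <= 16 * r ^+ 2 / n%:R.
Proof.
move=> tr kn nk; have hn := nR; have hr := r_gt0; set s := unit_coord t.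
have /andP[s0 s1] : 0 <= s <= 1 by exact: unit_coord01.
have E a : 2 * (node a - t) ^+ 2 + 2 * h ^+ 2 =
    2 * h ^+ 2 * (a%:R - n%:R * s) ^+ 2 + 2 * h ^+ 2.
  by rewrite /node /h /s /unit_coord; field; rewrite !gt_eqF.
rewrite (eq_cas _ _ E) casD casZ cas_cst cas_var.
have -> : 16 * r ^+ 2 / n%:R = 2 * h ^+ 2 * (2 * n%:R).
  by rewrite /h; field; rewrite gt_eqF.
rewrite -{2}[2 * h ^+ 2]mulr1 -mulrDr ler_wpM2l//; first by rewrite mulr_ge0// sqr_ge0.
have n1 : 1 <= n%:R :> R by rewrite ler1n.
have k0 : 0 <= k%:R :> R by [].
have s2 : s * (1 - s) <= 1 by nra.
have ks : k%:R * (s * (1 - s)) <= k%:R by rewrite ler_piMr.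
have [nkE|nk'] := eqVneq k n.
  by move: ks; rewrite nkE subrr expr0n /= addr0 mulrA => ks; lra.
have nE : n%:R = k%:R + 1 :> R.
  by rewrite natr1; congr (_%:R); apply/eqP; rewrite eqn_leq nk ltn_neqAle nk'.
have s3 : s ^+ 2 <= 1 by nra.
move: ks; rewrite nE mulrA => ks.
have -> : k%:R * s - (k%:R + 1) * s = - s by ring.
by rewrite sqrrN; lra.
Qed.

Lemma node_le a : (a <= n)%N -> `|node a| <= r.
Proof.
move=> an; have hn := nR; have hr := r_gt0.
have : h * a%:R <= h * n%:R.
  by rewrite ler_wpM2l ?ler_nat// /h divr_ge0// ?mulr_ge0// ltW.
have : 0 <= h * a%:R by rewrite mulr_ge0// /h divr_ge0// ?mulr_ge0// ltW.
rewrite {3}/h divfK ?gt_eqF// => h1 h2.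
by rewrite /node -/h ler_norml; apply/andP; split; lra.
Qed.

(* Degrees n and n - 1 both occur: differentiating a Bernstein polynomial
   lowers the degree but keeps the mesh. *)
Lemma cas3_approx (g : E -> R) (e K : R) (k l m : nat)
    (H : nat -> nat -> nat -> R) (y : E) :
  0 <= K -> cube r y ->
  (forall x y, cube r x -> cube r y -> `|g x - g y| <= e + K * dot (x - y) (x - y)) ->
  (n.-1 <= k <= n)%N -> (n.-1 <= l <= n)%N -> (n.-1 <= m <= n)%N ->
  (forall a b c, (a <= k)%N -> (b <= l)%N -> (c <= m)%N -> exists x,
    [/\ cube r x, H a b c = g x, `|x 0 ord0 - node a| <= h,
      `|x 0 (lift ord0 ord0) - node b| <= h &
      `|x 0 (lift ord0 (lift ord0 ord0)) - node c| <= h]) ->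
  `|cas3 (unit_coord (y 0 ord0)) (unit_coord (y 0 (lift ord0 ord0)))
      (unit_coord (y 0 (lift ord0 (lift ord0 ord0)))) k l m H - g y| <=
    e + K * (48 * r ^+ 2 / n%:R).
Proof.
move=> K0 yr gK /andP[k1 k2] /andP[l1 l2] /andP[m1 m2] HH.
pose Q t a := 2 * (node a - t) ^+ 2 + 2 * h ^+ 2.
have sq (p q t : R) : `|p - q| <= h -> (p - t) ^+ 2 <= 2 * (q - t) ^+ 2 + 2 * h ^+ 2.
  move=> pq; have : (p - q) ^+ 2 <= h ^+ 2.
    by rewrite -[leLHS]real_normK ?num_real// lerXn2r ?nnegrE// (le_trans _ pq).
  have := sqr_ge0 ((p - q) - (q - t)).
  have -> : p - t = (p - q) + (q - t) by ring.
  nra.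
have u01 i := unit_coord01 (yr i).
apply: le_trans (cas3_dist (G := fun a b c => e + K * (Q (y 0 ord0) a +
  (Q (y 0 (lift ord0 ord0)) b + Q (y 0 (lift ord0 (lift ord0 ord0))) c)))
  (u01 _) (u01 _) (u01 _) _) _.
  move=> a b c ak bl cm; have [x [xr -> xa xb xc]] := HH a b c ak bl cm.
  rewrite (le_trans (gK _ _ xr yr))// lerD2l ler_wpM2l// dotE !mxE -!expr2.
  by rewrite lerD ?sq// lerD ?sq.
rewrite cas3_sum lerD2l ler_wpM2l//.
have -> : 48 * r ^+ 2 / n%:R = 16 * r ^+ 2 / n%:R + (16 * r ^+ 2 / n%:R + 16 * r ^+ 2 / n%:R).
  by ring.
have p1 j : (n.-1 <= j)%N -> (n <= j.+1)%N by rewrite -{2}(prednK n_gt0) ltnS.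
by rewrite lerD ?node_moment ?p1// lerD// node_moment ?p1.
Qed.

End nodes.

End c1_approximation.

(** * Bernstein approximation of a function together with its gradient *)

Section bernstein.
Context {R : realType}.
Notation E := 'rV[R]_3.
Variables (r : R) (f : E -> R) (G : 'I_3 -> E -> R).
Hypotheses (r_gt0 : 0 < r) (cf : continuous f) (cG : forall i, continuous (G i))
  (dG : forall x i, is_derive x (delta_mx 0 i) f (G i x)).

Definition node_val n (a b c : nat) : R := f (vec3 (node r n a) (node r n b) (node r n c)).

Definition bern n (y : E) : R :=
  cas (unit_coord r (y 0 ord0)) n (fun a =>
  cas (unit_coord r (y 0 (lift ord0 ord0))) n (fun b =>
  cas (unit_coord r (y 0 (lift ord0 (lift ord0 ord0)))) n (node_val n a b))).

(** The gradient of [bern]; the factor 1 / (2 r) is the slope of [unit_coord]. *)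
Definition dbern n (y : E) : E := vec3
  ((2 * r)^-1 * dcas (unit_coord r (y 0 ord0)) n (fun a =>
    cas (unit_coord r (y 0 (lift ord0 ord0))) n (fun b =>
    cas (unit_coord r (y 0 (lift ord0 (lift ord0 ord0)))) n (node_val n a b))))
  (cas (unit_coord r (y 0 ord0)) n (fun a =>
    (2 * r)^-1 * dcas (unit_coord r (y 0 (lift ord0 ord0))) n (fun b =>
    cas (unit_coord r (y 0 (lift ord0 (lift ord0 ord0)))) n (node_val n a b))))
  (cas (unit_coord r (y 0 ord0)) n (fun a =>
    cas (unit_coord r (y 0 (lift ord0 ord0))) n (fun b =>
    (2 * r)^-1 * dcas (unit_coord r (y 0 (lift ord0 (lift ord0 ord0)))) n (node_val n a b)))).

Let cube_mvt x i (h : R) : 0 < h -> cube r x -> cube r (x + h *: delta_mx 0 i) ->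
  exists z, [/\ cube r z, f (x + h *: delta_mx 0 i) - f x = h * G i z &
    forall j, `|z 0 j - x 0 j| <= h].
Proof.
move=> h0 xr xhr; pose phi s := f (x + s *: delta_mx 0 i).
have dphi (s : R) : is_derive s 1 phi (G i (x + s *: delta_mx 0 i)).
  exact: is_derive_line.
have [|s] := @MVT _ phi (fun s => G i (x + s *: delta_mx 0 i)) 0 h h0 (fun s _ => dphi s).
  apply: continuous_in_subspaceT => s _.
  by apply/differentiable_continuous/derivable1_diffP; exact: ex_derive.
rewrite in_itv/= => /andP[s0 sh]; rewrite /phi scale0r addr0 subr0 => E0.
exists (x + s *: delta_mx 0 i); split; last first.
- move=> j; rewrite !mxE addrAC subrr add0r normrM (gtr0_norm s0).
  apply: le_trans (_ : s * 1 <= h); last by rewrite mulr1 ltW.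
  by rewrite ler_wpM2l ?(ltW s0)//; case: (_ && _); rewrite ?normr1 ?normr0.
- by rewrite E0 mulrC.
- move=> j; have := xr j; have := xhr j; rewrite !mxE !ler_norml.
  rewrite eqxx; case: (j == i); rewrite /= ?mulr1 ?mulr0 ?addr0//.
  by move=> /andP[h1 h2] /andP[h3 h4]; apply/andP; split; lra.
Qed.

Let vec3_cube n a b c : (0 < n)%N -> (a <= n)%N -> (b <= n)%N -> (c <= n)%N ->
  cube r (vec3 (node r n a) (node r n b) (node r n c)).
Proof.
by move=> n0 an bn cn [[|[|[|//]]] ?]; rewrite mxE /= node_le.
Qed.

(** A partial derivative of [bern] is a Bernstein operator, of degree n - 1 in one variable, applied
    to difference quotients of step h. Each quotient is a value of the partial derivative of f
    within h of the node, so the estimate for values covers gradients as well. *)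
Lemma bern_approx e : 0 < e -> exists2 n, (0 < n)%N & forall y, cube r y ->
  `|bern n y - f y| <= e /\ forall i, `|dbern n y 0 i - G i y| <= e.
Proof.
move=> e0; have hr := r_gt0.
have e20 : 0 < e / 2 by rewrite divr_gt0.
have [K0 K00 mod0] := modulus r cf e20.
have mG i : exists K : R, 0 <= K /\ forall x y, cube r x -> cube r y ->
    `|G i x - G i y| <= e / 2 + K * dot (x - y) (x - y).
  by have [K ? ?] := modulus r (cG (i := i)) e20; exists K.
have [K1 K1P] := boolp.choice mG.
have K10 i := (K1P i).1; have mod1 i := (K1P i).2.
(* K dominates the moduli of f and of its three partial derivatives, so one n serves all four. *)
pose K := K0 + \sum_i K1 i.
have KK0 : K0 <= K by rewrite lerDl sumr_ge0.
have KK1 i : K1 i <= K.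
  by rewrite /K (bigD1 i)//= addrCA lerDl addr_ge0// sumr_ge0.
have K_ge0 : 0 <= K by rewrite (le_trans K00).
have [n [n0 nK]] : exists n, (0 < n)%N /\ K * (48 * r ^+ 2 / n%:R) <= e / 2.
  pose X := K * (48 * r ^+ 2) / (e / 2).
  have X0 : 0 <= X by rewrite divr_ge0 ?(ltW e20)// mulr_ge0// mulr_ge0// sqr_ge0.
  exists (Num.bound X).+1; split => //.
  have hX : X <= (Num.bound X).+1%:R.
    by rewrite ltW// (lt_trans (archi_boundP X0))// ltr_nat.
  by rewrite mulrA ler_pdivrMr ?ltr0Sn// [leRHS]mulrC -ler_pdivrMr.
exists n => // y yr.
pose h := 2 * r / n%:R; have nR : 0 < n%:R :> R by rewrite ltr0n.
have h0 : 0 < h by rewrite divr_gt0// mulr_gt0.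
have fin k l m H (g : E -> R) Kg : 0 <= Kg -> Kg <= K ->
    (forall x y, cube r x -> cube r y -> `|g x - g y| <= e / 2 + Kg * dot (x - y) (x - y)) ->
    (n.-1 <= k <= n)%N -> (n.-1 <= l <= n)%N -> (n.-1 <= m <= n)%N ->
    (forall a b c, (a <= k)%N -> (b <= l)%N -> (c <= m)%N -> exists x,
      [/\ cube r x, H a b c = g x, `|x 0 ord0 - node r n a| <= h,
      `|x 0 (lift ord0 ord0) - node r n b| <= h &
      `|x 0 (lift ord0 (lift ord0 ord0)) - node r n c| <= h]) ->
    `|cas3 (unit_coord r (y 0 ord0)) (unit_coord r (y 0 (lift ord0 ord0)))
      (unit_coord r (y 0 (lift ord0 (lift ord0 ord0)))) k l m H - g y| <= e.
  move=> Kg0 KgK gK kn ln mn HH.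
  apply: le_trans (cas3_approx r_gt0 n0 Kg0 yr gK kn ln mn HH) _.
  rewrite [leRHS](splitr e) lerD2l (le_trans _ nK)// ler_wpM2r//.
  by rewrite divr_ge0// mulr_ge0// sqr_ge0.
have nn : (n.-1 <= n <= n)%N by rewrite leq_pred leqnn.
have n1n : (n.-1 <= n.-1 <= n)%N by rewrite leq_pred leqnn.
have hE : (2 * r)^-1 * n%:R = h^-1 by rewrite /h invf_div mulrC.
have dcasE s (phi : nat -> R) : (2 * r)^-1 * dcas s n phi =
    cas s n.-1 (fun a => h^-1 * (phi a.+1 - phi a)).
  by rewrite casZ -hE -mulrA; congr (_ * _); case: (n) n0.
have nodeS a : node r n a.+1 = node r n a + h.
  by rewrite /node -/h -natr1; ring.
have pn a : (a <= n.-1)%N -> (a.+1 <= n)%N by rewrite -ltnS prednK.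
have pn' a : (a <= n.-1)%N -> (a <= n)%N by move=> /pn/ltnW.
have vE0 a b c : vec3 (node r n a.+1) (node r n b) (node r n c) =
    vec3 (node r n a) (node r n b) (node r n c) + h *: delta_mx 0 ord0.
  apply/rowP => -[[|[|[|//]]] ?]; rewrite !mxE /= ?mulr0 ?mulr1 ?addr0//; exact: nodeS.
have vE1 a b c : vec3 (node r n a) (node r n b.+1) (node r n c) =
    vec3 (node r n a) (node r n b) (node r n c) + h *: delta_mx 0 (lift ord0 ord0).
  apply/rowP => -[[|[|[|//]]] ?]; rewrite !mxE /= ?mulr0 ?mulr1 ?addr0//; exact: nodeS.
have vE2 a b c : vec3 (node r n a) (node r n b) (node r n c.+1) =
    vec3 (node r n a) (node r n b) (node r n c) + h *: delta_mx 0 (lift ord0 (lift ord0 ord0)).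
  apply/rowP => -[[|[|[|//]]] ?]; rewrite !mxE /= ?mulr0 ?mulr1 ?addr0//; exact: nodeS.
have mvt x i : cube r x -> cube r (x + h *: delta_mx 0 i) -> exists z,
    [/\ cube r z, h^-1 * (f (x + h *: delta_mx 0 i) - f x) = G i z,
      `|z 0 ord0 - x 0 ord0| <= h, `|z 0 (lift ord0 ord0) - x 0 (lift ord0 ord0)| <= h &
      `|z 0 (lift ord0 (lift ord0 ord0)) - x 0 (lift ord0 (lift ord0 ord0))| <= h].
  move=> xr xhr; have [z [zr zE zx]] := cube_mvt h0 xr xhr.
  by exists z; split => //; rewrite zE mulKf// gt_eqF.
split.
  apply: (fin n n n _ f K0) => // a b c an bn cn.
  exists (vec3 (node r n a) (node r n b) (node r n c)).
  by split; rewrite ?mxE ?subrr ?normr0 ?(ltW h0)//; exact: vec3_cube.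
case=> -[|[|[|//]]] lti; rewrite mxE /=.
- rewrite dcasE; under eq_cas do rewrite -casB -casZ.
  under eq_cas do under eq_cas do rewrite -casB -casZ.
  rewrite (_ : Ordinal lti = ord0); last exact/val_inj.
  apply: (fin n.-1 n n _ _ _ (K10 _) (KK1 _) (mod1 ord0)) => // a b c an bn cn.
  rewrite /node_val vE0.
  have [||z [z1 z2 z3 z4 z5]] := mvt (vec3 (node r n a) (node r n b) (node r n c)) ord0.
  + by apply: vec3_cube => //; exact: pn'.
  + by rewrite -vE0; apply: vec3_cube => //; exact: pn.
  by exists z; move: z3 z4 z5; rewrite !mxE.
- under eq_cas do rewrite dcasE; under eq_cas do under eq_cas do rewrite -casB -casZ.
  rewrite (_ : Ordinal lti = lift ord0 ord0); last exact/val_inj.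
  apply: (fin n n.-1 n _ _ _ (K10 _) (KK1 _) (mod1 (lift ord0 ord0))) => // a b c an bn cn.
  rewrite /node_val vE1.
  have [||z [z1 z2 z3 z4 z5]] := mvt (vec3 (node r n a) (node r n b) (node r n c)) (lift ord0
    ord0).
  + by apply: vec3_cube => //; exact: pn'.
  + by rewrite -vE1; apply: vec3_cube => //; exact: pn.
  by exists z; move: z3 z4 z5; rewrite !mxE.
- under eq_cas do under eq_cas do rewrite dcasE.
  rewrite (_ : Ordinal lti = lift ord0 (lift ord0 ord0)); last exact/val_inj.
  apply: (fin n n n.-1 _ _ _ (K10 _) (KK1 _) (mod1 (lift ord0 (lift ord0 ord0)))) => // a b c
    an bn cn.
  rewrite /node_val vE2.
  have [||z [z1 z2 z3 z4 z5]] := mvt (vec3 (node r n a) (node r n b) (node r n c))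
    (lift ord0 (lift ord0 ord0)).
  + by apply: vec3_cube => //; exact: pn'.
  + by rewrite -vE2; apply: vec3_cube => //; exact: pn.
  by exists z; move: z3 z4 z5; rewrite !mxE.
Qed.

End bernstein.

(** * Functionals annihilating zonal polynomials annihilate C^1 functions *)

Section annihilator.
Context {R : realType}.
Notation E := 'rV[R]_3.
Context (mu : {measure set E -> \bar R}) (F : set E) (r : R).
Context (g : E -> R) (m : E -> E).
Hypotheses (cF : closed F) (r_gt0 : 0 < r) (Fr : F `<=` sphere r)
  (ig : mu.-integrable F (EFin \o g))
  (im : forall i, mu.-integrable F (EFin \o (fun y => m y 0 i))).
Implicit Types (f : E -> R) (df B : E -> E) (xi eta : E) (k n : nat).

Definition bm f := measurable_fun F f /\ exists M, forall y, F y -> `|f y| <= M.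

Lemma bm_cst (c : R) : bm (fun=> c).
Proof. by split; [exact: measurable_cst|exists `|c|]. Qed.

Lemma bmD f1 f2 : bm f1 -> bm f2 -> bm (fun y => f1 y + f2 y).
Proof.
move=> [m1 [M1 h1]] [m2 [M2 h2]]; split; first exact: measurable_funD.
by exists (M1 + M2) => y Fy; rewrite (le_trans (ler_normD _ _))// lerD ?h1 ?h2.
Qed.

Lemma bmM f1 f2 : bm f1 -> bm f2 -> bm (fun y => f1 y * f2 y).
Proof.
move=> [m1 [M1 h1]] [m2 [M2 h2]]; split; first exact: measurable_funM.
by exists (M1 * M2) => y Fy; rewrite normrM ler_pM ?h1 ?h2.
Qed.

Lemma bmB f1 f2 : bm f1 -> bm f2 -> bm (fun y => f1 y - f2 y).
Proof.
move=> b1 b2; have := bmD b1 (bmM (bm_cst (-1)) b2).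
by congr bm; apply/funext => y; rewrite mulN1r.
Qed.

Lemma bmX f n : bm f -> bm (fun y => f y ^+ n).
Proof.
move=> bf; elim: n => [|n IH]; first exact: bm_cst.
by have := bmM bf IH; congr bm; apply/funext => y; rewrite exprS.
Qed.

Lemma bm_dot xi : bm (fun y => dot xi y).
Proof.
split; first by apply: measurable_dot => i //; exact: measurable_coord.
exists (enorm xi * r) => y Fy; rewrite (le_trans (normr_dot_le _ _))//.
by rewrite (Fr Fy : enorm y = r).
Qed.

Definition test f df := bm f /\ forall i, bm (fun y => df y 0 i).

(** One functional covers a scalar density g tested on functions and a vector density m tested on
    gradients. Here f and df are independent arguments; each construction below transforms them
    consistently. *)
Definition Lam f df : R := \int[mu]_(y in F) (g y * f y + dot (m y) (df y)).

Let mass := pot_mass mu F g m.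

Let mass_ge0 : 0 <= mass. Proof. exact: pot_mass_ge0. Qed.

Lemma Lam_bound f df (M : R) : test f df -> (forall y, F y -> `|f y| <= M) ->
  (forall y i, F y -> `|df y 0 i| <= M) -> `|Lam f df| <= M * mass.
Proof.
move=> [[mf _] mdf] fM dfM.
by have [_] := weight_bound cF ig im mf (fun i => (mdf i).1) fM dfM.
Qed.

Lemma Lam_integrable f df : test f df ->
  mu.-integrable F (EFin \o (fun y => g y * f y + dot (m y) (df y))).
Proof.
move=> [[mf [M0 h0]] bdf].
have [M hM] := boolp.choice (fun i => (bdf i).2).
pose N := `|M0| + \sum_i `|M i|.
have N0 : `|M0| <= N by rewrite lerDl sumr_ge0.
have NM i : `|M i| <= N by rewrite /N (bigD1 i)//= addrCA lerDl addr_ge0// sumr_ge0.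
have [||//] := weight_bound (M := N) cF ig im mf (fun i => (bdf i).1).
- by move=> y /h0 h; rewrite (le_trans h)// (le_trans _ N0)// ler_norm.
- by move=> y i /(hM i) h; rewrite (le_trans h)// (le_trans _ (NM i))// ler_norm.
Qed.

Lemma Lam_lin (c : R) f1 df1 f2 df2 : test f1 df1 -> test f2 df2 ->
  Lam (fun y => c * f1 y + f2 y) (fun y => c *: df1 y + df2 y) =
  c * Lam f1 df1 + Lam f2 df2.
Proof.
move=> t1 t2; have i1 := Lam_integrable t1; have i2 := Lam_integrable t2.
have mF := measurable_closed cF.
have i1' := integrable_scale mF c i1.
rewrite /Lam -RintegralZl// -RintegralD//.
by apply: eq_Rintegral => y _; rewrite dotDr dotZr; ring.
Qed.

Lemma test_lin (c : R) f1 df1 f2 df2 : test f1 df1 -> test f2 df2 ->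
  test (fun y => c * f1 y + f2 y) (fun y => c *: df1 y + df2 y).
Proof.
move=> [t1 d1] [t2 d2]; split; first by apply: bmD => //; apply: bmM => //; exact: bm_cst.
move=> i; under eq_fun do rewrite !mxE.
by apply: bmD => //; apply: bmM => //; exact: bm_cst.
Qed.

Definition zonal f xi k : E -> R := fun y => f y * dot xi y ^+ k.
Definition dzonal f df xi k : E -> E := fun y =>
  dot xi y ^+ k *: df y + (f y * (k%:R * dot xi y ^+ k.-1)) *: xi.

Lemma test_zonal f df xi k : test f df -> test (zonal f xi k) (dzonal f df xi k).
Proof.
move=> [bf bdf]; have bx := bm_dot xi.
split; first by apply: bmM => //; exact: bmX.
move=> i; rewrite /dzonal; under eq_fun do rewrite !mxE.
apply: bmD; first by apply: bmM => //; exact: bmX.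
apply: bmM; last exact: bm_cst.
by apply: bmM => //; apply: bmM; [exact: bm_cst|exact: bmX].
Qed.

(* df stands for the gradient of f. *)
Definition good f df := test f df /\
  forall xi k, Lam (zonal f xi k) (dzonal f df xi k) = 0.

Lemma good_lin (c : R) f1 df1 f2 df2 : good f1 df1 -> good f2 df2 ->
  good (fun y => c * f1 y + f2 y) (fun y => c *: df1 y + df2 y).
Proof.
move=> [t1 h1] [t2 h2]; split; first exact: test_lin.
move=> xi k; transitivity (c * Lam (zonal f1 xi k) (dzonal f1 df1 xi k) +
  Lam (zonal f2 xi k) (dzonal f2 df2 xi k)); last by rewrite h1 h2 mulr0 addr0.
rewrite -Lam_lin; [|exact: test_zonal..].
congr Lam; apply/funext => y; rewrite /zonal /dzonal; first by ring.
by apply/rowP => i; rewrite !mxE; ring.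
Qed.

(** This is the case k = 0; the other zonal factors in [good] are what makes it stable under
    multiplication by linear forms. *)
Lemma good0 f df : good f df -> Lam f df = 0.
Proof.
move=> [_ /(_ 0 0%N)]; congr (_ = _); congr Lam; apply/funext => y.
  by rewrite /zonal expr0 mulr1.
by rewrite /dzonal expr0 scale1r scaler0 addr0.
Qed.

(** C depends only on n and M, hence serves all points y of F at once. *)
Lemma pow_remainder n (M : R) : 0 <= M -> exists2 C, 0 <= C &
  forall S T t : R, `|S| <= M -> `|T| <= M -> `|t| <= 1 ->
  `|(S + t * T) ^+ n - S ^+ n - t * (n%:R * S ^+ n.-1 * T)| <= C * t ^+ 2.
Proof.
move=> M0; elim: n => [|n [C C0 IH]].
  by exists 0 => // S T t _ _ _; rewrite !expr0 mul0r mul0r mulr0 subrr subr0 normr0 mul0r.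
exists (2 * M * C + n%:R * M ^+ n.-1 * M ^+ 2).
  by rewrite addr_ge0// !mulr_ge0// exprn_ge0.
move=> S T t SM TM t1.
have nS : S * (n%:R * S ^+ n.-1) = n%:R * S ^+ n.
  by case: (n) => [|k]; rewrite ?mul0r ?mulr0//= exprS; ring.
have -> : (S + t * T) ^+ n.+1 - S ^+ n.+1 - t * (n.+1%:R * S ^+ n.+1.-1 * T) =
  (S + t * T) * ((S + t * T) ^+ n - S ^+ n - t * (n%:R * S ^+ n.-1 * T)) +
  t ^+ 2 * (n%:R * S ^+ n.-1 * T ^+ 2).
  transitivity ((S + t * T) * (S + t * T) ^+ n - S * S ^+ n - t * ((n%:R * S ^+ n) * T) - t *
    (S ^+ n * T)).
    by rewrite !exprS -natr1 /=; ring.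
  by rewrite -nS; ring.
rewrite (le_trans (ler_normD _ _))// !normrM mulrDl; apply: lerD.
  rewrite -[leRHS]mulrA; apply: ler_pM => //; last exact: IH.
  rewrite (le_trans (ler_normD _ _))// normrM.
  have : `|t| * `|T| <= 1 * M by exact: ler_pM.
  lra.
rewrite -!normrM normrM [leLHS]mulrC -expr2 [`|t ^+ 2|]ger0_norm ?sqr_ge0//.
rewrite ler_wpM2r ?sqr_ge0// normrM [`|n%:R * _|]normrM normr_nat !normrX.
apply: ler_pM => //; rewrite ?mulr_ge0 ?exprn_ge0//.
  by rewrite ler_wpM2l// lerXn2r ?nnegrE.
by rewrite lerXn2r ?nnegrE.
Qed.

Lemma pow_difference n (M : R) : 0 <= M -> exists2 C, 0 <= C &
  forall S T t : R, `|S| <= M -> `|T| <= M -> `|t| <= 1 ->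
  `|(S + t * T) ^+ n - S ^+ n| <= C * `|t|.
Proof.
move=> M0; have [C C0 h] := pow_remainder n M0.
have X0 : 0 <= n%:R * M ^+ n.-1 * M by rewrite !mulr_ge0// exprn_ge0.
exists (C + n%:R * M ^+ n.-1 * M); first by rewrite addr_ge0.
move=> S T t SM TM t1.
have -> : (S + t * T) ^+ n - S ^+ n = ((S + t * T) ^+ n - S ^+ n - t * (n%:R * S ^+ n.-1 * T)) +
  t * (n%:R * S ^+ n.-1 * T) by ring.
rewrite (le_trans (ler_normD _ _))// mulrDl lerD//.
  rewrite (le_trans (h S T t SM TM t1))// ler_wpM2l//.
  by rewrite -[leLHS]real_normK ?num_real// expr2 ler_piMl.
rewrite normrM mulrC ler_wpM2r// !normrM normr_nat normrX.
apply: ler_pM => //; rewrite ?mulr_ge0 ?exprn_ge0//.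
by rewrite ler_wpM2l// lerXn2r ?nnegrE.
Qed.

(* The t-derivative at 0 of the hypothesis for xi + t eta and k + 1. *)
Lemma good_mul eta f df : good f df ->
  good (fun y => dot eta y * f y) (fun y => f y *: eta + dot eta y *: df y).
Proof.
move=> [[bf bdf] gf].
have beta := bm_dot eta.
have tmul : test (fun y => dot eta y * f y) (fun y => f y *: eta + dot eta y *: df y).
  split; first exact: bmM.
  move=> i; under eq_fun do rewrite !mxE.
  by apply: bmD; apply: bmM => //; exact: bm_cst.
split => // xi k; have bxi := bm_dot xi.
pose f' y := dot eta y * f y; pose df' y := f y *: eta + dot eta y *: df y.
set L := Lam _ _.
pose del n t y := dot (xi + t *: eta) y ^+ n - dot xi y ^+ n -
   t * (n%:R * dot xi y ^+ n.-1 * dot eta y).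
pose dif n t y := dot (xi + t *: eta) y ^+ n - dot xi y ^+ n.
(* [Ar] is f times the second-order remainder in t of ((xi + t eta) . y) ^ (k + 1), and [Br] is its
   gradient in y when df is that of f; both are O(t ^ 2) uniformly on F. *)
pose Ar t y := f y * del k.+1 t y.
pose Br t y := del k.+1 t y *: df y + (f y * k.+1%:R * del k t y) *: xi +
   (f y * k.+1%:R * (t * dif k t y)) *: eta.
have bdel n t : bm (del n t).
  apply: bmB; first by apply: bmB; apply: bmX => //; exact: bm_dot.
  apply: bmM; first exact: bm_cst.
  by apply: bmM => //; apply: bmM; [exact: bm_cst|exact: bmX].
have bdif n t : bm (dif n t) by apply: bmB; apply: bmX => //; exact: bm_dot.
have tr t : test (Ar t) (Br t).
  split; first exact: bmM.
  move=> i; rewrite /Br; under eq_fun do rewrite !mxE.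
  apply: bmD; first apply: bmD.
  - exact: bmM.
  - by apply: bmM; [apply: bmM => //; apply: bmM => //|]; exact: bm_cst.
  - apply: bmM; last exact: bm_cst.
    by apply: bmM; apply: bmM => //; exact: bm_cst.
(* The full power and the term of order 0 are annihilated by hypothesis, so the remainder is minus
   the first-order term. Dividing by t and letting t tend to 0 then gives L = 0. *)
have LE t : Lam (Ar t) (Br t) = - (t * k.+1%:R * L).
  have t0 := test_zonal xi k.+1 (conj bf bdf).
  have t1 := test_zonal xi k tmul.
  have := gf (xi + t *: eta) k.+1.
  have := Lam_lin (t * k.+1%:R) t1 (test_lin 1 t0 (tr t)).
  rewrite (Lam_lin 1 t0 (tr t)) gf mulr0 add0r -/L => E1 E2.
  apply/eqP; rewrite -addr_eq0 addrC; apply/eqP; rewrite -E1 -E2.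
  congr Lam; apply/funext => y.
    by rewrite /zonal /Ar /del /= exprS; ring.
  have dE : dot (xi + t *: eta) y = dot xi y + t * dot eta y by rewrite dotDl dotZl.
  apply/rowP => i; rewrite /dzonal /Br /del /dif /= !mxE.
  by rewrite !exprS; ring.
have [_ [Mf hf]] := bf; have [_ [Mx hx]] := bxi; have [_ [Me he]] := beta.
have [Md hd] := boolp.choice (fun i => (bdf i).2).
pose M := `|Mx| + `|Me|; have M0 : 0 <= M by rewrite addr_ge0.
have [C1 C10 hC1] := pow_remainder k.+1 M0.
have [C2 C20 hC2] := pow_remainder k M0.
have [C3 C30 hC3] := pow_difference k M0.
pose N := `|Mf| + \sum_i `|Md i| + enorm xi + enorm eta.
have N0 : 0 <= N by rewrite !addr_ge0 ?enorm_ge0// sumr_ge0.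
have Nf y : F y -> `|f y| <= N.
  move=> /hf h; rewrite (le_trans h)// (le_trans (ler_norm _))// /N -!addrA lerDl.
  by rewrite !addr_ge0 ?enorm_ge0// sumr_ge0.
have Nd y i : F y -> `|df y 0 i| <= N.
  move=> /(hd i) h; rewrite (le_trans h)// (le_trans (ler_norm _))// /N (bigD1 i)//=.
  rewrite -!addrA addrCA lerDl !addr_ge0 ?enorm_ge0// sumr_ge0//.
have Nx i : `|xi 0 i| <= N.
  rewrite (le_trans (coord_le _ _))// /N -addrA addrCA lerDl !addr_ge0 ?enorm_ge0// sumr_ge0//.
have Ne i : `|eta 0 i| <= N.
  rewrite (le_trans (coord_le _ _))// /N lerDr !addr_ge0 ?enorm_ge0// sumr_ge0//.
have Mxi y : F y -> `|dot xi y| <= M.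
  by move=> /hx h; rewrite (le_trans h)// (le_trans (ler_norm _))// lerDl.
have Meta y : F y -> `|dot eta y| <= M.
  by move=> /he h; rewrite (le_trans h)// (le_trans (ler_norm _))// lerDr.
clearbody M N.
pose C := N * C1 + (N * k.+1%:R * C2 * N + N * k.+1%:R * C3 * N).
have C0 : 0 <= C by rewrite /C !(addr_ge0, mulr_ge0).
have del1 n t y (D : R) : (forall S T t : R, `|S| <= M -> `|T| <= M -> `|t| <= 1 ->
    `|(S + t * T) ^+ n - S ^+ n - t * (n%:R * S ^+ n.-1 * T)| <= D * t ^+ 2) ->
    `|t| <= 1 -> F y -> `|del n t y| <= D * t ^+ 2.
  by move=> h t1 Fy; rewrite /del dotDl dotZl; apply: h => //; [exact: Mxi|exact: Meta].
have ineq t : 0 < t -> t <= 1 -> `|L| <= C * mass * t.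
  move=> t0 t1; have nt : `|t| <= 1 by rewrite gtr0_norm.
  have h : `|Lam (Ar t) (Br t)| <= C * t ^+ 2 * mass.
    apply: Lam_bound; first exact: tr.
      move=> y Fy; rewrite normrM (@le_trans _ _ (N * (C1 * t ^+ 2)))//.
        by apply: ler_pM => //; [exact: Nf|exact: del1].
      rewrite mulrA ler_wpM2r ?sqr_ge0// /C lerDl.
      by rewrite !(addr_ge0, mulr_ge0).
    move=> y i Fy; rewrite /Br !mxE.
    rewrite (le_trans (ler_normD _ _))// (_ : C * t ^+ 2 = (N * C1 * t ^+ 2 +
      N * k.+1%:R * C2 * N * t ^+ 2) + N * k.+1%:R * C3 * N * t ^+ 2); last by rewrite /C; ring.
    apply: lerD; first (rewrite (le_trans (ler_normD _ _))//; apply: lerD).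
    - rewrite normrM (_ : N * C1 * t ^+ 2 = (C1 * t ^+ 2) * N); last by ring.
      by apply: ler_pM => //; [exact: del1|exact: Nd].
    - rewrite !normrM (_ : N * k.+1%:R * C2 * N * t ^+ 2 = N * k.+1%:R * (C2 * t ^+ 2) * N);
      last by ring.
      apply: ler_pM => //; rewrite ?mulr_ge0//.
      apply: ler_pM; rewrite ?mulr_ge0//; last exact: del1.
      by rewrite normr_nat ler_wpM2r// Nf.
    - rewrite !normrM (_ : N * k.+1%:R * C3 * N * t ^+ 2 = N * k.+1%:R * (`|t| * (C3 * `|t|)) *
      N).
        apply: ler_pM => //; rewrite ?mulr_ge0//.
        apply: ler_pM; rewrite ?mulr_ge0//; first by rewrite normr_nat ler_wpM2r// Nf.
        rewrite ler_wpM2l// /dif dotDl dotZl; apply: hC3 => //; [exact: Mxi|exact: Meta].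
      by rewrite (gtr0_norm t0); ring.
  move: h; rewrite LE normrN !normrM (gtr0_norm t0) normr_nat => h.
  have h2 : t * `|L| <= t * k.+1%:R * `|L|.
    by rewrite ler_wpM2r// ler_peMr ?(ltW t0)// ler1n.
  rewrite -(ler_pM2l t0) (le_trans h2)// (le_trans h)//.
  by rewrite le_eqVlt; apply/orP; left; apply/eqP; ring.
apply/eqP; rewrite -normr_le0 leNgt; apply/negP => L0.
have D0 : 0 <= C * mass by rewrite mulr_ge0.
pose t := Num.min 1 (`|L| / (2 * (C * mass + 1))).
have q0 : 0 < 2 * (C * mass + 1) by rewrite mulr_gt0// ltr_wpDl.
have t0 : 0 < t by rewrite lt_min ltr01 divr_gt0.
have t1 : t <= 1 by rewrite ge_min lexx.
have t2 : t * (2 * (C * mass + 1)) <= `|L|.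
  by rewrite -ler_pdivlMr// ge_min lexx orbT.
have := ineq t t0 t1; lra.
Qed.

Hypothesis H0 : forall xi k,
  Lam (fun y => dot xi y ^+ k) (fun y => (k%:R * dot xi y ^+ k.-1) *: xi) = 0.

(** [H0] says that the constant 1 is good, and c is (c - 1) * 1 + 1. *)
Lemma good_cst (c : R) : good (fun=> c) (fun=> 0).
Proof.
have g1 : good (fun=> 1) (fun=> 0).
  split; first by split=> [|i]; [|under eq_fun do rewrite mxE]; exact: bm_cst.
  move=> xi k; rewrite -(H0 xi k); congr Lam; apply/funext => y.
    by rewrite /zonal mul1r.
  by rewrite /dzonal scaler0 add0r mul1r.
have := good_lin (c - 1) g1 g1; congr good; apply/funext => y; first by ring.
by rewrite scaler0 addr0.
Qed.

Lemma good_unit i f df : good f df ->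
  good (fun y => unit_coord r (y 0 i) * f y)
    (fun y => unit_coord r (y 0 i) *: df y + ((2 * r)^-1 * f y) *: delta_mx 0 i).
Proof.
move=> gf; have r0 : r != 0 by rewrite gt_eqF.
(* [unit_coord] is a multiple of the coordinate plus 1 / 2; the half of f is written - f / 2 + f to
   fit [good_lin]. *)
have := good_lin (2 * r)^-1 (good_mul (delta_mx 0 i) gf) (good_lin (- 2^-1) gf gf).
congr good; apply/funext => y; rewrite /unit_coord dotC dot_delta; first by field.
by apply/rowP => j; rewrite !mxE; field.
Qed.

Lemma good_cas i n (f : nat -> E -> R) (df : nat -> E -> E) :
  (forall a, good (f a) (df a)) ->
  good (fun y => cas (unit_coord r (y 0 i)) n (f ^~ y))
    (fun y => \row_j (cas (unit_coord r (y 0 i)) n (fun a => df a y 0 j) +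
      (j == i)%:R * ((2 * r)^-1 * dcas (unit_coord r (y 0 i)) n (f ^~ y)))).
Proof.
elim: n f df => [|n IH] f df gf.
  have := gf 0%N; congr good; apply/funext => y.
  by apply/rowP => j; rewrite mxE /= !mulr0 addr0.
have gX := IH (f \o S) (df \o S) (fun a => gf a.+1).
have gY := IH f df gf.
have := good_lin 1 (good_unit i gX) (good_lin (-1) (good_unit i gY) gY).
congr good; apply/funext => y; first by rewrite /comp /=; ring.
apply/rowP => j; rewrite !mxE dcasS /comp /=.
by case: (j == i) => /=; ring.
Qed.

(** Bernstein polynomials arise from constants by multiplications with the affine functions
    [unit_coord] and 1 - [unit_coord], one variable after the other. *)
Lemma good_bern phi n : good (bern r phi n) (dbern r phi n).
Proof.
have := good_cas ord0 n (fun a => good_cas (lift ord0 ord0) n (fun b =>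
  good_cas (lift ord0 (lift ord0 ord0)) n (fun c => good_cst (node_val r phi n a b c)))).
congr good; apply/funext => y.
apply/rowP => j; rewrite mxE.
under eq_cas do rewrite mxE; under eq_cas do under eq_cas do rewrite mxE.
under eq_cas do under eq_cas do under eq_cas do rewrite mxE.
under eq_cas do under eq_cas do rewrite cas_cst add0r.
rewrite mxE; case: j => -[|[|[|//]]] ? /=.
- under eq_cas do under eq_cas do rewrite mul0r.
  under eq_cas do rewrite cas_cst mul0r add0r.
  by rewrite cas_cst add0r mul1r.
- under eq_cas do under eq_cas do rewrite mul0r.
  under eq_cas do rewrite cas_cst mul1r add0r.
  by rewrite mul0r addr0.
- under eq_cas do under eq_cas do rewrite mul1r.
  under eq_cas do rewrite mul0r addr0.
  by rewrite mul0r addr0.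
Qed.

(** [Lam] is bounded by [mass] times the C^1 size of its argument, so its vanishing passes to limits
    of Bernstein polynomials taken with their gradients. *)
Lemma Lam_C1 f (G : 'I_3 -> E -> R) : continuous f -> (forall i, continuous (G i)) ->
  (forall x i, is_derive x (delta_mx 0 i) f (G i x)) ->
  test f (fun y => \row_i G i y) /\ Lam f (fun y => \row_i G i y) = 0.
Proof.
move=> fC GC dG; have bapp := bern_approx r_gt0 fC GC dG.
have Fc y : F y -> cube r y by move=> /Fr <- i; exact: coord_le.
have mcont (phi : E -> R) : continuous phi -> measurable_fun F phi.
  move=> cphi; apply: (@measurable_funS _ _ _ _ setT) => //.
  by apply: measurable_cont => [|x _]; [exact: openT|exact: cphi].
have tf : test f (fun y => \row_i G i y).
  (* Boundedness on F is read off from one approximation of accuracy 1 by a bounded function. *)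
  have [n _ hn] := bapp 1 ltr01.
  have [[[_ [M hM]] bd] _] := good_bern f n.
  split; first split; first exact: mcont.
    exists (1 + M) => y Fy; have [h _] := hn y (Fc y Fy); have := hM y Fy.
    by move: h; rewrite !ler_norml => /andP[? ?] /andP[? ?]; apply/andP; split; lra.
  move=> i; have [_ [N hN]] := bd i.
  split; first by under eq_fun do rewrite mxE; exact: mcont.
  exists (1 + N) => y Fy; have [_ /(_ i) h] := hn y (Fc y Fy); have := hN y Fy.
  by rewrite mxE; move: h; rewrite !ler_norml => /andP[? ?] /andP[? ?]; apply/andP; split; lra.
split => //; apply/eqP; rewrite -normr_le0 leNgt; apply/negP => L0.
set L := Lam _ _ in L0.
have D0 : 0 < 2 * (mass + 1) by rewrite mulr_gt0// ltr_wpDl.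
have e0 : 0 < `|L| / (2 * (mass + 1)) by rewrite divr_gt0.
have [n _ hn] := bapp _ e0.
have gb := good_bern f n.
have LE := Lam_lin (-1) gb.1 tf.
rewrite (good0 gb) mulr0 add0r -/L in LE.
have : `|L| <= `|L| / (2 * (mass + 1)) * mass.
  rewrite -{1}LE; apply: Lam_bound; first exact: (test_lin (-1) gb.1 tf).
    by move=> y /Fc/hn[h _]; rewrite mulN1r addrC distrC.
  move=> y i /Fc/hn[_ /(_ i) h].
  rewrite [X in `|X|](_ : _ = - (dbern r f n y 0 i - G i y)) ?normrN//.
  by rewrite [LHS]mxE [X in X + _]mxE [X in _ + X]mxE; ring.
have : `|L| / (2 * (mass + 1)) * (2 * (mass + 1)) = `|L|.
  by rewrite divfK// gt_eqF.
move: e0; set z := `|L| / _ => z0 E1 E2; lra.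
Qed.

End annihilator.

(** * From vanishing potentials to vanishing moments *)

Section moments.
Context {R : realType}.
Notation E := 'rV[R]_3.

Lemma dot0l (u : E) : dot 0 u = 0.
Proof. by rewrite -(scale0r u) dotZl mul0r. Qed.

Lemma dot0r (u : E) : dot u 0 = 0.
Proof. by rewrite dotC dot0l. Qed.

Context (mu : {measure set E -> \bar R}) (F : set E) (r : R).
Hypotheses (cF : closed F) (r_gt0 : 0 < r) (Fr : F `<=` sphere r).
Implicit Types (e t l : R) (x y xi : E) (w a : E -> R) (b : E -> E).

Let mF : measurable F. Proof. exact: measurable_closed. Qed.

Let dotF xi y : F y -> `|dot xi y| <= enorm xi * r.
Proof. by move=> /Fr <-; exact: normr_dot_le. Qed.

Let measurable_dotF xi : measurable_fun F (dot xi).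
Proof. by apply: measurable_dot => i //; exact: measurable_coord. Qed.

(** The coefficients of the expansion in t are positive multiples of the moments, and zeros
    accumulating at t = 0 annihilate all of them. *)
Lemma zonal_moment w xi : mu.-integrable F (EFin \o w) ->
  (forall e, 0 < e -> exists t, 0 < `|t| < e /\
    \int[mu]_(y in F) (w y * kap (1 - t * dot xi y)) = 0) ->
  forall k, \int[mu]_(y in F) (w y * dot xi y ^+ k) = 0.
Proof.
move=> iw wz k.
pose al (y : E) : R := 1; pose be y : R := - (dot xi y / 2); pose ga (y : E) : R := 0.
have B0 : 0 <= enorm xi * r by rewrite mulr_ge0 ?enorm_ge0// ltW.
have mbe : measurable_fun F be.
  apply: measurableT_comp => //; apply: measurable_funM => //; exact: measurable_dotF.
have be_le y : F y -> `|be y| <= enorm xi * r.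
  move=> Fy; rewrite /be normrN normrM normfV (le_trans _ (dotF xi Fy))//.
  by rewrite ler_piMr// gtr0_norm; lra.
have iS n : mu.-integrable F (EFin \o (fun y => w y * dot xi y ^+ n)).
  apply: (@integrable_bddM _ _ _ _ _ mF _ _ ((enorm xi * r) ^+ n)) => //.
    by apply: measurable_funX; exact: measurable_dotF.
  by move=> y Fy; rewrite normrX lerXn2r ?nnegrE// dotF.
have ga_le y : F y -> `|ga y| <= enorm xi * r by rewrite normr0.
have T := @taylor_kap_quad _ _ _ mu F mF al be ga 1 (enorm xi * r)
  (measurable_cst _) mbe (measurable_cst _) ltr01 (fun y _ => lexx _) be_le
  ga_le w iw.
have T' : taylor (fun t => \int[mu]_(y in F) (w y * kap (1 - t * dot xi y)))
    (fun n => (kap 1 * geg 1 0 n * 2^-1 ^+ n) * \int[mu]_(y in F) (w y * dot xi y ^+ n)).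
  apply: eq_taylor; last first.
    rewrite (_ : (fun n => _) = (fun n => \int[mu]_(y in F) (w y * kap_coef al be ga y n))).
      exact: T.
    apply/funext => n; rewrite -RintegralZl//; apply/esym/eq_Rintegral => y _.
    have bE : - be y / al y = dot xi y / 2 by rewrite /be /al opprK divr1.
    have gE : ga y / al y = 0 by rewrite /ga mul0r.
    rewrite /kap_coef bE gE (geg_e0 (dot xi y / 2)) exprMn /al.
    by ring.
  exists 1 => // t _; apply: eq_Rintegral => y _.
  by rewrite (_ : _ + _ = 1 - t * dot xi y)// /al /be /ga; field.
have c0 : 0 < kap 1 * geg 1 0 k * 2^-1 ^+ k :> R.
  by rewrite !mulr_gt0 ?geg_gt0 ?exprn_gt0 ?invr_gt0 ?exprn_gt0 ?sqrtr_gt0.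
by have /eqP := taylor_coef0 T' wz k; rewrite mulf_eq0 gt_eqF//= => /eqP.
Qed.

Section ray.
Variables (a : E -> R) (b : E -> E) (xi : E).
Hypotheses (xi_neq0 : xi != 0) (ia : mu.-integrable F (EFin \o a))
  (ib : forall i, mu.-integrable F (EFin \o (fun y => b y 0 i))).

Let q := dot xi xi.
Let q_gt0 : 0 < q. Proof. by rewrite dot_gt0. Qed.
Let den l := l ^+ 2 * q + r ^+ 2.
Let den_gt0 l : 0 < den l.
Proof. by rewrite ltr_wpDl ?exprn_gt0// mulr_ge0 ?sqr_ge0// ltW. Qed.
Definition ray_par (l : R) := 2 * l / (l ^+ 2 * q + r ^+ 2).
Definition ray_int (w : E -> R) (t : R) := \int[mu]_(y in F) (w y * kap (1 - t * dot xi y)).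

Let dist_ray l y : F y -> dot (l *: xi - y) (l *: xi - y) = den l * (1 - ray_par l * dot xi y).
Proof.
have hr := r_gt0.
move=> /Fr /(sphereE _ (ltW hr)) yy; have d0 : l ^+ 2 * q + r ^+ 2 != 0 by exact: lt0r_neq0
  (den_gt0 l).
rewrite /ray_par /den dotBl !dotBr !dotZl !dotZr yy (dotC y xi) -/q; field.
exact: d0.
Qed.

Lemma integrable_position : mu.-integrable F (EFin \o (fun y => dot (b y) y)).
Proof.
apply: (integrable_dot (M := r) cF ib) => [i|y /Fr ->//]; exact: measurable_coord.
Qed.

Lemma integrable_direction : mu.-integrable F (EFin \o (fun y => dot (b y) xi)).
Proof.
by apply: (integrable_dot (M := enorm xi) cF ib) => // i; exact: measurable_cst.
Qed.

Lemma ray_pot l : ~ F (l *: xi) -> pot mu F r a b (l *: xi) =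
  kap (l ^+ 2 * q + r ^+ 2) * ((l ^+ 2 * q - r ^+ 2) * ray_int a (ray_par l) +
  l * ray_int (fun y => dot (b y) xi) (ray_par l) -
  ray_int (fun y => dot (b y) y) (ray_par l)).
Proof.
move=> Fl; have [m m0 mle] := closed_sep cF Fl.
have t_gt y : F y -> m / den l <= 1 - ray_par l * dot xi y.
  by move=> Fy; rewrite ler_pdivrMr// mulrC -dist_ray// mle.
have md0 : 0 < m / den l by rewrite divr_gt0.
have ik w : mu.-integrable F (EFin \o w) ->
    mu.-integrable F (EFin \o (fun y => w y * kap (1 - ray_par l * dot xi y))).
  move=> iw; apply: (@integrable_bddM _ _ _ _ _ mF _ _ (kap (m / den l))) => //.
    apply: (measurable_comp_pos (f := fun y => 1 - ray_par l * dot xi y)).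
    - apply: measurable_funB => //; apply: measurable_funM => //; exact: measurable_dotF.
    - by move=> y /t_gt; exact: lt_le_trans.
    - by move=> z z0; exact: kap_continuous.
  by move=> y Fy; rewrite ger0_norm ?kap_ge0// kap_le// t_gt.
have i1 := ik _ ia; have i2 := ik _ integrable_direction; have i3 := ik _ integrable_position.
have i1' := integrable_scale mF (l ^+ 2 * q - r ^+ 2) i1.
have i2' := integrable_scale mF l i2.
have i12 := integrable_add mF i1' i2'.
rewrite /ray_int -RintegralZl// -[l * _]RintegralZl// -RintegralD// -RintegralB//.
rewrite -RintegralZl//; last by have := integrableB mF i12 i3.
apply: eq_Rintegral => y /set_mem Fy.
rewrite dist_ray// kapM ?(ltW (den_gt0 l))// dotBr !dotZl !dotZr -/q /den; ring.
Qed.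

Lemma ray_par_small e L : 0 < e -> exists l, [/\ 0 < l, L < l & 0 < `|ray_par l| < e].
Proof.
move=> e0; have hr := r_gt0; have hq := q_gt0.
(* The parameter is below 2 / (l q), hence below e as soon as l > 2 / (q e). *)
pose l := 1 + `|L| + 2 / (q * e).
have z0 : 0 < 2 / (q * e) by rewrite divr_gt0// mulr_gt0.
have l0 : 0 < l by rewrite /l; have := normr_ge0 L; lra.
exists l; split => //; first by rewrite /l; have := ler_norm L; lra.
have p0 : 0 < ray_par l by rewrite divr_gt0// ?mulr_gt0//; exact: den_gt0.
rewrite gtr0_norm// p0/= ltr_pdivrMr; last exact: den_gt0.
have : 2 < l * (q * e).
  by rewrite -ltr_pdivrMr ?mulr_gt0// /l; have := normr_ge0 L; lra.
move=> h; have : l * 2 < l * (l * (q * e)) by rewrite ltr_pM2l.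
have : 0 < e * r ^+ 2 by rewrite mulr_gt0// exprn_gt0.
move=> h1 h2; rewrite (_ : e * _ = l * (l * (q * e)) + e * r ^+ 2); last by ring.
lra.
Qed.

End ray.

(** With b = 0 only the integral of [a] remains at l xi, and its factor l ^ 2 |xi|^2 - r ^ 2 is
    nonzero far out. *)
Lemma poisson_moment a R0 : mu.-integrable F (EFin \o a) ->
  (forall x, R0 < enorm x -> pot mu F r a (fun=> 0) x = 0) ->
  forall xi k, xi != 0 -> \int[mu]_(y in F) (a y * dot xi y ^+ k) = 0.
Proof.
move=> ia a0 xi k xi0; apply: zonal_moment => // e e0.
have hr := r_gt0; have n0 : 0 < enorm xi by rewrite enorm_gt0.
have [l [l0 lL lt]] := ray_par_small xi0 ((`|R0| + r) / enorm xi) e0.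
exists (ray_par xi l); split => //.
have lx : `|R0| + r < l * enorm xi by rewrite -ltr_pdivrMr.
have nl : enorm (l *: xi) = l * enorm xi by rewrite enormZ gtr0_norm.
have Fl : ~ F (l *: xi).
  by move=> /Fr; rewrite /sphere /= nl => h; move: lx; rewrite h; have := normr_ge0 R0; lra.
have ib0 i : mu.-integrable F (EFin \o (fun y : E => ((fun=> 0) y : E) 0 i)).
  by apply: (eq_integrable mF (cst 0%E)); [move=> y _; rewrite /= mxE|exact: integrable0].
have := ray_pot xi0 ia ib0 Fl; rewrite a0; last first.
  by rewrite nl; have := ler_norm R0; lra.
have r0 c : ray_int xi (fun y => dot ((fun=> 0) y : E) (c y)) (ray_par xi l) = 0.
  rewrite /ray_int (@eq_Rintegral _ _ _ mu F (cst 0)); first by rewrite Rintegral_cst// mul0r.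
  move=> y _.
  by rewrite dot0l mul0r.
rewrite (r0 (fun=> xi)) (r0 id) mulr0 addr0 subr0 => /esym/eqP.
have q0 : dot xi xi = enorm xi ^+ 2 by rewrite sqr_enorm.
rewrite !mulf_eq0 q0 -exprMn => /orP[|/orP[|/eqP//]].
  rewrite /kap invr_eq0 expf_eq0/= sqrtr_eq0 leNgt ltr_wpDl ?sqr_ge0//.
  by rewrite exprn_gt0.
rewrite subr_eq0 eqrXn2 ?(ltW r_gt0)// ?mulr_ge0 ?(ltW n0) ?(ltW l0)// => /eqP h.
by move: lx; rewrite h; have := normr_ge0 R0; lra.
Qed.

(** Let G1 and G2 be the integrals of b . xi and b . y. Vanishing at l xi means l G1 = G2; the
    inverse point l' xi has the same parameter and gives l' G1 = G2. As l' < l, both are 0. *)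
Lemma dipole_moment b R0 :
  (forall i, mu.-integrable F (EFin \o (fun y => b y 0 i))) ->
  (forall x, R0 <= enorm x -> pot mu F r (fun=> 0) b x = 0) ->
  (forall x, enorm x < r -> pot mu F r (fun=> 0) b x = 0) ->
  forall xi k, xi != 0 -> \int[mu]_(y in F) (dot (b y) xi * dot xi y ^+ k) = 0 /\
    \int[mu]_(y in F) (dot (b y) y * dot xi y ^+ k) = 0.
Proof.
move=> ib b_out b_in xi k xi0.
have hr := r_gt0; have n0 : 0 < enorm xi by rewrite enorm_gt0.
have ia0 : mu.-integrable F (EFin \o (fun y : E => 0 : R)) by exact: integrable0.
have qE : dot xi xi = enorm xi ^+ 2 by rewrite sqr_enorm.
suff S e : 0 < e -> exists t, 0 < `|t| < e /\
    (ray_int xi (fun y => dot (b y) xi) t = 0 /\ ray_int xi (fun y => dot (b y) y) t = 0).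
  split; apply: zonal_moment => //.
  - exact: integrable_direction.
  - by move=> e /S[t [? []]]; exists t.
  - exact: integrable_position.
  - by move=> e /S[t [? []]]; exists t.
move=> e0; have [l [l0 lL lt]] := ray_par_small xi0 ((`|R0| + r) / enorm xi) e0.
exists (ray_par xi l); split => //.
have lx : `|R0| + r < l * enorm xi by rewrite -ltr_pdivrMr.
pose l' := r ^+ 2 / (l * dot xi xi).
have lq0 : 0 < l * dot xi xi by rewrite mulr_gt0// dot_gt0.
have l'0 : 0 < l' by rewrite divr_gt0// exprn_gt0.
have nl : enorm (l *: xi) = l * enorm xi by rewrite enormZ gtr0_norm.
have nl' : enorm (l' *: xi) = l' * enorm xi by rewrite enormZ gtr0_norm.
have l'r : l' * enorm xi < r.
  rewrite /l' qE mulrAC ltr_pdivrMr; last by rewrite -qE.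
  rewrite (_ : r * _ = (r * (l * enorm xi)) * enorm xi); last by ring.
  by rewrite ltr_pM2r// expr2 ltr_pM2l//; have := normr_ge0 R0; lra.
have ll' : l' < l.
  by rewrite -(ltr_pM2r n0) (lt_trans l'r)//; have := normr_ge0 R0; lra.
have Fl : ~ F (l *: xi).
  by move=> /Fr; rewrite /sphere /= nl => h; move: lx; rewrite h; have := normr_ge0 R0; lra.
have Fl' : ~ F (l' *: xi).
  by move=> /Fr; rewrite /sphere /= nl' => h; move: l'r; rewrite h ltxx.
have tE : ray_par xi l' = ray_par xi l.
  rewrite /ray_par /l'; field.
  have d0 : 0 < l ^+ 2 * dot xi xi + r ^+ 2.
    by rewrite ltr_wpDl ?exprn_gt0// mulr_ge0 ?sqr_ge0 ?dot_ge0.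
  have d1 : r ^+ 4 + r ^+ 2 * (l ^+ 2 * dot xi xi) = r ^+ 2 * (l ^+ 2 * dot xi xi + r ^+ 2) by
    ring.
  rewrite d1; apply/and4P; split; apply: lt0r_neq0 => //; first by rewrite dot_gt0.
  by rewrite mulr_gt0// exprn_gt0.
have := ray_pot xi0 ia0 ib Fl; rewrite b_out; last first.
  by rewrite nl; have := ler_norm R0; lra.
have := ray_pot xi0 ia0 ib Fl'; rewrite b_in; last by rewrite nl'.
have r0 t : ray_int xi (fun=> 0) t = 0.
  rewrite /ray_int (@eq_Rintegral _ _ _ mu F (cst 0)); first by rewrite Rintegral_cst// mul0r.
  by move=> y _; rewrite mul0r.
rewrite tE !r0 !mulr0 !add0r.
set G1 := ray_int _ _ _; set G2 := ray_int _ _ _.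
have kap_neq0 z : 0 < z + r ^+ 2 -> kap (z + r ^+ 2) != 0.
  by move=> z0; rewrite /kap gt_eqF// invr_gt0 exprn_gt0// sqrtr_gt0.
have kn z : kap (z ^+ 2 * dot xi xi + r ^+ 2) != 0.
  by rewrite kap_neq0// ltr_wpDl ?exprn_gt0// mulr_ge0 ?sqr_ge0 ?dot_ge0.
move=> /esym/eqP; rewrite mulf_eq0 (negbTE (kn _))/= subr_eq0 => /eqP E1.
move=> /esym/eqP; rewrite mulf_eq0 (negbTE (kn _))/= subr_eq0 => /eqP E2.
have /eqP : (l - l') * G1 = 0 by rewrite mulrBl E2 E1 subrr.
rewrite mulf_eq0 subr_eq0 gt_eqF//= => /eqP G10.
by split => //; rewrite -E2 G10 mulr0.
Qed.

Lemma moment_all w : (forall xi k, xi != 0 -> \int[mu]_(y in F) (w y * dot xi y ^+ k) = 0) ->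
  forall xi k, \int[mu]_(y in F) (w y * dot xi y ^+ k) = 0.
Proof.
(* At xi = 0 only k = 0 has content, and there the power is 1 whatever the direction, so a nonzero
   direction supplies it. *)
move=> h xi [|k]; last first.
  have [->|] := eqVneq xi 0; last exact: h.
  rewrite (@eq_Rintegral _ _ _ mu F (cst 0)); first by rewrite Rintegral_cst// mul0r.
  by move=> y _; rewrite dot0l expr0n mulr0.
have d0 : delta_mx 0 ord0 != 0 :> E by rewrite -enorm_gt0 enorm_delta.
by rewrite -(h _ 0%N d0); apply: eq_Rintegral => y _; rewrite !expr0.
Qed.

Lemma Lam_scalar_moment w :
  (forall xi k, \int[mu]_(y in F) (w y * dot xi y ^+ k) = 0) ->
  forall xi k, Lam mu F w (fun=> 0) (fun y => dot xi y ^+ k)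
    (fun y => (k%:R * dot xi y ^+ k.-1) *: xi) = 0.
Proof.
move=> h xi k; rewrite -(h xi k); apply: eq_Rintegral => y _.
by rewrite dot0l addr0.
Qed.

(** Pairing b with the gradient of (xi . y) ^ k gives k times the moment of b . xi of order k -
    1. *)
Lemma Lam_vector_moment b :
  (forall i, mu.-integrable F (EFin \o (fun y => b y 0 i))) ->
  (forall xi k, xi != 0 -> \int[mu]_(y in F) (dot (b y) xi * dot xi y ^+ k) = 0) ->
  forall xi k, Lam mu F (fun=> 0) b (fun y => dot xi y ^+ k)
    (fun y => (k%:R * dot xi y ^+ k.-1) *: xi) = 0.
Proof.
move=> ib h xi k.
have z (phi : E -> R) : (forall y, phi y = 0) -> \int[mu]_(y in F) phi y = 0.
  move=> phi0; rewrite (@eq_Rintegral _ _ _ mu F (cst 0)) => [|y _]; last exact: phi0.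
  by rewrite Rintegral_cst// mul0r.
have [->|xi0] := eqVneq xi 0.
  by apply: z => y; rewrite scaler0 mul0r add0r dot0r.
transitivity (\int[mu]_(y in F) (k%:R * (dot (b y) xi * dot xi y ^+ k.-1))).
  by apply: eq_Rintegral => y _; rewrite mul0r add0r dotZr; ring.
rewrite RintegralZl ?h ?mulr0//.
apply: (@integrable_bddM _ _ _ _ _ mF _ _ ((enorm xi * r) ^+ k.-1)).
- exact: integrable_direction.
- by apply: measurable_funX; exact: measurable_dotF.
- move=> y Fy; rewrite normrX lerXn2r ?nnegrE ?dotF// mulr_ge0 ?enorm_ge0//; exact: ltW.
Qed.

End moments.

(** * A calculus of C^1 functions *)

Section c1_functions.
Context {R : realType}.
Implicit Types (V : normedModType R) (h : R).

Lemma is_derive_quad V (f : V -> R) (x v : V) (d C : R) :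
  (forall h, `|f (h *: v + x) - f x - h * d| <= C * h ^+ 2) -> is_derive x v f d.
Proof.
move=> fC.
have C0 : 0 <= C by have := le_trans (normr_ge0 _) (fC 1); rewrite expr1n mulr1.
suff cv : h^-1 *: ((f \o shift x) (h *: v) - f x) @[h --> 0^'] --> d.
  by split; [apply/cvg_ex; exists d|exact: cvg_lim cv].
have C1 : 0 < C + 1 by rewrite ltr_wpDl.
apply/cvgrPdist_lt => e e0; have d0 : 0 < e / (C + 1) by rewrite divr_gt0.
near=> h.
have h0 : h != 0 by near: h; exact: nbhs_dnbhs_neq.
have -> : d - h^-1 *: ((f \o shift x) (h *: v) - f x) =
    - (h^-1 * (f (h *: v + x) - f x - h * d)).
  by rewrite /= /GRing.scale /=; field.
rewrite normrN normrM normfV.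
have hp : 0 < `|h| by rewrite normr_gt0.
rewrite mulrC ltr_pdivrMr// (le_lt_trans (fC h))//.
rewrite -[h ^+ 2]real_normK ?num_real// expr2 mulrA ltr_pM2r//.
have hd : `|h| < e / (C + 1).
  by near: h; exact: dnbhs0_lt.
rewrite (@le_lt_trans _ _ ((C + 1) * `|h|))//; first by rewrite ler_wpM2r// lerDl.
by rewrite mulrC -ltr_pdivlMr.
Unshelve. all: by end_near. Qed.

Lemma is_derive_of_line V (f : V -> R) (x v : V) (d : R) :
  is_derive (0 : R) 1 (fun s : R => f (x + s *: v)) d -> is_derive x v f d.
Proof.
move=> [dv <-].
have E1 : (fun h : R => h^-1 *: (f (x + (h * 1 + 0) *: v) - f (x + (0 : R) *: v))) =
   (fun h : R => h^-1 *: ((f \o shift x) (h *: v) - f x)).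
  by apply/funext => h /=; rewrite scale0r !addr0 mulr1 [x + _]addrC.
by split; [move: dv; rewrite /derivable /= E1|rewrite [in RHS]/derive /= E1].
Qed.

Notation E := 'rV[R]_3.

Lemma is_derive_chain (f : E -> R) (x v : E) (phi : R -> R) (d dphi : R) :
  is_derive x v f d -> is_derive (f x) 1 phi dphi ->
  is_derive x v (phi \o f) (dphi * d).
Proof.
move=> df dp; apply: is_derive_of_line.
have d1 : is_derive (0 : R) 1 (fun s : R => f (x + s *: v)) d.
  by apply: is_derive_line; rewrite scale0r addr0.
have d2 : is_derive (f (x + (0 : R) *: v)) 1 phi dphi by rewrite scale0r addr0.
exact: (@is_derive1_comp R phi (fun s : R => f (x + s *: v)) 0 _ _ d2 d1).
Qed.

Implicit Types (f g : E -> R) (G H : 'I_3 -> E -> R).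

Definition C1 f G := [/\ continuous f, forall i, continuous (G i) &
  forall x i, is_derive x (delta_mx 0 i) f (G i x)].

Lemma C1_cst (c : R) : C1 (fun=> c) (fun _ _ => 0).
Proof.
split=> [|i|x i]; [exact: cst_continuous|exact: cst_continuous|].
exact: is_derive_cst.
Qed.

Lemma C1_coord j : C1 (fun y => y 0 j) (fun i _ => (j == i)%:R).
Proof.
split=> [|i|x i]; [exact: coord_continuous|exact: cst_continuous|].
apply: (@is_derive_quad _ _ _ _ _ 0) => h.
by rewrite !mxE eqxx /= addrK subrr normr0 mul0r.
Qed.

Lemma C1D f g G H : C1 f G -> C1 g H ->
  C1 (fun y => f y + g y) (fun i y => G i y + H i y).
Proof.
move=> [cf cG df] [cg cH dg]; split=> [x|i x|x i].
- by apply: contD; [exact: cf|exact: cg].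
- by apply: contD; [exact: cG|exact: cH].
- exact: is_deriveD.
Qed.

Lemma C1M f g G H : C1 f G -> C1 g H ->
  C1 (fun y => f y * g y) (fun i y => f y * H i y + g y * G i y).
Proof.
move=> [cf cG df] [cg cH dg]; split=> [x|i x|x i].
- by apply: contM; [exact: cf|exact: cg].
- apply: (@contD _ _ _ (fun y => f y * H i y) (fun y => g y * G i y)).
    by apply: contM; [exact: cf|exact: cH].
  by apply: contM; [exact: cg|exact: cG].
- exact: is_deriveM.
Qed.

Lemma C1_comp f G (phi dphi : R -> R) : continuous phi -> continuous dphi ->
  (forall s : R, is_derive s 1 phi (dphi s)) -> C1 f G ->
  C1 (phi \o f) (fun i y => dphi (f y) * G i y).
Proof.
move=> cphi cdphi dphiP [cf cG df]; split=> [x|i x|x i].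
- by apply: (@contcomp _ _ _ f phi); [exact: cf|exact: cphi].
- apply: (@contM _ _ (fun y => dphi (f y))); last exact: cG.
  by apply: (@contcomp _ _ _ f dphi); [exact: cf|exact: cdphi].
- exact: is_derive_chain.
Qed.

(** Squaring makes the positive part C^1. It serves to approximate indicators of orthants and to cut
    functions off near 0. *)
Definition pos_sqr (s : R) : R := Num.max 0 s ^+ 2.

Lemma max0_continuous : continuous (fun s : R => Num.max 0 s).
Proof. by move=> s; apply: continuous_max => //; exact: cst_continuous. Qed.

Lemma pos_sqr_continuous : continuous pos_sqr.
Proof.
move=> s; rewrite /pos_sqr; under eq_fun do rewrite expr2.
by apply: contM; exact: max0_continuous.
Qed.

Lemma is_derive_pos_sqr (s : R) : is_derive s 1 pos_sqr (2 * Num.max 0 s).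
Proof.
apply: (@is_derive_quad _ _ _ _ _ 1) => h; rewrite [h *: 1]mulr1 mul1r /pos_sqr.
rewrite ler_norml; case: (leP 0 s) => s0; case: (leP 0 (h + s)) => hs; apply/andP; split; nra.
Qed.

Lemma C1_pos_sqr f G : C1 f G ->
  C1 (fun y => pos_sqr (f y)) (fun i y => 2 * Num.max 0 (f y) * G i y).
Proof.
apply: (@C1_comp f G pos_sqr (fun s => 2 * Num.max 0 s)).
- exact: pos_sqr_continuous.
- by move=> s; apply: (@contM _ _ (fun=> 2) (fun t : R => Num.max 0 t)); [exact:
  cst_continuous|exact: max0_continuous].
- exact: is_derive_pos_sqr.
Qed.

Lemma C1V f G : (forall y, f y != 0) -> C1 f G ->
  C1 (fun y => (f y)^-1) (fun i y => - (f y) ^- 2 * G i y).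
Proof.
move=> f0 [cf cG df]; split=> [x|i x|x i].
- by apply: (@contcomp _ _ _ f (@GRing.inv R)); [exact: cf|exact: inv_continuous].
- apply: (@contM _ _ (fun y => - (f y) ^- 2)); last exact: cG.
  apply: (@contcomp _ _ _ f (fun t : R => - t ^- 2)); first exact: cf.
  apply: (@contcomp _ _ _ (fun t : R => t ^- 2) -%R); last exact: oppr_continuous.
  apply: (@contcomp _ _ _ (fun t : R => t ^+ 2) (@GRing.inv R)); first exact: exprn_continuous.
  by apply: inv_continuous; rewrite expf_neq0.
- have [d1 d2] := df x i; split; first exact: derivableV.
  by rewrite deriveV// d2.
Qed.

End c1_functions.

(** * Densities orthogonal to all C^1 functions *)

Section vanishing_density.
Context {R : realType}.
Notation E := 'rV[R]_3.
Context (mu : {measure set E -> \bar R}) (F : set E) (g : E -> R).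
Hypotheses (mF : measurable F) (ig : mu.-integrable F (EFin \o g))
  (g_C1 : forall f G, C1 f G -> \int[mu]_(y in F) (g y * f y) = 0).

(** Orthants generate the sigma-algebra, are stable under intersection, and are the positivity sets
    of products of [pos_sqr]. *)
Definition orthant (c : 'I_3 -> R) : set E := [set y | forall i, c i < y 0 i].

Lemma measurable_orthant c : measurable (orthant c).
Proof.
rewrite (_ : orthant c = \bigcap_(i in setT) [set y | c i < y 0 i]); last first.
  by apply/seteqP; split => [y h i _|y h i]; exact: h.
apply: fin_bigcap_measurable => // i _.
have := @measurable_coord R [set: E] i measurableT _ (measurable_itv `]c i, +oo[).
rewrite setTI; congr measurable.
by apply/seteqP; split => y /=; rewrite in_itv/= andbT.
Qed.

Lemma sigma_orthant : (measurable : set (set E)) `<=` <<s range orthant >>.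
Proof.
pose T := g_sigma_algebraType (range orthant).
have mid : measurable_fun setT (id : T -> E).
  apply: measurable_fun_rVP => i.
  apply: (measurability _ (RGenOInfty.measurableE R)) => //.
  move=> _ [_ [x ->] <-]; rewrite setTI.
  (* Letting the other bounds decrease to minus infinity turns orthants into a half-space. *)
  rewrite (_ : _ @^-1` _ = \bigcup_n orthant (fun j => if j == i then x else - n%:R)).
    by apply: bigcup_measurable => n _; apply: sub_gen_smallest; exists (fun j => if j == i
      then x else - n%:R).
  apply/seteqP; split => y /=.
    rewrite /rV_coord in_itv/= andbT => xy.
    exists (Num.bound (\sum_j `|y 0 j|)) => // j.
    case: eqVneq => [->//|_]; rewrite ltrNl (@le_lt_trans _ _ (\sum_j `|y 0 j|))//.
      by rewrite (le_trans (ler_norm _))// normrN (bigD1 j)//= lerDl sumr_ge0.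
    by rewrite archi_boundP// sumr_ge0.
  by move=> [n _ /(_ i)]; rewrite eqxx /rV_coord in_itv/= andbT.
by move=> A mA; have := mid measurableT A mA; rewrite setTI.
Qed.

Let orthant_integral c : (\int[mu]_(y in F `&` orthant c) (g y)%:E = 0)%E.
Proof.
pose P (y : E) := \prod_(i < 3) pos_sqr (y 0 i - c i).
have P0 y : 0 <= P y by apply: prodr_ge0 => i _; rewrite /pos_sqr sqr_ge0.
have [G PC1] : exists G, C1 P G.
  have C1c i : C1 (fun y : E => pos_sqr (y 0 i - c i)) _ :=
    C1_pos_sqr (C1D (C1_coord i) (C1_cst (- c i))).
  have -> : P = (fun y => pos_sqr (y 0 ord0 - c ord0) *
      pos_sqr (y 0 (lift ord0 ord0) - c (lift ord0 ord0)) *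
      pos_sqr (y 0 (lift ord0 (lift ord0 ord0)) - c (lift ord0 (lift ord0 ord0)))).
    by apply/funext => y; rewrite /P !big_ord_recl big_ord0 mulr1 mulrA.
  eexists; exact: (C1M (C1M (C1c ord0) (C1c (lift ord0 ord0))) (C1c (lift ord0 (lift ord0
    ord0)))).
have nP n y : 0 < 1 + n%:R * P y by rewrite ltr_pwDl// mulr_ge0.
(* These C^1 functions take values in [0, 1], are 0 where P = 0 and tend to 1 where P > 0: they
   converge to the indicator of the orthant, boundedly enough for dominated convergence. *)
pose f n y := 1 - (1 + n%:R * P y)^-1.
have f01 n y : 0 <= f n y <= 1.
  rewrite /f subr_ge0 invf_le1// lerDl mulr_ge0//= gerBl invr_ge0; exact: ltW.
have fC1 n : exists G, C1 (f n) G.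
  have -> : f n = (fun y => 1 + -1 * (1 + n%:R * P y)^-1).
    by apply/funext => y; rewrite mulN1r.
  eexists; exact: (C1D (C1_cst 1) (C1M (C1_cst (-1))
    (C1V (fun y => lt0r_neq0 (nP n y)) (C1D (C1_cst 1) (C1M (C1_cst n%:R) PC1))))).
have igf n : mu.-integrable F (EFin \o (fun y => g y * f n y)).
  have [H [cf _ _]] := fC1 n.
  apply: (@integrable_bddM _ _ _ _ _ mF _ _ 1) => //.
    apply: (@measurable_funS _ _ _ _ setT) => //.
    by apply: measurable_cont => [|x _]; [exact: openT|exact: cf].
  by move=> y _; have /andP[f0 f1] := f01 n y; rewrite ger0_norm.
have f0 n : (\int[mu]_(y in F) (g y * f n y)%:E = 0)%E.
  have [H C1H] := fC1 n.
  rewrite -[LHS]fineK; first by rewrite [fine _](g_C1 C1H).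
  exact: integrable_fin_num (igf n).
have fcvg y : (fun n => (g y * f n y)%:E) @ \oo --> ((EFin \o g) \_ (orthant c)) y.
  have [cy|cy] := pselect (orthant c y).
    rewrite patchE mem_set//; apply: cvg_EFin; first exact: nearW.
    rewrite -[X in _ --> X]mulr1; apply: cvgM; first exact: cvg_cst.
    have Py : 0 < P y.
      by apply: prodr_gt0 => i _; rewrite /pos_sqr exprn_gt0// lt_max subr_gt0 cy orbT.
    rewrite -[X in _ --> X]subr0; apply: cvgB; first exact: cvg_cst.
    apply/cvgr0Pnorm_lt => e e0; near=> n.
    rewrite gtr0_norm ?invr_gt0// -[ltRHS]invrK ltf_pV2 ?posrE ?invr_gt0//.
    rewrite (@lt_trans _ _ (n%:R * P y))//; last by rewrite ltrDr.
    rewrite -ltr_pdivrMr//; near: n; exact: nbhs_infty_gtr.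
  rewrite patchE memNset//.
  have Py : P y = 0.
    have [i /negP ci] : exists i, ~ c i < y 0 i by apply/existsNP.
    by rewrite /P (bigD1 i)//= /pos_sqr max_l ?expr0n ?mul0r// subr_le0 leNgt.
  rewrite (_ : (fun n => _) = cst 0%E); first exact: cvg_cst.
  by apply/funext => n; rewrite /f Py mulr0 addr0 invr1 subrr mulr0.
have fle y n : F y -> (`|(g y * f n y)%:E| <= `|(g y)%:E|)%E.
  move=> _; rewrite /= lee_fin normrM ler_piMr//.
  by have /andP[f0' f1] := f01 n y; rewrite ger0_norm.
rewrite integral_mkcondr.
have mlim : measurable_fun F ((EFin \o g) \_ (orthant c)).
  apply: (emeasurable_fun_cvg (fun n y => (g y * f n y)%:E)) => [n|y _]; last exact: fcvg.
  exact: measurable_int (igf n).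
have [_ _] : [/\ _, _ & _] := @dominated_convergence _ _ _ mu F mF (fun n y => (g y * f n y)%:E)
  ((EFin \o g) \_ (orthant c)) (fun y => `|(g y)%:E|%E)
  (fun n => measurable_int mu (igf n)) mlim (aeW mu (fun y _ => fcvg y))
  (integrable_abse ig) (aeW mu fle).
rewrite (_ : [sequence _]_n = cst 0%E); last by apply/funext => n; exact: f0.
by move=> /cvg_lim <-//; rewrite lim_cst.
Unshelve. all: by end_near. Qed.

(** The sets over which g integrates to 0 form a Dynkin system that contains the orthants, hence all
    measurable sets. *)
Lemma vanishing_density : ae_eq mu F (EFin \o g) (cst 0%E).
Proof.
pose H := [set A : set E | measurable A /\ (\int[mu]_(y in F `&` A) (g y)%:E = 0)%E].
have HF : (\int[mu]_(y in F) (g y)%:E = 0)%E.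
  have := g_C1 (C1_cst 1); rewrite (@eq_Rintegral _ _ _ mu F g); last by move=> y _; rewrite
    mulr1.
  move=> h; rewrite -[LHS]fineK; first by rewrite [fine _]h.
  exact: integrable_fin_num.
have dH : dynkin H.
  split.
  - by split; [exact: measurableT|rewrite setIT].
  - move=> A [mA A0]; split; first exact: measurableC.
    have := HF; rewrite -{1}[F]setIT -(setUv A) setIUr integral_setU.
    + by rewrite A0 add0e.
    + exact: measurableI.
    + by apply: measurableI => //; exact: measurableC.
    + rewrite -setIUr setUv setIT; exact: measurable_int ig.
    + apply/disj_setPS => y [[_ Ay] [_ nAy]]; exact: nAy.
  - move=> A tA HA; split; first by apply: bigcup_measurable => k _; exact: (HA k).1.
    rewrite setI_bigcupr integral_bigcup.
    + by rewrite eseries0// => k _ _; exact: (HA k).2.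
    + exact: trivIset_setIl.
    + by move=> k; apply: measurableI => //; exact: (HA k).1.
    + apply: integrableS ig => //; last by move=> y [k _ []].
      by apply: bigcup_measurable => k _; apply: measurableI => //; exact: (HA k).1.
have GI : setI_closed (range (@orthant)).
  move=> _ _ [c _ <-] [d _ <-]; exists (fun i => Num.max (c i) (d i)) => //.
  apply/seteqP; split => [y h|y [h1 h2] i].
    by split => i; have := h i; rewrite gt_max => /andP[].
  by rewrite gt_max h1 h2.
apply: integral_ae_eq => //.
move=> A AF mA; rewrite integral_cst// mul0e.
have : H A.
  have := sigma_orthant mA; rewrite -setI_closed_g_dynkin_g_sigma_algebra//.
  apply: smallest_sub => // _ [c _ <-]; split; first exact: measurable_orthant.
  exact: orthant_integral.
by move=> [_]; rewrite setIC setIidl.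
Qed.

End vanishing_density.

(** * The surface measure: finiteness and full support *)

Section surface_measure.
Context {R : realType}.
Notation E := 'rV[R]_3.
Notation T := (measurableTypeR R * measurableTypeR R)%type.
Variable r : R.
Hypothesis r_gt0 : 0 < r.
Local Notation omega := (sphere_measure r).
Local Notation leb2 := (@lebesgue_measure R \x @lebesgue_measure R)%E.

Let dens (p : T) : \bar R := (r ^+ 2 * sin p.1)%:E.

Let measurable_dens (D : set T) : measurable_fun D dens.
Proof.
apply/measurable_funTS/measurable_EFinP; apply: measurable_funM => //.
apply: (@measurableT_comp _ _ _ _ _ _ sin).
  by apply: continuous_measurable_fun; exact: continuous_sin.
exact: measurable_fst.
Qed.

Let dens_ge0 p : angles p -> (0 <= dens p)%E.
Proof.
move=> [/= + _]; rewrite in_itv/= => p1.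
by rewrite lee_fin mulr_ge0 ?sqr_ge0 ?sin_ge0_pi.
Qed.

Let measurable_pre (A : set E) : measurable A -> measurable (angles `&` spherical r @^-1` A).
Proof.
move=> mA; apply: measurableI; first exact: measurable_angles.
by rewrite -[X in measurable X]setTI; exact: measurable_spherical.
Qed.

Let leb2X (A B : set (measurableTypeR R)) : measurable A -> measurable B ->
  leb2 (A `*` B) = (lebesgue_measure A * lebesgue_measure B)%E.
Proof. exact: product_measure1E. Qed.

Lemma sphere_measure_fin : sphere_measure r [set: E] \is a fin_num.
Proof.
rewrite ge0_fin_numE ?measure_ge0//.
rewrite /sphere_measure preimage_setT setIT.
have mA := @measurable_angles R.
apply: (@le_lt_trans _ _ (\int[leb2]_(p in angles) cst (r ^+ 2)%:E p)%E).
  apply: ge0_le_integral => //.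
  by move=> p _; rewrite lee_fin ler_piMr ?sqr_ge0// sin_le1.
apply: (@le_lt_trans _ _ ((r ^+ 2)%:E * leb2 angles)%E); first by rewrite integral_cst.
rewrite /angles leb2X; [|exact: measurable_itv|exact: measurable_itv].
rewrite !lebesgue_measure_itv/= !lte_fin pi_gt0 mulrn_wgt0 ?pi_gt0//.
by rewrite -!EFinB -!EFinM ltry.
Qed.

Lemma dot_spherical p : dot (spherical r p) (spherical r p) = r ^+ 2.
Proof.
rewrite /dot !big_ord_recl big_ord0 !mxE /=.
have := cos2Dsin2 p.1; have := cos2Dsin2 p.2.
set c1 := cos p.1; set s1 := sin p.1; set c2 := cos p.2; set s2 := sin p.2 => h2 h1.
transitivity (r ^+ 2 * (s1 ^+ 2 * (c2 ^+ 2 + s2 ^+ 2) + c1 ^+ 2)); first by ring.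
by rewrite h2 mulr1 addrC h1 mulr1.
Qed.

Lemma spherical_sphere p : sphere r (spherical r p).
Proof. by apply/(sphereE _ (ltW r_gt0)); exact: dot_spherical. Qed.

Lemma measurable_sphere : measurable (sphere r : set E).
Proof. by apply: measurable_closed; exact: (@sphere_closed R). Qed.

Lemma ae_sphere : {ae omega, forall x, sphere r x}.
Proof.
exists (~` sphere r); split => //.
- by apply: measurableC; exact: measurable_sphere.
- rewrite /sphere_measure (_ : _ @^-1` _ = set0) ?setI0 ?integral_set0//.
  by apply/seteqP; split => p //=; move/(_ (spherical_sphere p)).
Qed.

Lemma L2_integrable f (D : set E) : measurable D -> L2 r f -> omega.-integrable D (EFin \o f).
Proof.
move=> mD /(Lfun_subset12 sphere_measure_fin)/Lfun1_integrable.
by apply: integrableS => //; exact: measurableT.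
Qed.

Let spherical_onto x : sphere r x -> exists2 p, angles p & spherical r p = x.
Proof.
have hr := r_gt0.
move=> xr; have xx : dot x x = r ^+ 2 by exact/(sphereE _ (ltW r_gt0)).
have abz : x 0 ord0 ^+ 2 + x 0 (lift ord0 ord0) ^+ 2 +
    x 0 (lift ord0 (lift ord0 ord0)) ^+ 2 = r ^+ 2.
  by rewrite -xx /dot !big_ord_recl big_ord0 addr0 !addrA -!expr2.
have spE p : spherical r p = x <-> [/\ r * sin p.1 * cos p.2 = x 0 ord0,
    r * sin p.1 * sin p.2 = x 0 (lift ord0 ord0) &
    r * cos p.1 = x 0 (lift ord0 (lift ord0 ord0))].
  split=> [<-|[h1 h2 h3]]; first by rewrite !mxE.
  apply/rowP => -[[|[|[|//]]] i3]; rewrite mxE /= ?h1 ?h2 ?h3; congr (x 0 _); exact: val_inj.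
move: abz; set a := x 0 ord0 in spE *; set b := x 0 (lift ord0 ord0) in spE *.
set z := x 0 (lift ord0 (lift ord0 ord0)) in spE * => abz.
have zr : -1 <= z / r <= 1.
  by rewrite -ler_norml normrM normfV (gtr0_norm hr) ler_pdivrMr// mul1r -xr coord_le.
pose t := acos (z / r).
have ct : cos t = z / r by rewrite /t acosK// in_itv.
have t0 : 0 <= t <= pi by rewrite acos_ge0// acos_lepi.
have st : 0 <= sin t by exact: sin_ge0_pi.
pose rho := r * sin t.
have rho0 : 0 <= rho by rewrite mulr_ge0// ltW.
have rho2 : rho ^+ 2 = a ^+ 2 + b ^+ 2.
  have -> : rho ^+ 2 = r ^+ 2 * (cos t ^+ 2 + sin t ^+ 2) - (r * cos t) ^+ 2 by rewrite /rho;
    ring.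
  by rewrite cos2Dsin2 ct mulrCA divff ?gt_eqF// !mulr1 -abz addrK.
have zE : r * cos t = z by rewrite ct mulrCA divff ?gt_eqF// mulr1.
have tI : t \in `[0, pi] by rewrite in_itv.
(* At a pole the azimuth is arbitrary, and 0 is taken. *)
have [rho_eq0|rho_neq0] := eqVneq rho 0.
  exists (t, 0).
    by split => //=; rewrite in_itv/= lexx mulrn_wge0// pi_ge0.
  apply/spE => /=; rewrite -/rho rho_eq0 !mul0r.
  have : a ^+ 2 + b ^+ 2 == 0 by rewrite -rho2 rho_eq0 expr0n.
  by rewrite paddr_eq0 ?sqr_ge0// !sqrf_eq0 => /andP[/eqP -> /eqP ->].
have rho_gt0 : 0 < rho by rewrite lt_neqAle eq_sym rho_neq0.
pose f := acos (a / rho).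
have ar : -1 <= a / rho <= 1.
  rewrite -ler_norml normrM normfV (gtr0_norm rho_gt0) ler_pdivrMr// mul1r.
  by rewrite -(@ler_pXn2r _ 2) ?nnegrE// real_normK ?num_real// rho2 lerDl sqr_ge0.
have cf : rho * cos f = a by rewrite /f acosK ?in_itv// mulrCA divff// mulr1.
have f0 : 0 <= f <= pi by rewrite acos_ge0// acos_lepi.
have sf : rho * sin f = `|b|.
  have s0 : 0 <= rho * sin f by rewrite mulr_ge0// sin_ge0_pi.
  apply/eqP; rewrite -(@eqrXn2 _ 2)// real_normK ?num_real//.
  have -> : (rho * sin f) ^+ 2 = rho ^+ 2 * (cos f ^+ 2 + sin f ^+ 2) - (rho * cos f) ^+ 2 by
    ring.
  by rewrite cos2Dsin2 cf rho2 mulr1 addrC addKr.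
have pi0 := @pi_gt0 R.
(* The arccosine knows only the cosine of the azimuth; the sign of b decides between f and 2 pi -
   f. *)
have [b0|b0] := leP 0 b.
  exists (t, f); first by split => //=; rewrite in_itv/=; move/andP: f0 => [? ?]; apply/andP;
    split; lra.
  by apply/spE; rewrite /= -/rho cf sf ger0_norm.
exists (t, pi *+ 2 - f).
  by split => //=; rewrite in_itv/=; move/andP: f0 => [? ?]; apply/andP; split; lra.
apply/spE; rewrite /= -/rho; split => //.
  by rewrite cosB cos2pi sin2pi mul1r mul0r addr0.
by rewrite sinB cos2pi sin2pi mul1r mul0r add0r mulrN sf ltr0_norm// opprK.
Qed.

Let spherical_near (p0 : R * R) (U : set E) : nbhs (spherical r p0) U ->
  exists2 e : R, 0 < e & forall p : R * R, `|p.1 - p0.1| < e -> `|p.2 - p0.2| < e ->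
    U (spherical r p).
Proof.
move=> /nbhs_ballP[e /= e0 eU].
have c1 (k : R -> R) : continuous k -> {for p0, continuous (fun p : R * R => k p.1)}.
  by move=> ck; apply: (@contcomp _ _ _ fst k); [exact: cvg_fst|exact: ck].
have c2 (k : R -> R) : continuous k -> {for p0, continuous (fun p : R * R => k p.2)}.
  by move=> ck; apply: (@contcomp _ _ _ snd k); [exact: cvg_snd|exact: ck].
have cs := @continuous_sin R; have cc := @continuous_cos R.
have cr : {for p0, continuous (fun p : R * R => r * sin p.1)}.
  by apply: (@contM _ _ (fun=> r)); [exact: contC|exact: c1].
have n0 : \forall p \near p0, `|spherical r p0 0 ord0 - spherical r p 0 ord0| < e.
  have : {for p0, continuous (fun p : R * R => r * sin p.1 * cos p.2)}.
    by apply: contM => //; exact: c2.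
  by move=> /cvgrPdist_lt/(_ e e0); apply: filterS => p; rewrite !mxE.
have n1 : \forall p \near p0, `|spherical r p0 0 (lift ord0 ord0) -
    spherical r p 0 (lift ord0 ord0)| < e.
  have : {for p0, continuous (fun p : R * R => r * sin p.1 * sin p.2)}.
    by apply: contM => //; exact: c2.
  by move=> /cvgrPdist_lt/(_ e e0); apply: filterS => p; rewrite !mxE.
have n2 : \forall p \near p0, `|spherical r p0 0 (lift ord0 (lift ord0 ord0)) -
    spherical r p 0 (lift ord0 (lift ord0 ord0))| < e.
  have : {for p0, continuous (fun p : R * R => r * cos p.1)}.
    by apply: (@contM _ _ (fun=> r)); [exact: contC|exact: c1].
  by move=> /cvgrPdist_lt/(_ e e0); apply: filterS => p; rewrite !mxE.
have : nbhs p0 [set p : R * R | U (spherical r p)].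
  apply: filterS (filterI n0 (filterI n1 n2)) => p [h0 [h1 h2]].
  apply: eU; split => // i j; rewrite (ord1 i) /ball/=.
  case: j => -[|[|[|//]]] j3.
  - by rewrite (_ : Ordinal j3 = ord0)//; exact: val_inj.
  - by rewrite (_ : Ordinal j3 = lift ord0 ord0)//; exact: val_inj.
  - by rewrite (_ : Ordinal j3 = lift ord0 (lift ord0 ord0))//; exact: val_inj.
move=> /nbhs_ballP[d /= d0 dU]; exists d => // p h1 h2; apply: dU.
by split; rewrite /ball/= distrC.
Qed.

(** U contains the image of a nonempty open rectangle of angles with polar angle strictly between 0
    and pi, where the density r ^ 2 sin(theta) is positive. *)
Lemma sphere_full_support x (U : set E) : sphere r x -> nbhs x U ->
  ~ omega.-negligible U.
Proof.
move=> /spherical_onto[[t f] [/= tI fI] <-] /spherical_near[e e0 eU] [N [mN N0 UN]].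
have pi0 := @pi_gt0 R.
move: tI fI; rewrite !in_itv/= => /andP[t0 t1] /andP[f0 f1].
(* The window is cut off at 0 and L, so it is one-sided when s is an endpoint. *)
have window (s L : R) : 0 <= s -> s <= L -> 0 < L -> exists a b : R,
    [/\ a < b, 0 <= a, b <= L & forall u, a < u -> u < b -> `|u - s| < e].
  move=> s0 sL L0; exists (Num.max (s - e) 0), (Num.min (s + e) L); split.
  - by rewrite gt_max !lt_min; apply/andP; split; apply/andP; split; lra.
  - by rewrite le_max lexx orbT.
  - by rewrite ge_min lexx orbT.
  - move=> u; rewrite gt_max lt_min => /andP[u1 u2] /andP[u3 u4].
    by rewrite ltr_norml; apply/andP; split; lra.
have [a [b [ab a0 bpi tab]]] := window t pi t0 t1 pi0.
have [c [d [cd c0 dpi fcd]]] := window f (pi *+ 2) f0 f1 (mulrn_wgt0 2 pi0).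
pose B := angles `&` spherical r @^-1` N.
have mB : measurable B := measurable_pre mN.
have : ae_eq leb2 B dens (cst 0%E).
  apply/ae_eq_integral_abs => //.
  rewrite -[RHS]N0; apply: eq_integral => p /set_mem[Ap _].
  by rewrite gee0_abs// dens_ge0.
move=> [M [mM M0 BM]].
have IJM : (`]a, b[ `*` `]c, d[ : set T) `<=` M.
  move=> [u v] [/=]; rewrite !in_itv/= => /andP[au ub] /andP[cv vd].
  apply: BM => /= h.
  have : dens (u, v) = 0%E.
    apply: h; split; first by split => /=; rewrite in_itv/=; apply/andP; split; lra.
    by apply: UN; apply: eU => /=; [exact: tab|exact: fcd].
  move=> /eqP; rewrite eqe mulf_eq0 sqrf_eq0 gt_eqF//= gt_eqF// sin_gt0_pi//.
  by apply/andP; split; lra.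
have : (leb2 (`]a, b[ `*` `]c, d[) <= 0)%E.
  rewrite -M0; apply: le_measure; rewrite ?inE//.
  by apply: measurableX; exact: measurable_itv.
rewrite leb2X; [|exact: measurable_itv|exact: measurable_itv].
rewrite !lebesgue_measure_itv/= !lte_fin ab cd -!EFinB -EFinM lee_fin.
by rewrite leNgt mulr_gt0// subr_gt0.
Qed.

(** This turns the almost everywhere hypothesis on |x| = r2 into the pointwise boundary condition of
    the maximum principle. *)
Lemma ae_sphere_eq0 (f : E -> R) : {ae omega, forall x, f x = 0} ->
  forall x, sphere r x -> {for x, continuous f} -> f x = 0.
Proof.
move=> f0 x xr cf; apply/eqP; rewrite -[_ == _]negbK; apply/negP => fx.
apply: (@sphere_full_support x [set y | f y != 0]) => //.
  have f_gt0 : 0 < `|f x| by rewrite normr_gt0.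
  move: cf => /cvgrPdist_lt/(_ _ f_gt0); apply: filterS => y /= xy.
  by apply: contraTN xy => /eqP ->; rewrite subr0 ltxx.
move: f0 => [N [mN N0 fN]]; exists N; split=> // y /= fy.
by apply: fN => h; rewrite h eqxx in fy.
Qed.

End surface_measure.

(** * The reciprocal distance as a test function on the sphere *)

Section reciprocal_distance.
Context {R : realType}.
Notation E := 'rV[R]_3.
Implicit Types (f g : E -> R) (y v : E).

Definition rsqrt (s : R) : R := (Num.sqrt s)^-1.

Lemma is_derive_rsqrt (s : R) : 0 < s -> is_derive s 1 rsqrt (- (2^-1 * rsqrt s ^+ 3)).
Proof.
move=> s0; have q0 : Num.sqrt s != 0 by rewrite gt_eqF// sqrtr_gt0.
have := is_deriveV q0 (is_derive1_sqrt s0).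
move=> d; apply: (is_derive_eq d); rewrite /rsqrt /GRing.scale /=; field; exact: q0.
Qed.

Lemma rsqrt_continuous (s : R) : 0 < s -> {for s, continuous rsqrt}.
Proof.
move=> /is_derive_rsqrt d.
by apply: differentiable_continuous; apply/derivable1_diffP; exact: ex_derive.
Qed.

Lemma is_derive_sqr_norm y i :
  is_derive y (delta_mx 0 i) (fun y => dot y y) (2 * y 0 i).
Proof.
apply: (@is_derive_quad _ _ _ _ _ _ 1) => h.
rewrite dotDl !dotDr !dotZl !dotZr (dotC _ y) !dot_delta mxE !eqxx /= mulr1 mul1r.
rewrite (_ : _ - _ = h ^+ 2); last by ring.
by rewrite ger0_norm// sqr_ge0.
Qed.

Variables (x : E) (r : R).
Hypotheses (r_gt0 : 0 < r) (xr : enorm x != r).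

(** Off 0, [w] is 1 / |y| and [q] is |x - r y / |y||^2, so [u] is the radial extension of the
    reciprocal distance. *)
Let w y := rsqrt (dot y y).
Let q y := dot x x + r ^+ 2 - 2 * r * (dot x y * w y).
Let u y := rsqrt (q y).

Let wE y : y != 0 -> w y ^+ 2 * dot y y = 1.
Proof.
move=> y0; rewrite /w /rsqrt -/(enorm y) -sqr_enorm exprVn mulVf//.
by rewrite expf_neq0// gt_eqF// enorm_gt0.
Qed.

Let qE y : y != 0 -> q y = dot (x - (r * w y) *: y) (x - (r * w y) *: y).
Proof.
move=> y0; have := wE y0.
rewrite dotBl !dotBr !dotZl !dotZr (dotC y x) /q => h.
transitivity (dot x x + r ^+ 2 * (w y ^+ 2 * dot y y) - 2 * r * (dot x y * w y)); last by ring.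
by rewrite h mulr1.
Qed.

Let q_gt0 y : y != 0 -> 0 < q y.
Proof.
move=> y0; rewrite qE// dot_gt0 subr_eq0; apply: contra xr => /eqP ->.
rewrite enormZ gtr0_norm ?mulr_gt0 ?invr_gt0 ?sqrtr_gt0 ?dot_gt0//.
by rewrite -mulrA mulVf ?mulr1// gt_eqF// sqrtr_gt0 dot_gt0.
Qed.

(* The functions obtained by differentiating 1 / |x - r y / |y||. *)
Inductive alg : (E -> R) -> Prop :=
| alg_cst (c : R) : alg (fun=> c)
| alg_dot v : alg (dot v)
| alg_w : alg w
| alg_u : alg u
| algD f g : alg f -> alg g -> alg (fun y => f y + g y)
| algM f g : alg f -> alg g -> alg (fun y => f y * g y).

Lemma is_derive_dot v y i : is_derive y (delta_mx 0 i) (dot v) (v 0 i).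
Proof.
apply: (@is_derive_quad _ _ _ _ _ _ 0) => h.
by rewrite dotDr dotZr dot_delta addrK subrr normr0 mul0r.
Qed.

Let dw i y := - (2^-1 * w y ^+ 3) * (2 * y 0 i).

Let is_derive_w y i : y != 0 -> is_derive y (delta_mx 0 i) w (dw i y).
Proof.
move=> y0; apply: (is_derive_chain (f := fun y => dot y y)); last first.
  by apply: is_derive_rsqrt; rewrite dot_gt0.
exact: is_derive_sqr_norm.
Qed.

Let du i y := - (2^-1 * u y ^+ 3) * (- (2 * r) * (dot x y * dw i y + w y * x 0 i)).

Let is_derive_u y i : y != 0 -> is_derive y (delta_mx 0 i) u (du i y).
Proof.
move=> y0; apply: (is_derive_chain (f := q)); last first.
  by apply: is_derive_rsqrt; exact: q_gt0.
have d1 := is_deriveM (is_derive_dot x y i) (is_derive_w i y0).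
have d2 := is_deriveD (is_derive_cst (dot x x + r ^+ 2) y (delta_mx 0 i)) (is_deriveZ (- (2 *
  r)) d1).
rewrite (_ : q = cst (dot x x + r ^+ 2) + - (2 * r) \*: (dot x * w)); last first.
  by apply/funext => z; rewrite /q /= !fctE /= [_ *: _]mulNr.
by apply: (is_derive_eq d2); rewrite add0r.
Qed.

Lemma alg_derive f : alg f -> forall i, exists2 g, alg g &
  forall y, y != 0 -> is_derive y (delta_mx 0 i) f (g y).
Proof.
have alg_coord i : alg (fun y => y 0 i).
  rewrite (_ : (fun y => _) = dot (delta_mx 0 i)); first exact: alg_dot.
  by apply/funext => y; rewrite dotC dot_delta.
have algX g n : alg g -> alg (fun y => g y ^+ n).
  move=> ag; elim: n => [|n IH]; first exact: alg_cst.
  by rewrite (_ : (fun y => _) = (fun y => g y * g y ^+ n)); [exact: algM|apply/funext => y;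
    rewrite exprS].
have algV g : alg g -> alg (fun y => - (2^-1 * g y ^+ 3)).
  move=> ag; rewrite (_ : (fun y => _) = (fun y => - 2^-1 * g y ^+ 3)).
    by apply: algM; [exact: alg_cst|exact: algX].
  by apply/funext => y; rewrite mulNr.
have alg_dw i : alg (dw i).
  by apply: algM; [apply: algV; exact: alg_w|apply: algM => //; exact: alg_cst].
elim=> [c|v|||f1 f2 a1 d1 a2 d2|f1 f2 a1 d1 a2 d2] i.
- exists (fun=> 0); [exact: alg_cst|move=> y _; exact: is_derive_cst].
- exists (fun=> v 0 i); [exact: alg_cst|move=> y _; exact: is_derive_dot].
- by exists (dw i) => // y y0; exact: is_derive_w.
- exists (du i) => [|y y0]; last exact: is_derive_u.
  apply: algM; first by apply: algV; exact: alg_u.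
  apply: algM; first exact: alg_cst.
  apply: algD; first by apply: algM; [exact: alg_dot|].
  by apply: algM; [exact: alg_w|exact: alg_cst].
- have [g1 ag1 dg1] := d1 i; have [g2 ag2 dg2] := d2 i.
  exists (fun y => g1 y + g2 y); first exact: algD.
  by move=> y y0; apply: is_deriveD; [exact: dg1|exact: dg2].
- have [g1 ag1 dg1] := d1 i; have [g2 ag2 dg2] := d2 i.
  exists (fun y => f1 y * g2 y + f2 y * g1 y).
    by apply: algD; apply: algM.
  by move=> y y0; apply: is_deriveM; [exact: dg1|exact: dg2].
Qed.

Lemma alg_continuous f : alg f -> forall y, y != 0 -> {for y, continuous f}.
Proof.
have cdot v y : {for y, continuous (dot v)}.
  by apply: dot_continuous; [exact: contC|exact: contI].
have cw y : y != 0 -> {for y, continuous w}.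
  move=> y0; apply: (@contcomp _ _ _ (fun y => dot y y) rsqrt).
    by apply: dot_continuous; exact: contI.
  by apply: rsqrt_continuous; rewrite dot_gt0.
elim=> [c|v|||f1 f2 a1 d1 a2 d2|f1 f2 a1 d1 a2 d2] y y0 //.
- exact: contC.
- exact: cw.
- apply: (@contcomp _ _ _ q rsqrt); last by apply: rsqrt_continuous; exact: q_gt0.
  apply: (@contB _ _ _ (fun=> dot x x + r ^+ 2) (fun y => 2 * r * (dot x y * w y))).
    exact: contC.
  apply: (@contM _ _ (fun=> 2 * r)); first exact: contC.
  by apply: (@contM _ _ (dot x)) => //; exact: cw.
- by apply: (@contD _ _ _ f1 f2); [exact: d1|exact: d2].
- by apply: (@contM _ _ f1 f2); [exact: d1|exact: d2].
Qed.

Let near_neq0 y (P : E -> Prop) : y != 0 -> (forall z, z != 0 -> P z) -> \forall z \near y, P z.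
Proof.
move=> y0 h; have s0 z : sphere 0 z <-> z = 0.
  by rewrite /sphere /=; split => [/eqP|->]; [rewrite enorm_eq0 => /eqP|apply/eqP; rewrite
    enorm_eq0].
have : nbhs y (~` sphere 0).
  apply: open_nbhs_nbhs; split; first exact/closed_openC/sphere_closed.
  by move/s0/eqP; rewrite (negbTE y0).
by apply: filterS => z zs; apply: h; apply/eqP => /s0.
Qed.

(** Agreement off 0 is the form that the induction needs: the partial derivatives of g are
    identified with functions of [alg] only there. *)
Lemma cont_diff_alg n g f : alg f -> (forall y, y != 0 -> g y = f y) ->
  cont_diff n [set~ 0] g.
Proof.
elim: n g f => [|n IH] g f af gf.
  split => // y /eqP y0; apply: (cont_near_eq (W := f)); last exact: alg_continuous.
  exact: near_neq0.
split=> [y /eqP y0|i].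
  by apply: (cont_near_eq (W := f)); [exact: near_neq0|exact: alg_continuous].
have [h ah fh] := alg_derive af i.
have gh y : y != 0 -> is_derive y (delta_mx 0 i) g (h y).
  move=> y0; apply: (near_eq_is_derive _ (fh _ y0)).
  by apply: near_neq0 => // z z0; rewrite gf.
split=> [y /eqP y0|]; first by have [] := gh y y0.
by apply: (IH _ h) => // y y0; have [_] := gh y y0.
Qed.

Definition recip_dist y : R := (enorm (x - y))^-1.

Let recipE y : y != 0 -> radial_ext r recip_dist y = u y.
Proof.
by move=> y0; rewrite /radial_ext /recip_dist /u qE// /w /rsqrt -/(enorm y).
Qed.

Lemma recip_dist_smooth : smooth_on_sphere r recip_dist.
Proof. by move=> n; apply: cont_diff_alg recipE; exact: alg_u. Qed.

(** The vectors x and x - y have the same tangential part at y, namely x - (x . y / r ^ 2) y; the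
    gradient is the tangential part of (x - y) / |x - y|^3. *)
Lemma recip_dist_grad y : sphere r y ->
  surface_grad r recip_dist y = kap (dot (x - y) (x - y)) *: (x - (dot x y / r ^+ 2) *: y).
Proof.
have hr := r_gt0; move=> yr.
have y0 : y != 0 by rewrite -enorm_gt0 (yr : enorm y = r).
have wy : w y = r^-1 by rewrite /w /rsqrt -/(enorm y) (yr : enorm y = r).
have uy : u y ^+ 3 = kap (dot (x - y) (x - y)).
  rewrite /u qE// wy mulfV ?gt_eqF// scale1r /kap /rsqrt exprVn.
  by [].
apply/rowP => i; rewrite mxE.
have -> : 'D_'e_i (radial_ext r recip_dist) y = du i y.
  have d : is_derive y (delta_mx 0 i) (radial_ext r recip_dist) (du i y).
    apply: (near_eq_is_derive _ (is_derive_u i y0)).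
    by apply: near_neq0 => // z z0; rewrite recipE.
  exact: derive_val.
rewrite !mxE /du /dw wy uy; field; exact: lt0r_neq0.
Qed.

End reciprocal_distance.

(** * Integrals modulo null sets *)

Section ae_integrals.
Context d (T : measurableType d) (R : realType) (mu : {measure set T -> \bar R}).
Implicit Types (D A : set T) (f g : T -> R).

Lemma ae_eq_Rintegral D f g : measurable D -> measurable_fun D f ->
  measurable_fun D g -> {ae mu, forall y, D y -> f y = g y} ->
  \int[mu]_(y in D) f y = \int[mu]_(y in D) g y.
Proof.
move=> mD mf mg fg; rewrite /Rintegral; congr fine.
apply: ae_eq_integral => //; try exact/measurable_EFinP.
by apply: filterS fg => y h Dy; rewrite h.
Qed.

(** It switches between integrals over the sphere, as in the divergence condition, and over the set
    carrying the density. *)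
Lemma Rintegral_ae_support D A f : measurable D -> measurable A -> A `<=` D ->
  measurable_fun D f -> {ae mu, forall y, ~ A y -> f y = 0} ->
  \int[mu]_(y in D) f y = \int[mu]_(y in A) f y.
Proof.
move=> mD mA AD mf f0; rewrite /Rintegral; congr fine.
rewrite -(setIidr AD) integral_mkcondr; apply: ae_eq_integral => //.
- exact/measurable_EFinP.
- apply/measurable_restrict => //; apply/measurable_EFinP.
  by apply: measurable_funS mf => // y [].
- apply: filterS f0 => y h Dy; rewrite patchE; case: ifPn => // /negP Ay.
  by rewrite h// => Ay'; apply: Ay; rewrite inE.
Qed.

End ae_integrals.

(** * C^1 extension to the origin *)

Section smooth_extension.
Context {R : realType}.
Notation E := 'rV[R]_3.

Lemma C1_sqr_norm : C1 (fun y : E => dot y y) (fun i y => 2 * y 0 i).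
Proof.
split=> [x|i x|x i].
- by apply: dot_continuous; exact: contI.
- by apply: (@contM _ _ (fun=> 2)); [exact: contC|exact: coord_continuous].
- exact: is_derive_sqr_norm.
Qed.

(* Multiplying by a function of |y|^2 removes the singularity of the radial
   extension at 0; it only rescales tangential derivatives on the sphere. *)
Lemma C1_radial_cutoff (F : E -> R) (c : R) : 0 < c -> cont_diff 1 [set~ 0] F ->
  C1 (fun y => pos_sqr (dot y y - c) * F y)
    (fun i y => pos_sqr (dot y y - c) * 'D_(delta_mx 0 i) F y +
      F y * (2 * Num.max 0 (dot y y - c) * (2 * y 0 i))).
Proof.
move=> c0 [cF dF].
have [cX cG dX] := C1_pos_sqr (C1D C1_sqr_norm (C1_cst (- c))).
(* The cutoff vanishes on this neighbourhood of 0, so the product is 0 there whatever the values of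
   F. *)
have near0 : \forall y \near (0 : E), dot y y < c.
  have c1 : {for (0 : E), continuous (fun y : E => dot y y)}.
    by apply: dot_continuous; exact: contI.
  move: c1 => /cvgrPdist_lt/(_ c c0); apply: filterS => y.
  by rewrite dot0l sub0r normrN ger0_norm// dot_ge0.
have X0 y : dot y y < c -> Num.max 0 (dot y y - c) = 0.
  by move=> yc; rewrite max_l// subr_le0 ltW.
split=> [x|i x|x i].
- have [->|/eqP x0] := eqVneq x 0.
    apply: (cont_near_eq (W := fun=> 0)); last exact: contC.
    by apply: filterS near0 => y /X0 h; rewrite /pos_sqr h expr0n mul0r.
  by apply: (@contM _ _ (fun y => pos_sqr (dot y y - c))); [exact: cX|exact: cF].
- have [->|/eqP x0] := eqVneq x 0.
    apply: (cont_near_eq (W := fun=> 0)); last exact: contC.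
    by apply: filterS near0 => y /X0 h; rewrite /pos_sqr h expr0n /= !(mul0r, mulr0) addr0.
  have [_ [cdF _]] := dF i.
  apply: (@contD _ _ _ (fun y => pos_sqr (dot y y - c) * 'D_(delta_mx 0 i) F y)).
    by apply: (@contM _ _ (fun y => pos_sqr (dot y y - c))); [exact: cX|exact: cdF].
  apply: (@contM _ _ F); first exact: cF.
  rewrite (_ : (fun y => _ * _) = (fun y => 2 * Num.max 0 (dot y y - c) * (2 * y 0 i + 0))).
    exact: cG.
  by apply/funext => y; rewrite addr0.
- have [->|/eqP x0] := eqVneq x 0.
    rewrite X0 ?dot0l// !(mul0r, mulr0) addr0.
    apply: (near_eq_is_derive (f := fun=> 0)).
      by apply: filterS near0 => y /X0 h; rewrite /pos_sqr h expr0n mul0r.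
    by rewrite /pos_sqr max_l ?sub0r ?oppr_le0 ?(ltW c0)// expr0n mul0r; exact: is_derive_cst.
  have [dFi _] := dF i.
  have := is_deriveM (dX x i) (derivableP (dFi x x0)).
  by move=> d1; apply: (is_derive_eq d1); rewrite addr0.
Qed.

End smooth_extension.

(** * Densities whose potentials vanish *)

Section sphere_densities.
Context {R : realType}.
Notation E := 'rV[R]_3.
Variables (r : R) (F : set E).
Hypotheses (r_gt0 : 0 < r) (cF : closed F) (Fr : F `<=` sphere r).
Local Notation omega := (sphere_measure r).

Let mF : measurable F. Proof. exact: measurable_closed. Qed.
Let mS : measurable (sphere r : set E).
Proof. exact: measurable_sphere. Qed.

Lemma L2vec_integrable m (D : set E) i : measurable D -> L2vec r m ->
  omega.-integrable D (EFin \o (fun y => m y 0 i)).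
Proof. by move=> mD mL; apply: L2_integrable => //; exact: mL. Qed.

Lemma L2vec_measurable m (D : set E) i : measurable D -> L2vec r m ->
  measurable_fun D (fun y => m y 0 i).
Proof. by move=> mD /(L2vec_integrable i mD)/measurable_int/measurable_EFinP. Qed.

(** Off F, a point of the sphere has by definition of the support a neighbourhood where m vanishes
    almost everywhere, and a point off the sphere has a null one; [ae_cover] joins these local
    statements. *)
Lemma ess_suppP (m : E -> E) : L2vec r m ->
  ess_supp r m `<=` F <-> m = cst 0 %[ae omega in ~` F].
Proof.
move=> mL; split=> [supp|m0].
  apply: ae_cover => x Fx.
  have [xr|xr] := pselect (sphere r x); last first.
    exists (~` sphere r).
      by apply: open_nbhs_nbhs; split => //; exact/closed_openC/sphere_closed.
    by apply: filterS (ae_sphere r_gt0) => y yr.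
  have : ~ ess_supp r m x by move/supp.
  move=> /not_andP[//|/existsNP[U /not_implyP[xU /contrapT Um]]].
  by exists U.
move=> x [xr xU]; apply: contrapT => Fx; apply: (xU (~` F)) => //.
by apply: open_nbhs_nbhs; split => //; exact: closed_openC.
Qed.

Lemma poisson_injective h R0 : L2 r h ->
  (forall x, R0 < enorm x -> pot omega (sphere r) r h (fun=> 0) x = 0) ->
  h = cst 0 %[ae omega].
Proof.
move=> hL h_out.
have cS : closed (sphere r : set E) by exact: sphere_closed.
have ih := L2_integrable mS hL.
have i0 i : omega.-integrable (sphere r) (EFin \o (fun y : E => (0 : E) 0 i)).
  by apply: (eq_integrable mS (cst 0%E)); [move=> y _; rewrite /= mxE|exact: integrable0].
have S_sub : sphere r `<=` (sphere r : set E) by [].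
have mom xi k : \int[omega]_(y in sphere r) (h y * dot xi y ^+ k) = 0.
  by move: xi k; apply: moment_all => // xi k xi0; exact: poisson_moment h_out _ _ xi0.
have hC1 f G : C1 f G -> \int[omega]_(y in sphere r) (h y * f y) = 0.
  move=> [fc Gc fG]; have := Lam_C1 cS r_gt0 S_sub ih i0 (Lam_scalar_moment mom) fc Gc fG.
  move=> [_ <-]; apply: eq_Rintegral => y _.
  by rewrite dot0l addr0.
have := vanishing_density mS ih hC1.
apply: filterS2 (ae_sphere r_gt0) => y yr h0 _.
by have [] := h0 yr.
Qed.

Lemma measurable_surface_grad f i : smooth_on_sphere r f ->
  measurable_fun (sphere r) (fun y => surface_grad r f y 0 i).
Proof.
move=> /(_ 1%N)[_ /(_ i)[_ [cd _]]].
under eq_fun do rewrite mxE.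
apply: (@measurable_funS _ _ _ _ (~` sphere 0)).
- by apply: measurableC; exact: measurable_sphere.
- by move=> y yr y0; move: r_gt0; rewrite -yr y0 ltxx.
- apply: measurable_cont; first exact/closed_openC/sphere_closed.
  move=> y y0; apply: cd => yE; apply: y0; rewrite yE /sphere /=.
  by apply/eqP; rewrite enorm_eq0.
Qed.

Section dipole.
Variables (m : E -> E) (R0 : R).
Hypotheses (mL : L2vec r m) (m0 : m = cst 0 %[ae omega in ~` F])
  (m_out : forall x, R0 <= enorm x -> pot omega F r (fun=> 0) m x = 0)
  (m_in : forall x, enorm x < r -> pot omega F r (fun=> 0) m x = 0).

Let im i : omega.-integrable F (EFin \o (fun y => m y 0 i)).
Proof. exact: L2vec_integrable. Qed.

Let i0 : omega.-integrable F (EFin \o (fun y : E => 0 : R)).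
Proof. exact: integrable0. Qed.

(** The moments of the scalar density m . y vanish, so it annihilates all C^1 functions and is 0
    almost everywhere. *)
Lemma dipole_tangential : tangential r m.
Proof.
have ipos := integrable_position cF Fr im.
have mom xi k : \int[omega]_(y in F) (dot (m y) y * dot xi y ^+ k) = 0.
  move: xi k; apply: moment_all => // xi k xi0.
  by have [] := dipole_moment cF r_gt0 Fr im m_out m_in k xi0.
have z0 i : omega.-integrable F (EFin \o (fun y : E => (0 : E) 0 i)).
  by apply: (eq_integrable mF (cst 0%E)); [move=> y _; rewrite /= mxE|exact: integrable0].
have hC1 f G : C1 f G -> \int[omega]_(y in F) (dot (m y) y * f y) = 0.
  move=> [fc Gc fG]; have := Lam_C1 cF r_gt0 Fr ipos z0 (Lam_scalar_moment mom) fc Gc fG.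
  move=> [_ <-]; apply: eq_Rintegral => y _.
  by rewrite dot0l addr0.
have := vanishing_density mF ipos hC1.
apply: filterS2 m0 => y my h0.
have [Fy|Fy] := pselect (F y); first by have [] := h0 Fy.
by rewrite my// dot0l.
Qed.

Lemma dipole_div_free : weak_div_free r m.
Proof.
move=> f sf; have hr := r_gt0.
(* The cutoff level r ^ 2 / 2 excludes a ball around 0 and leaves a positive factor on the
   sphere. *)
have c0 : 0 < r ^+ 2 / 2 by rewrite divr_gt0// exprn_gt0.
have mom xi k : Lam omega F (fun=> 0) m (fun y => dot xi y ^+ k)
    (fun y => (k%:R * dot xi y ^+ k.-1) *: xi) = 0.
  move: xi k; apply: (Lam_vector_moment cF r_gt0 Fr im) => xi k xi0.
  by have [] := dipole_moment cF r_gt0 Fr im m_out m_in k xi0.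
have [fc Gc fG] := C1_radial_cutoff c0 (sf 1%N).
have [tf L0] := Lam_C1 cF r_gt0 Fr i0 im mom fc Gc fG.
have iL := Lam_integrable cF i0 im tf.
have mdot : measurable_fun (sphere r) (fun y => dot (surface_grad r f y) (m y)).
  apply: measurable_dot => i; first exact: measurable_surface_grad.
  exact: L2vec_measurable.
rewrite (Rintegral_ae_support mS mF Fr mdot); last first.
  by apply: filterS m0 => y my /my ->; rewrite dot0r.
pose k := pos_sqr (r ^+ 2 - r ^+ 2 / 2).
have k0 : k != 0.
  by rewrite /k /pos_sqr gt_eqF// exprn_gt0// lt_max; apply/orP; right; lra.
have iL' := integrable_scale mF k^-1 iL.
have mF' : measurable_fun F (fun y => dot (surface_grad r f y) (m y)) by exact: measurable_funS
  mdot.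
have mG := measurable_int _ iL'; move/measurable_EFinP in mG.
rewrite (ae_eq_Rintegral mF mF' mG); first by rewrite RintegralZl// [X in _ * X]L0 mulr0.
apply: filterS dipole_tangential => y ym Fy.
have yy : dot y y = r ^+ 2 by apply/(sphereE _ (ltW r_gt0)); exact: Fr.
(* On the sphere the gradient of the cut-off extension is k times the surface gradient plus the
   radial vector z y, which a tangential m does not see. *)
set z := radial_ext r f y * (2 * Num.max 0 (r ^+ 2 - r ^+ 2 / 2) * 2).
rewrite (_ : \row_i _ = k *: surface_grad r f y + z *: y); last first.
  by apply/rowP => i; rewrite !mxE yy -/k /z; ring.
by rewrite dotDr !dotZr ym mulr0 addr0 mul0r add0r mulKf// dotC.
Qed.

End dipole.

End sphere_densities.

(** * The operator expressed through [pot], and the nullspace *)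

Section potentials.
Context {R : realType}.
Notation E := 'rV[R]_3.
Implicit Types (x y : E) (m : E -> E) (h : E -> R).

Lemma Phi0E (F : set E) (r : R) m x :
  Phi0 F r m x = (4 * pi)^-1 * pot (sphere_measure r) F r (fun=> 0) m x.
Proof.
congr (_ * _); apply: eq_Rintegral => y _.
by rewrite kap_dot mul0r add0r.
Qed.

Lemma Phi1E (r : R) h x :
  Phi1 r h x = (4 * pi * r)^-1 * pot (sphere_measure r) (sphere r) r h (fun=> 0) x.
Proof.
congr (_ * _); apply: eq_Rintegral => y _.
by rewrite kap_dot dot0l addr0 sqr_enorm mulrA.
Qed.

Lemma PhiE (F : set E) (r1 r0 : R) m h : Phi F r1 r0 (m, h) = (fun x =>
  (4 * pi)^-1 * pot (sphere_measure r0) F r0 (fun=> 0) m x +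
  (4 * pi * r1)^-1 * pot (sphere_measure r1) (sphere r1) r1 h (fun=> 0) x).
Proof. by apply/funext => x; rewrite /Phi Phi0E Phi1E. Qed.

Lemma measurable_kap_sub (r : R) x : enorm x != r ->
  measurable_fun (sphere r) (fun y => kap (dot (x - y) (x - y))).
Proof.
move=> xr; have mS := @measurable_sphere R r.
apply: (measurable_comp_pos (f := fun y => dot (x - y) (x - y))) => //.
- by apply: measurable_dot => i; exact: measurable_sub_coord.
- by move=> y yr; rewrite dot_gt0 subr_eq0; apply: contra xr => /eqP ->; apply/eqP.
- by move=> z z0; exact: kap_continuous.
Qed.

Lemma Phi1_ae0 (r : R) h x : 0 < r -> L2 r h -> h = cst 0 %[ae sphere_measure r] ->
  enorm x != r -> Phi1 r h x = 0.
Proof.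
move=> r_gt0 hL h0 xr.
have mS := @measurable_sphere R r.
have mh : measurable_fun (sphere r) h.
  by have /measurable_int/measurable_EFinP := L2_integrable mS hL.
rewrite /Phi1 (@ae_eq_Rintegral _ _ _ _ _ _ (cst 0) mS).
- by rewrite Rintegral_cst// mul0r mulr0.
- apply: measurable_funM => //; apply: measurable_funM => //.
  exact: measurable_kap_sub.
- exact: measurable_cst.
- by apply: filterS h0 => y hy _; rewrite hy// mul0r.
Qed.

(** The condition |x| != r keeps the reciprocal distance smooth on the sphere, hence admissible as a
    test function for the weak divergence. *)
Lemma divfree_dipole (r : R) (F : set E) m x : 0 < r -> closed F -> F `<=` sphere r ->
  divfree_space r m -> m = cst 0 %[ae sphere_measure r in ~` F] ->
  enorm x != r -> pot (sphere_measure r) F r (fun=> 0) m x = 0.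
Proof.
move=> r_gt0 cF Fr [mL mt mdf] m0 xr.
have mF : measurable F by exact: measurable_closed.
have mS := @measurable_sphere R r.
have mm i := L2vec_measurable i mS mL.
have mk := measurable_kap_sub xr.
have mp : measurable_fun (sphere r) (fun y => ((fun=> 0) y * (dot x x - r ^+ 2) +
    dot (m y) (x - y)) * kap (dot (x - y) (x - y))).
  apply: measurable_funM => //; apply: measurable_funD; first exact: measurable_cst.
  by apply: measurable_dot => // i; exact: measurable_sub_coord.
rewrite /pot -(Rintegral_ae_support mS mF Fr mp); last first.
  by apply: filterS m0 => y my /my ->; rewrite dot0l mul0r add0r mul0r.
have sf := recip_dist_smooth r_gt0 xr.
rewrite -[RHS](mdf _ sf); apply: ae_eq_Rintegral => //.
  by apply: measurable_dot => // i; exact: measurable_surface_grad.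
apply: filterS mt => y my yr.
rewrite (recip_dist_grad r_gt0 xr yr) dotZl [dot (_ - _ *: _) _]dotBl dotZl [dot y (m y)]dotC
  my mulr0 subr0.
by rewrite mul0r add0r dotBr my subr0 dotC mulrC.
Qed.

End potentials.

Theorem theorem4p3 (R : realType) (r1 r0 r2 : R) (Gam : set 'rV[R]_3)
    (r1_gt0 : 0 < r1) (r1_lt_r0 : r1 < r0) (r0_lt_r2 : r0 < r2)
    (Gam_closed : closed Gam) (Gam_sub : Gam `<=` sphere r0)
    (Gam_neq : Gam <> sphere r0) :
  Phi_nullspace Gam r1 r0 r2 =
  [set dh | [/\ divfree_space r0 dh.1, ess_supp r0 dh.1 `<=` Gam &
    L2 r1 dh.2 /\ dh.2 = cst 0 %[ae sphere_measure r1]]].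
Proof.
have r0_gt0 := lt_trans r1_gt0 r1_lt_r0.
have r2_gt0 := lt_trans r0_gt0 r0_lt_r2.
have pi0 := @pi_gt0 R.
have k0_gt0 : 0 < (4 * pi)^-1 :> R by rewrite invr_gt0 mulr_gt0.
have k1_gt0 : 0 < (4 * pi * r1)^-1 by rewrite invr_gt0 !mulr_gt0.
have mGam : measurable Gam by exact: measurable_closed.
have cS : closed (sphere r1 : set 'rV[R]_3) by exact: sphere_closed.
have mS := @measurable_sphere R r1.
have S_sub : sphere r1 `<=` (sphere r1 : set 'rV[R]_3) by [].
apply/seteqP; split=> [[m h] [/= [mL m0] hL Phi_ae]|[m h] [/= md supp [hL h0]]].
  have i0 : (sphere_measure r0).-integrable Gam (EFin \o (fun _ : 'rV[R]_3 => 0 : R)).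
    exact: integrable0.
  have im i := L2vec_integrable i mGam mL.
  have ih := L2_integrable mS hL.
  have iz i : (sphere_measure r1).-integrable (sphere r1)
      (EFin \o (fun y : 'rV[R]_3 => ((fun=> 0) y : 'rV[R]_3) 0 i)).
    by apply: (eq_integrable mS (cst 0%E)); [move=> y _; rewrite /= mxE|exact: integrable0].
  (* Both potentials are continuous near |x| = r2, away from the spheres that carry the densities,
     so vanishing almost everywhere becomes vanishing everywhere. *)
  have Phi_eq0 x : enorm x = r2 ->
      (4 * pi)^-1 * pot (sphere_measure r0) Gam r0 (fun=> 0) m x +
      (4 * pi * r1)^-1 * pot (sphere_measure r1) (sphere r1) r1 h (fun=> 0) x = 0.
    move=> xr2; transitivity (Phi Gam r1 r0 (m, h) x); first by rewrite PhiE.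
    apply: (ae_sphere_eq0 r2_gt0 _ xr2); first by apply: filterS Phi_ae => y; apply.
    rewrite PhiE.
    apply: (@contD _ _ _ (fun x =>
      (4 * pi)^-1 * pot (sphere_measure r0) Gam r0 (fun=> 0) m x)).
      apply: (@contM _ _ (fun=> (4 * pi)^-1)); first exact: contC.
      apply: pot_continuous => //; first exact: ltW.
      by move=> /Gam_sub; rewrite /sphere /= xr2 => E; move: r0_lt_r2; rewrite E ltxx.
    apply: (@contM _ _ (fun=> (4 * pi * r1)^-1)); first exact: contC.
    apply: pot_continuous => //; first exact: ltW.
    rewrite /sphere /= xr2 => E.
    by move: (lt_trans r1_lt_r0 r0_lt_r2); rewrite E ltxx.
  have [in0 out0 out1] := potentials_vanish (ltW r1_gt0) r1_lt_r0 r0_lt_r2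
    Gam_closed cS Gam_sub S_sub Gam_neq i0 im ih iz Phi_eq0.
  have div0 (k z : R) : 0 < k -> k * z = 0 -> z = 0.
    by move=> kp /eqP; rewrite mulf_eq0 gt_eqF//= => /eqP.
  have m_in x : enorm x < r0 -> pot (sphere_measure r0) Gam r0 (fun=> 0) m x = 0.
    by move=> /in0; exact: div0.
  have m_out x : r2 <= enorm x -> pot (sphere_measure r0) Gam r0 (fun=> 0) m x = 0.
    by move=> /out0; exact: div0.
  have h_out x : r1 < enorm x -> pot (sphere_measure r1) (sphere r1) r1 h (fun=> 0) x = 0.
    by move=> /out1; exact: div0.
  split => /=.
  - split => //; first exact: dipole_tangential m_out m_in.
    exact: dipole_div_free m_out m_in.
  - exact/ess_suppP.
  - by split => //; exact: poisson_injective h_out.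
have [mL _ _] := md.
have m0 : m = cst 0 %[ae sphere_measure r0 in ~` Gam] by exact/ess_suppP.
split => //=.
apply: filterS (ae_sphere r2_gt0) => x xr2 _.
rewrite /Phi /= Phi0E divfree_dipole//; last by rewrite (xr2 : enorm x = r2) gt_eqF.
rewrite mulr0 add0r Phi1_ae0// (xr2 : enorm x = r2) gt_eqF//.
exact: lt_trans r0_lt_r2.
Qed.
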